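(* Assume that $g:\mathbb R^N\to\mathbb R$ is bounded and continuous, that $(\mathbf H_\Omega)$ holds and that (C1)--(C4) hold (see context). Let $\phi\in C^1(\mathcal H\times[0,T])$ and suppose that $(x,t)$, with $x\in\mathcal H$ and $t\in(0,T)$, is a minimum point of $(z,s)\mapsto(\mathbf U^+)_*(z,s)-\phi(z,s)$ in $\mathcal H\times[0,T]$. Then at least one of the following holds: A) there exist $\eta\in(0,t]$, $i\in\{1,2\}$ and a control $\alpha_i(\cdot)\in L^\infty(0,\eta;A_i)$ such that the trajectory $Y$ solving $\dot Y(s)=b_i(Y(s),t-s,\alpha_i(s))$ for a.e. $s\in(0,\eta)$, $Y(0)=x$, satisfies $Y(s)\in\Omega_i$ for all $s\in(0,\eta]$ and $$(\mathbf U^+)_*(x,t)\ \ge\ \int_0^\eta l_i(Y(s),t-s,\alpha_i(s))\,ds+(\mathbf U^+)_*(Y(\eta),t-\eta);$$ B) $\ \partial_t\phi(x,t)+H_T^{\rm reg}(x,t,D_{\mathcal H}\phi(x,t))\ge0.$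
   Context: Geometry $(\mathbf H_\Omega)$: $\mathbb R^N=\Omega_1\cup\Omega_2\cup\mathcal H$, where $\Omega_1,\Omega_2$ are disjoint open sets and $\mathcal H=\partial\Omega_1=\partial\Omega_2$ is a $W^{2,\infty}$-hypersurface (the signed distance to $\mathcal H$ is $W^{2,\infty}$ in a neighbourhood of $\mathcal H$). For $z\in\mathcal H$, $\mathbf n_i(z)$ is the unit normal to $\partial\Omega_i$ at $z$ pointing outwards $\Omega_i$. $D_{\mathcal H}$ is the tangential gradient on $\mathcal H$, $T_z\mathcal H$ the tangent space. Control data: $T>0$; for $i=1,2$, $b_i:\overline{\Omega_i}\times[0,T]\times A_i\to\mathbb R^N$, $l_i:\overline{\Omega_i}\times[0,T]\times A_i\to\mathbb R$. (C1) $A_i$ is a compact metric space, $b_i$ is continuous, $|b_i|\le M_b$ and $|b_i(z,s,\alpha_i)-b_i(z',s',\alpha_i)|\le L_b(|z-z'|+|s-s'|)$. (C2) $l_i$ is uniformly continuous, $|l_i|\le M_l$, and $|l_i(z,s,\alpha_i)-l_i(z',s',\alpha_i)|\le m_l(|z-z'|+|s-s'|)$ for a modulus of continuity $m_l$. (C3) For all $z\in\overline{\Omega_i}$, $s\in[0,T]$, the set $\{(b_i(z,s,\alpha_i),l_i(z,s,\alpha_i)):\alpha_i\in A_i\}$ is closed and convex. (C4) There is $\delta>0$ such that for $i=1,2$, $z\in\mathcal H$, $s\in[0,T]$: $\{b_i(z,s,\alpha_i)\cdot\mathbf n_i(z):\alpha_i\in A_i\}\supset[-\delta,\delta]$. Interface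 dynamics: $A:=A_1\times A_2\times[0,1]$; for $z\in\mathcal H$, $a=(\alpha_1,\alpha_2,\mu)\in A$, $b_{\mathcal H}(z,s,a)=\mu b_1(z,s,\alpha_1)+(1-\mu)b_2(z,s,\alpha_2)$, $l_{\mathcal H}(z,s,a)=\mu l_1(z,s,\alpha_1)+(1-\mu)l_2(z,s,\alpha_2)$; $A_0^{\rm reg}(z,s)=\{a\in A: b_{\mathcal H}(z,s,a)\cdot\mathbf n_1(z)=0,\ b_i(z,s,\alpha_i)\cdot\mathbf n_i(z)\ge0,\ i=1,2\}$. For $x\in\mathcal H$, $p\in T_x\mathcal H$: $H_T^{\rm reg}(x,t,p)=\sup_{a\in A_0^{\rm reg}(x,t)}\{-b_{\mathcal H}(x,t,a)\cdot p-l_{\mathcal H}(x,t,a)\}$. Value function: for $(x,t)\in\mathbb R^N\times[0,T)$, $\mathcal T^{\rm reg}_{x,t}$ is the set of pairs $(X,a)$ with $X:[0,t]\to\mathbb R^N$ Lipschitz, $X(0)=x$, $a=(\alpha_1,\alpha_2,\mu)\in L^\infty(0,t;A)$, such that for a.e. $s\in(0,t)$, $\dot X(s)=\sum_{i}b_i(X(s),t-s,\alpha_i(s))\mathbf 1_{\{X(s)\in\Omega_i\}}+b_{\mathcal H}(X(s),t-s,a(s))\mathbf 1_{\{X(s)\in\mathcal H\}}$, and $a(s)\in A_0^{\rm reg}(X(s),t-s)$ for a.e. $s$ with $X(s)\in\mathcal H$. Then $\mathbf U^+(x,t)=\inf_{(X,a)\in\mathcal T^{\rm reg}_{x,t}}\Big\{\int_0^t\ell(X(s),t-s,a(s))\,ds+g(X(t))\Big\}$,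 where $\ell(X(s),t-s,a(s))=\sum_i l_i(X(s),t-s,\alpha_i(s))\mathbf 1_{\{X(s)\in\Omega_i\}}+l_{\mathcal H}(X(s),t-s,a(s))\mathbf 1_{\{X(s)\in\mathcal H\}}$. $(\mathbf U^+)_*(x,t)=\liminf_{(z,s)\to(x,t)}\mathbf U^+(z,s)$ is the lower semicontinuous envelope. *)

(* Defs.v *)
From HB Require Import structures.
From mathcomp Require Import all_boot all_order all_algebra.
From mathcomp Require Import all_classical all_reals all_analysis.

Set Implicit Arguments.
Unset Strict Implicit.
Unset Printing Implicit Defensive.

Import Order.TTheory GRing.Theory Num.Theory.
Import numFieldNormedType.Exports.

Local Open Scope classical_set_scope.
Local Open Scope ring_scope.

(* The norm of 'rV[R]_N in the library is the sup norm; quantitative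
   hypotheses and distances are stated with the Euclidean norm below. *)
Section euclidean.
Context {R : realType} {N : nat}.
Implicit Types u v : 'rV[R]_N.

Definition dot u v : R := \sum_(i < N) u 0 i * v 0 i.

Definition enorm u : R := Num.sqrt (dot u u).

Definition edist (S : set 'rV[R]_N) u : R := inf [set enorm (u - v) | v in S].

End euclidean.

Definition C1 {R : realType} {V : normedModType R} (U : set V) (f : V -> R) :=
  (forall q, U q -> differentiable f q) /\
  (forall v, {within U, continuous (fun q => 'D_v f q)}).

Section sobolev.
Context {R : realType}.

(* Iterated Lebesgue integral over R^n; by Fubini, the Lebesgue integral of an
   integrable Borel function. *)
Fixpoint integral_rV (n : nat) : ('rV[R]_n -> R) -> R :=
  match n with
  | 0 => fun f => f 0
  | m.+1 => fun f => \int[lebesgue_measure]_x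
      integral_rV (fun v : 'rV[R]_m => f (row_mx (x%:M : 'rV[R]_1) v))
  end.

Context {N : nat}.
Local Notation E := 'rV[R]_N.
Implicit Types (V : set E) (f g psi : E -> R).

(* Test functions are C^1 with compact support, as in Gilbarg-Trudinger; by
   mollification this gives the same first-order weak derivatives as C^oo_c. *)
Definition test_function V psi :=
  [/\ C1 setT psi, compact (closure [set z | psi z != 0]) &
      closure [set z | psi z != 0] `<=` V].

(* [g] is the weak i-th partial derivative of [f] in the open set [V] *)
Definition weak_partial V (i : 'I_N) f g :=
  forall psi, test_function V psi ->
    integral_rV (fun z => f z * 'D_('e_i) psi z) =
    - integral_rV (fun z => g z * psi z).

(* Every class in L^oo has an everywhere bounded Borel representative. *)
Definition bounded_borel V f :=
  measurable_fun (V : set (g_sigma_algebraType (@open E))) f /\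
  exists M, forall z, V z -> `|f z| <= M.

(* the Sobolev space W^{k,oo}(V) *)
Fixpoint sobolev_oo (k : nat) V f : Prop :=
  bounded_borel V f /\
  if k is k'.+1 then
    forall i, exists2 g, weak_partial V i f g & sobolev_oo k' V g
  else True.

End sobolev.

Section geometry.
Context {R : realType} {N : nat}.
Local Notation E := 'rV[R]_N.
Implicit Types (Om H : set E) (z n v p : E).

Definition boundary Om : set E := closure Om `\` interior Om.

Definition signed_dist (Om1 Om2 H : set E) z : R :=
  (\1_Om1 z - \1_Om2 z) * edist H z.

Definition W2oo_hypersurface (Om1 Om2 H : set E) :=
  exists V : set E,
    [/\ open V, H `<=` V & sobolev_oo 2 V (signed_dist Om1 Om2 H)].

Definition hyp_Omega (Om1 Om2 H : set E) :=
  [/\ [set: E] = Om1 `|` Om2 `|` H,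
      [/\ open Om1, open Om2 & Om1 `&` Om2 = set0],
      H = boundary Om1, H = boundary Om2 &
      W2oo_hypersurface Om1 Om2 H].

Definition curve_in H z (gamma : R -> E) v :=
  [/\ gamma 0 = z, \forall s \near 0, H (gamma s) & is_derive (0 : R) 1 gamma v].

Definition tangent_space H z : set E :=
  [set v | exists gamma, curve_in H z gamma v].

Definition outward_unit_normal Om z n :=
  [/\ enorm n = 1,
      forall v, tangent_space (boundary Om) z v -> dot n v = 0 &
      \forall h \near 0^'+, ~ closure Om (z + h *: n)].

(* the tangent vector representing the differential of [f] along [H] at [z] *)
Definition is_tangential_gradient H (f : E -> R) z p :=
  tangent_space H z p /\
  forall gamma v, curve_in H z gamma v ->
    is_derive (0 : R) 1 (f \o gamma) (dot p v).

Definition tangential_gradient H (f : E -> R) z : E :=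
  xget 0 [set p | is_tangential_gradient H f z p].

(* [phi] is of class C^1 on the manifold [H] times [0, T]: locally the
   restriction of a C^1 function of the ambient space. *)
Definition C1_on_interface H (T : R) (phi : E -> R -> R) :=
  forall z s, H z -> s \in `[0, T] ->
    exists (U : set (E * R)) (psi : E * R -> R),
      [/\ open U, U (z, s), C1 U psi &
          forall z' s', U (z', s') -> H z' -> s' \in `[0, T] ->
            psi (z', s') = phi z' s'].

End geometry.

Section control_hypotheses.
Context {R : realType} {N : nat}.
Local Notation E := 'rV[R]_N.
Variables (T : R) (Om : set E) (A : metricType R).
Implicit Types (b : E -> R -> A -> E) (l : E -> R -> A -> R).

(* [b] and [l] are total, but only their values on this set are constrained *)
Definition ctrl_domain : set (E * R * A) :=
  [set p | closure Om p.1.1 /\ p.1.2 \in `[0, T]].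

Definition modulus_of_continuity (m : R -> R) :=
  [/\ m 0 = 0, {in `[0, +oo[ &, {homo m : r r' / r <= r'}} & m @ 0^'+ --> (0 : R)].

Definition hyp_C1 b (Mb Lb : R) :=
  [/\ compact [set: A],
      {within ctrl_domain, continuous (fun p : E * R * A => b p.1.1 p.1.2 p.2)},
      forall z s a, ctrl_domain (z, s, a) -> enorm (b z s a) <= Mb &
      forall z s z' s' a, ctrl_domain (z, s, a) -> ctrl_domain (z', s', a) ->
        enorm (b z s a - b z' s' a) <= Lb * (enorm (z - z') + `|s - s'|)].

Definition hyp_C2 l (Ml : R) (ml : R -> R) :=
  [/\ forall e, 0 < e -> exists2 d, 0 < d &
        forall p q : E * R * A, ctrl_domain p -> ctrl_domain q -> ball p d q ->
          `|l p.1.1 p.1.2 p.2 - l q.1.1 q.1.2 q.2| < e,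
      forall z s a, ctrl_domain (z, s, a) -> `|l z s a| <= Ml,
      modulus_of_continuity ml &
      forall z s z' s' a, ctrl_domain (z, s, a) -> ctrl_domain (z', s', a) ->
        `|l z s a - l z' s' a| <= ml (enorm (z - z') + `|s - s'|)].

Definition hyp_C3 b l :=
  forall z s, closure Om z -> s \in `[0, T] ->
    let BL := [set (b z s a, l z s a) | a in [set: A]] : set (E * R) in
    closed BL /\ convex_set BL.

Definition hyp_C4 (H : set E) (n : E -> E) b (delta : R) :=
  forall z s, H z -> s \in `[0, T] ->
    [set` `[- delta, delta]] `<=` [set dot (b z s a) (n z) | a in [set: A]].

End control_hypotheses.

(* [a] represents a class in L^oo(0, t; A), when [A] is bounded and separable:
   such a class of Lebesgue measurable functions contains a Borel one. *)
Definition control {R : realType} (A : topologicalType) (t : R) (a : R -> A) :=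
  forall O, open O -> measurable ([set` `]0, t[] `&` a @^-1` O).

Section value_function.
Context {R : realType} {N : nat}.
Local Notation E := 'rV[R]_N.
Variables (Om1 Om2 H : set E) (n1 n2 : E -> E) (A1 A2 : metricType R).
Variables (b1 : E -> R -> A1 -> E) (b2 : E -> R -> A2 -> E).
Variables (l1 : E -> R -> A1 -> R) (l2 : E -> R -> A2 -> R).
Local Notation A12 := (A1 * A2 * R)%type.
Implicit Types (z x p : E) (s t : R) (a : A12) (X : R -> E) (c : R -> A12).

Definition ctrl_set : set A12 := [set a | 0 <= a.2 <= 1].

Definition bH z s a : E := a.2 *: b1 z s a.1.1 + (1 - a.2) *: b2 z s a.1.2.

Definition lH z s a : R := a.2 * l1 z s a.1.1 + (1 - a.2) * l2 z s a.1.2.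

Definition A0reg z s : set A12 :=
  [set a | [/\ ctrl_set a, dot (bH z s a) (n1 z) = 0,
               0 <= dot (b1 z s a.1.1) (n1 z) &
               0 <= dot (b2 z s a.1.2) (n2 z)]].

Definition HTreg x t p : \bar R :=
  ereal_sup [set (- dot (bH x t a) p - lH x t a)%:E | a in A0reg x t].

Definition dynamics z s a : E :=
  \1_Om1 z *: b1 z s a.1.1 + \1_Om2 z *: b2 z s a.1.2 + \1_H z *: bH z s a.

Definition running_cost z s a : R :=
  \1_Om1 z * l1 z s a.1.1 + \1_Om2 z * l2 z s a.1.2 + \1_H z * lH z s a.

Definition Treg x t : set ((R -> E) * (R -> A12)) :=
  [set Xc | let: (X, c) := Xc in
    [/\ [lipschitz X s | s in [set` `[0, t]]] /\ X 0 = x,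
        control t c /\ (forall s, s \in `]0, t[ -> ctrl_set (c s)),
        \forall s \ae lebesgue_measure, s \in `]0, t[ ->
          is_derive s 1 X (dynamics (X s) (t - s) (c s)) &
        \forall s \ae lebesgue_measure, s \in `]0, t[ -> H (X s) ->
          A0reg (X s) (t - s) (c s)]].

Definition total_cost (g : E -> R) t (Xc : (R -> E) * (R -> A12)) : R :=
  (\int[lebesgue_measure]_(s in `[0, t]) running_cost (Xc.1 s) (t - s) (Xc.2 s))
  + g (Xc.1 t).

Definition Uplus (g : E -> R) x t : \bar R :=
  ereal_inf [set (total_cost g t Xc)%:E | Xc in Treg x t].

(* Lower semicontinuous envelope of [Uplus], which is a function on
   R^N x [0, T[; it is evaluated at points of R^N x [0, T]. *)
Definition Uplus_lsc (T : R) (g : E -> R) x t : \bar R :=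
  limf_einf (fun q : E * R => Uplus g q.1 q.2)
    (within [set q | q.2 \in `[0, T[] (nbhs (x, t))).

End value_function.

Section one_sided.
Context {R : realType} {N : nat} {A : metricType R}.
Local Notation E := 'rV[R]_N.

(* A trajectory that leaves [x] and stays in [Om] on ]0, eta], along which [U]
   satisfies the superoptimality inequality. *)
Definition superoptimal_into (Om : set E) (b : E -> R -> A -> E)
    (l : E -> R -> A -> R) (U : E -> R -> \bar R) (x : E) (t : R) :=
  exists (eta : R) (alpha : R -> A) (Y : R -> E),
    [/\ eta \in `]0, t] /\ control eta alpha,
        [/\ [lipschitz Y s | s in [set` `[0, eta]]], Y 0 = x &
            \forall s \ae lebesgue_measure, s \in `]0, eta[ ->
              is_derive s 1 Y (b (Y s) (t - s) (alpha s))],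
        forall s, s \in `]0, eta] -> Om (Y s) &
        (((\int[lebesgue_measure]_(s in `[0, eta])
             l (Y s) (t - s) (alpha s))%R)%:E + U (Y eta) (t - eta)%R
         <= U x t)%E].

End one_sided.

(* Main.v *)
(* A function with bounded weak second derivatives has second differences
   f(z) - f(z + s e_i) - f(z + r e_j) + f(z + s e_i + r e_j) = O(s r), as one sees
   by testing its second weak derivative against tensor products of B-splines.
   Hence the signed distance f to the interface has a second order expansion, its
   gradient is a unit vector field G, and n_1 = - G, n_2 = G on the interface.

   Along an ultrafilter, near-optimal trajectories for points (z, s) realizing
   the envelope at (x, t), paired with their accumulated costs, converge to a
   Lipschitz pair (X, L) with
     U_*(x, t) >= L(s) + U_*(X(s), t - s).
   If X leaves the interface at once, it stays in one Omega_i on some (0, eta]; by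
   convexity (X', L') lies there in the compact set of pairs (b_i, l_i), and a
   measurable selection of controls gives A. Otherwise X returns to the interface
   at arbitrarily small times s. If B fails, there are multipliers m_1, m_2 with
   m_1 + m_2 >= 0 such that p . X + m_1 f^+ + m_2 f^- + L, where p is the
   tangential gradient of phi, grows at a rate larger than d_t phi along all
   admissible trajectories near (x, t), hence also along the limit. As f vanishes
   at X(s), this contradicts the inequality above and the minimality of
   U_* - phi. *)

Require Import Defs.
From HB Require Import structures.
From mathcomp Require Import all_boot all_order all_algebra.
From mathcomp Require Import all_classical all_reals all_analysis.
From mathcomp Require Import measurable_realfun.
From mathcomp Require Import ring lra.

Set Implicit Arguments.
Unset Strict Implicit.
Unset Printing Implicit Defensive.

Import Order.TTheory GRing.Theory Num.Theory.
Import numFieldNormedType.Exports.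

Local Open Scope classical_set_scope.
Local Open Scope ring_scope.


(** * Lipschitz functions of one variable *)

(** The difficulty is the interface: the limit trajectory may run along H while its approximations
    move on either side, so no control of the limit is identified there. Only scalar growth
    inequalities go to the limit. They hold almost everywhere along the approximations, are
    integrated there, and then involve values of (X, L) alone. Inside Omega_i this is enough,
    because linear growth bounds determine a compact convex set. Near H the sum p . X + L alone has
    no such bound, since regularity constrains the normal velocity only on H itself; the kinked
    terms m_1 f^+ + m_2 f^- compensate for it and, vanishing on H, do not enter the comparison with
    phi. Their slopes come from supporting, on each side, the convex set of pairs (normal velocity,
    excess over the rate): failure of B makes opposite slopes add up to at least 0, and (C4) keeps
    them finite. Integration of almost everywhere inequalities rests on one covering argument, which
    also gives speed bounds and the uniqueness of primitives. *)

Section dder.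
Context {R : realType} {V : normedModType R}.
Implicit Types (F : R -> V) (s : R) (d : V).

(** The difference quotient is multiplied out, which admits [h = 0] and exposes the radius [r], so
    that several derivatives combine by taking a minimum of radii. *)
Definition dder F s d := forall e : R, 0 < e -> exists2 r : R, 0 < r &
  forall h : R, `|h| < r -> `|F (s + h) - F s - h *: d| <= e * `|h|.

Lemma dderP F s d : is_derive s 1 F d <-> dder F s d.
Proof.
have E : (h^-1 *: (F (h *: 1 + s) - F s) @[h --> 0^'] --> d) <-> dder F s d.
  split.
    move=> /cvgrPdist_le H e e0.
    have [r /= r0 Hr] := H e e0.
    exists r => // h hr.
    have [->|h0] := eqVneq h 0.
      by rewrite addr0 subrr scale0r subr0 normr0 normr0 mulr0.
    have := Hr h; rewrite /ball/= sub0r normrN => /(_ hr h0).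
    rewrite [h *: 1]mulr1 => Hd.
    have -> : F (s + h) - F s - h *: d = - h *: (d - h^-1 *: (F (h + s) - F s)).
      rewrite scaleNr [in RHS]scalerBr scalerA divff// scale1r opprB.
      by rewrite [h + s]addrC.
    by rewrite normrZ normrN mulrC ler_pM2r ?normr_gt0.
  move=> H; apply/cvgrPdist_le => e e0.
  have [r r0 Hr] := H e e0.
  exists r => //= h; rewrite /ball/= sub0r normrN => hr h0.
  have := Hr h hr; rewrite [h *: 1]mulr1 => Hd.
  have -> : d - h^-1 *: (F (h + s) - F s) = - h^-1 *: (F (s + h) - F s - h *: d).
    rewrite scaleNr [in RHS]scalerBr scalerA mulVf// scale1r opprB.
    by rewrite [h + s]addrC.
  rewrite normrZ normrN normfV mulrC ler_pdivrMr ?normr_gt0//.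
split=> [[H1 H2]|/E H].
  apply/E; move: H1 => /cvg_ex[l Hl].
  by rewrite -H2 /derive (cvg_lim _ Hl)//; exact: norm_hausdorff.
split; first by apply/cvg_ex; exists d.
by apply: cvg_lim; [exact: norm_hausdorff|exact: H].
Qed.

Lemma dder_eq F G s d (r : R) : 0 < r ->
  (forall h, `|h| < r -> F (s + h) = G (s + h)) -> dder F s d -> dder G s d.
Proof.
move=> r0 FG H e /H[r' r'0 Hr']; exists (Num.min r r'); first by rewrite lt_min r0.
move=> h; rewrite lt_min => /andP[hr hr'].
rewrite -FG// -[G s](_ : F s = _); first exact: Hr'.
by rewrite -[s]addr0 FG// normr0.
Qed.

Lemma dderD F G s d d' : dder F s d -> dder G s d' ->
  dder (fun z => F z + G z) s (d + d').
Proof.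
move=> HF HG e e0; have e20 : 0 < e / 2 by rewrite divr_gt0.
have [r r0 Hr] := HF _ e20; have [r' r'0 Hr'] := HG _ e20.
exists (Num.min r r'); first by rewrite lt_min r0.
move=> h; rewrite lt_min => /andP[hr hr'].
have -> : F (s + h) + G (s + h) - (F s + G s) - h *: (d + d') =
    (F (s + h) - F s - h *: d) + (G (s + h) - G s - h *: d').
  by rewrite scalerDr !opprD [in RHS]addrACA [X in _ = X + _]addrACA.
apply: le_trans (ler_normD _ _) _.
have := Hr h hr; have := Hr' h hr'; lra.
Qed.

Lemma dderZ F s d (c : R) : dder F s d -> dder (fun z => c *: F z) s (c *: d).
Proof.
move=> HF e e0; have c1 : 0 < `|c| + 1 by have := normr_ge0 c; lra.
have [r r0 Hr] := HF _ (divr_gt0 e0 c1); exists r => // h hr.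
rewrite scalerA mulrC -scalerA -!scalerBr normrZ.
apply: (@le_trans _ _ ((`|c| + 1) * (e / (`|c| + 1) * `|h|))); last first.
  by rewrite mulrA mulrCA divff ?gt_eqF// mulr1.
apply: ler_pM => //; first by lra.
exact: Hr.
Qed.

Lemma dder_cst (c : V) s : dder (fun=> c) s 0.
Proof. by move=> e e0; exists 1 => // h _; rewrite subrr scaler0 subr0 normr0 mulr_ge0// ltW. Qed.

Lemma dder_unique F s d d' : dder F s d -> dder F s d' -> d = d'.
Proof. by move=> /dderP[_ <-] /dderP[_ <-]. Qed.

End dder.

Lemma dder_id (R : realType) (s : R) : dder id s 1.
Proof.
move=> e e0; exists 1 => // h _.
by rewrite [s + h]addrC addrK [h *: _]mulr1 subrr normr0 mulr_ge0// ltW.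
Qed.

Section lipschitz_real.
Context {R : realType}.
Local Notation mu := (@lebesgue_measure R).
Implicit Types (F : R -> R) (a b c L s : R) (Z : set R).

(** The constant is explicit because bounds uniform over a sequence of trajectories have to survive
    in the limit. Its sign is free, hence [|L|] in the estimates. *)
Definition lipon (V : normedModType R) L a b (F : R -> V) :=
  forall s s' : R, a <= s <= b -> a <= s' <= b -> `|F s - F s'| <= L * `|s - s'|.

(** Continuous induction: the supremum of the points where [F] is at least [F a] belongs to this set
    by continuity, and below [b] it could be passed. *)
Lemma right_nondecreasing F L a b : lipon L a b F -> a <= b ->
  (forall s, a <= s < b -> exists2 r : R, 0 < r &
     forall h : R, 0 < h < r -> s + h <= b -> F s <= F (s + h)) ->
  F a <= F b.
Proof.
move=> FL ab H.
pose S : set R := [set s | a <= s <= b /\ F a <= F s].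
have Sa : S a by split; rewrite // lexx.
have ubS : has_sup S by split; [exists a|exists b => s [/andP[]]].
set m := sup S.
have am : a <= m by apply: ub_le_sup => //; case: ubS.
have mb : m <= b by apply: ge_sup; [exists a|move=> s [/andP[]]].
have L0 : 0 <= `|L| by [].
have Fm : F a <= F m.
  apply/ler_addgt0Pr => e e0.
  have e'0 : 0 < e / (`|L| + 1) by rewrite divr_gt0// ltr_wpDl.
  have [s [/andP[as_ sb] FS] ms] := sup_adherent e'0 ubS.
  rewrite -/m in ms.
  have sm : s <= m by apply: ub_le_sup; [case: ubS|split; rewrite ?as_ ?sb].
  have := FL s m; rewrite as_ sb am mb => /(_ isT isT).
  have : `|s - m| <= e / (`|L| + 1).
    by rewrite ler0_norm ?subr_le0// opprB; lra.
  move=> h1 h2.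
  have h3 : L * `|s - m| <= e.
    apply: (@le_trans _ _ (`|L| * `|s - m|)).
      by rewrite ler_wpM2r// ler_norm.
    apply: (@le_trans _ _ ((`|L| + 1) * `|s - m|)).
      by rewrite ler_wpM2r// lerDl.
    by rewrite mulrC -ler_pdivlMr// ltr_wpDl.
  have := ler_norm (F s - F m); lra.
have [mltb|] := ltP m b; last first.
  by move=> bm; suff -> : b = m by []; apply/eqP; rewrite eq_le bm mb.
have /H[r r0 Hr] : a <= m < b by rewrite am mltb.
pose h := Num.min (r / 2) (b - m).
have h0 : 0 < h by rewrite lt_min divr_gt0//= subr_gt0.
have hr : h < r by rewrite gt_min; apply/orP; left; lra.
have hb : m + h <= b by rewrite -lerBrDl ge_min lexx orbT.
have := Hr h; rewrite h0 hr => /(_ isT hb) Fmh.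
have : S (m + h).
  split; last exact: le_trans Fmh.
  by rewrite hb andbT; lra.
move=> /(ub_le_sup (proj2 ubS)); rewrite -/m; lra.
Qed.

Lemma negligible_open_cover Z e : mu.-negligible Z -> 0 < e ->
  exists W : set R, [/\ open W, Z `<=` W & (mu W < e%:E)%E].
Proof.
move=> [B [mB muB0 ZB]] e0.
have muB : (mu B < +oo)%E by rewrite muB0 ltey.
have [U [oU BU HU]] := lebesgue_regularity_outer mB muB e0.
exists U; split=> //; first exact: subset_trans BU.
have -> : U = B `|` (U `\` B) by rewrite setDUK.
apply: (@le_lt_trans _ _ (mu B + mu (U `\` B))%E).
  by apply: measureU2 => //; apply: measurableD => //; exact: open_measurable.
by rewrite muB0 add0e.
Qed.

Let mule (A B : set R) : measurable A -> measurable B -> A `<=` B ->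
  (mu A <= mu B)%E.
Proof. by move=> mA mB AB; apply: le_measure; rewrite ?inE. Qed.

Let muleU2 (A B : set R) : measurable A -> measurable B ->
  (mu (A `|` B) <= mu A + mu B)%E.
Proof. by move=> mA mB; apply: measureU2. Qed.

Let muU (A B : set R) : measurable A -> measurable B -> A `&` B = set0 ->
  mu (A `|` B) = (mu A + mu B)%E.
Proof. by move=> mA mB AB; apply: measureU. Qed.

Let muoc s h : 0 < h -> mu `]s, s + h]%classic = h%:E.
Proof.
by move=> h0; rewrite lebesgue_measure_itv/= lte_fin ltrDl h0 -EFinD; congr EFin; lra.
Qed.

(* The null set is covered by an open set of small measure; adding a multiple
   of the measure of its trace on [[a, s]] repairs the possible decrease there. *)
Lemma lipschitz_growth F L a b c Z : lipon L a b F -> a <= b ->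
  mu.-negligible Z ->
  (forall s, a < s < b -> ~ Z s -> forall e : R, 0 < e -> exists2 r : R, 0 < r &
     forall h : R, 0 < h < r -> (c - e) * h <= F (s + h) - F s) ->
  c * (b - a) <= F b - F a.
Proof.
move=> FL ab Z0 H.
(* The endpoint joins the exceptional set: the growth hypothesis is silent at [a], whereas
   [right_nondecreasing] starts there. *)
have {}Z0 : mu.-negligible (Z `|` [set a]).
  by apply: negligibleU => //; exists [set a]; split=> //; exact: lebesgue_measure_set1.
apply/ler_addgt0Pr => e e0.
pose K : R := `|L| + `|c| + (b - a) + 1.
have K0 : 0 < K by have := normr_ge0 L; have := normr_ge0 c; rewrite /K; lra.
pose d := e / (2 * K).
have d0 : 0 < d by rewrite divr_gt0// mulr_gt0.
have [W [oW ZW Wd]] := negligible_open_cover Z0 d0.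
have mW : measurable W by exact: open_measurable.
pose T s := W `&` `[a, s]%classic.
have mT s : measurable (T s) by apply: measurableI.
have muT s : (mu (T s) <= mu W)%E by apply: mule => //; exact: subIsetl.
have fT s : mu (T s) \is a fin_num.
  rewrite ge0_fin_numE ?measure_ge0//; apply: le_lt_trans (muT s) _.
  by apply: lt_trans Wd _; rewrite ltey.
pose m s := fine (mu (T s)).
have mm s s' : s <= s' -> m s <= m s'.
  move=> ss'; apply: fine_le => //; apply: mule => //.
  by apply: setIS => z /=; rewrite !in_itv/= => /andP[-> /le_trans->].
have mT' s h : 0 < h -> m (s + h) <= m s + h.
  move=> h0; rewrite -lee_fin EFinD /m !fineK//.
  apply: (@le_trans _ _ (mu (T s `|` `]s, s + h]%classic))).
    apply: mule => //; first by apply: measurableU.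
    move=> z [Oz]; rewrite /T /= !in_itv/= => /andP[az zs].
    by have [zs'|sz] := leP z s; [left|right]; rewrite ?az.
  by apply: le_trans (muleU2 _ _) _ => //; rewrite leeD2l// muoc.
have mW' s h : a <= s -> 0 < h -> `[s, s + h]%classic `<=` W -> m s + h <= m (s + h).
  move=> as_ h0 sO; rewrite -lee_fin EFinD /m !fineK//.
  rewrite -(muoc s h0) -muU//; last first.
    by apply/seteqP; split=> z //= [[_]]; rewrite /= !in_itv/= => /andP[_ ?] /andP[]; lra.
  apply: mule => //; first by apply: measurableU.
  move=> z [[Oz]|]; rewrite /T/= !in_itv/= => /andP[z1 z2].
    by split=> //; rewrite z1; lra.
  split; last by lra.
  by apply: sO; rewrite /= in_itv/=; lra.
(* On an interval inside [W], [m] grows at unit rate and [F s - (c - d) * s] loses at most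
   [|L| + |c|] per unit of time. Off [W] the slack [d] absorbs the error of the hypothesis. The
   total price is [d * (K - 1) <= e]. *)
pose G s := F s - (c - d) * (s - a) + (`|L| + `|c|) * m s.
have GL : lipon (`|L| + `|c - d| + (`|L| + `|c|)) a b G.
  move=> s s' ss ss'.
  have -> : G s - G s' = (F s - F s') - (c - d) * (s - s') + (`|L| + `|c|) * (m s - m s').
    rewrite /G; lra.
  have m1 : `|m s - m s'| <= `|s - s'|.
    wlog: s s' ss ss' / s' <= s => [hw|].
      have [|/ltW] := leP s' s; first exact: hw.
      by move=> ?; rewrite distrC [leRHS]distrC; exact: hw.
    rewrite le_eqVlt => /orP[/eqP ->|s's]; first by rewrite !subrr.
    rewrite !ger0_norm ?subr_ge0 ?(ltW s's)//; last by apply: mm; exact: ltW.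
    have := @mT' s' (s - s'); rewrite subr_gt0 => /(_ s's).
    rewrite subrKC; lra.
  rewrite [leRHS]mulrDl; apply: le_trans (ler_normD _ _) _; apply: lerD.
    rewrite [leRHS]mulrDl; apply: le_trans (ler_normB _ _) _.
    apply: lerD; last by rewrite normrM.
    apply: le_trans (FL _ _ ss ss') _.
    by rewrite ler_wpM2r// ler_norm.
  rewrite normrM (ger0_norm (addr_ge0 _ _))//.
  by rewrite ler_wpM2l// addr_ge0.
have : G a <= G b.
  apply: (right_nondecreasing GL ab) => s /andP[as_ sb].
  have [Os|nWs] := pselect (W s).
    have /nbhs_ballP[r /= r0 rO] : nbhs s W by exact: open_nbhs_nbhs.
    exists r => // h /andP[h0 hr] shb.
    have /(mW' s h as_ h0) mh : `[s, s + h]%classic `<=` W.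
      move=> z; rewrite /= in_itv/= => /andP[sz zh]; apply: rO.
      by rewrite /ball/= distrC ger0_norm ?subr_ge0//; lra.
    have FLh : - (`|L| * h) <= F (s + h) - F s.
      have := @FL (s + h) s; rewrite as_ (ltW sb) shb andbT.
      have -> : a <= s + h by lra.
      move=> /(_ isT isT); rewrite (_ : s + h - s = h) ?(gtr0_norm h0); last by lra.
      have := ler_norm (- (F (s + h) - F s)); rewrite normrN.
      have : L * h <= `|L| * h by rewrite ler_wpM2r ?ler_norm// ltW.
      lra.
    rewrite /G -subr_ge0.
    have : (c - d) * h <= `|c| * h.
      by rewrite ler_wpM2r ?(ltW h0)//; have := ler_norm c; lra.
    have : (`|L| + `|c|) * h <= (`|L| + `|c|) * (m (s + h) - m s).
      by rewrite ler_wpM2l// ?addr_ge0//; lra.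
    nra.
  have as' : a < s < b.
    rewrite sb andbT lt_neqAle as_ andbT; apply/negP => /eqP sa.
    by apply: nWs; apply: ZW; right; rewrite /= sa.
  have nZ : ~ Z s by move=> Zs; apply: nWs; apply: ZW; left.
  have [r r0 Hr] := H s as' nZ d d0.
  exists r => // h hr shb; have := Hr h hr.
  have : m s <= m (s + h) by apply: mm; move: hr => /andP[]; lra.
  move=> h1 h2.
  have : (`|L| + `|c|) * m s <= (`|L| + `|c|) * m (s + h).
    by rewrite ler_wpM2l// addr_ge0.
  rewrite /G; nra.
rewrite /G subrr mulr0 subr0.
have ma : 0 <= m a by apply: fine_ge0; exact: measure_ge0.
have mb : m b <= d.
  by rewrite -lee_fin /m fineK//; apply: le_trans (muT b) _; exact: ltW.
have mb0 : 0 <= m b by apply: fine_ge0; exact: measure_ge0.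
move=> Gab.
have h1 : d * (b - a) + (`|L| + `|c|) * d <= e.
  have -> : e = d * (2 * K) by rewrite /d divfK// gt_eqF// mulr_gt0.
  rewrite [leLHS](_ : _ = d * (K - 1)); last by rewrite /K; ring.
  by rewrite ler_wpM2l ?(ltW d0)//; lra.
have h2 : (`|L| + `|c|) * m b <= (`|L| + `|c|) * d by rewrite ler_wpM2l// addr_ge0.
have h3 : 0 <= (`|L| + `|c|) * m a by rewrite mulr_ge0// addr_ge0.
nra.
Qed.

End lipschitz_real.

(** * Almost everywhere derivatives and primitives *)

Section ae_derivable.
Context {R : realType}.
Local Notation mu := (@lebesgue_measure R).
Implicit Types (F : R -> R) (a b c L s : R) (Z : set R).


Lemma aeS (P Q : R -> Prop) : (forall s, P s -> Q s) ->
  {ae mu, forall s, P s} -> {ae mu, forall s, Q s}.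
Proof. by move=> PQ; apply: filterS PQ; exact: (ae_filter_ringOfSetsType mu). Qed.

Lemma aeI (P Q : R -> Prop) : {ae mu, forall s, P s} ->
  {ae mu, forall s, Q s} -> {ae mu, forall s, P s /\ Q s}.
Proof. by move=> HP HQ; apply: filterI HP HQ; exact: (ae_filter_ringOfSetsType mu). Qed.

Let ls_oc (f : cumulative R R) a b : a <= b ->
  lebesgue_stieltjes_measure f `]a, b]%classic = (f b - f a)%:E.
Proof.
move=> ab; rewrite /lebesgue_stieltjes_measure/= /measure_extension/=.
rewrite measurable_mu_extE//; last exact: is_ocitv.
exact: wlength_itv_bnd.
Qed.

(* [F + id/2] and [id/2 - F] are nondecreasing with sum [id], so that the
   Stieltjes measure of the former is dominated by the Lebesgue measure. *)
Let half_lipschitz_ae_derivable F a b :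
  (forall s s', `|F s - F s'| <= `|s - s'| / 2) -> a < b ->
  {ae mu, forall s, a < s < b -> exists d, dder F s d}.
Proof.
move=> FL ab.
have cvgF (f : R -> R) : (forall s s', `|f s - f s'| <= `|s - s'|) -> continuous f.
  move=> fL s; apply/cvgrPdist_le => e e0; near=> s'.
  by apply: le_trans (fL _ _) _; near: s'; exact: cvgr_dist_le.
have F1L (e : R) : `|e| = 1 -> forall s s',
    `|(e * F s + s / 2) - (e * F s' + s' / 2)| <= `|s - s'|.
  move=> e1 s s'.
  have -> : (e * F s + s / 2) - (e * F s' + s' / 2) = e * (F s - F s') + (s - s') / 2 by lra.
  apply: le_trans (ler_normD _ _) _; rewrite normrM e1 mul1r normrM (@ger0_norm _ 2^-1)//.
  have := FL s s'; lra.
have F1nd (e : R) : `|e| = 1 -> nondecreasing (fun s => e * F s + s / 2).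
  move=> e1 s s' ss'; rewrite -subr_ge0.
  have -> : e * F s' + s' / 2 - (e * F s + s / 2) = (s' - s) / 2 - e * (F s - F s') by lra.
  have := FL s s'; rewrite (ler0_norm (_ : s - s' <= 0)) ?subr_le0// => H.
  have : e * (F s - F s') <= `|F s - F s'|.
    by apply: le_trans (ler_norm _) _; rewrite normrM e1 mul1r.
  by lra.
pose f1 := fun s => 1 * F s + s / 2.
have [nu1 n1oc num] : exists2 nu1 : {measure set (measurableTypeR R) -> \bar R},
    (forall x y, x <= y -> nu1 `]x, y]%classic = (f1 y - f1 x)%:E) &
    forall A : set (measurableTypeR R), measurable A -> (nu1 A <= mu A)%E.
  have e1 : `|1 : R| = 1 by rewrite normr1.
  have eN1 : `|- 1 : R| = 1 by rewrite normrN1.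
  pose f2 := fun s => - 1 * F s + s / 2.
  pose m1 := isCumulative.Build R _ R f1 (F1nd _ e1) (right_continuousW (cvgF _ (F1L _ e1))).
  pose m2 := isCumulative.Build R _ R f2 (F1nd _ eN1) (right_continuousW (cvgF _ (F1L _ eN1))).
  pose c1 : cumulative R R := HB.pack f1 m1.
  pose c2 : cumulative R R := HB.pack f2 m2.
  pose nu1 : {measure set (measurableTypeR R) -> \bar R} := lebesgue_stieltjes_measure c1.
  pose nu2 : {measure set (measurableTypeR R) -> \bar R} := lebesgue_stieltjes_measure c2.
  have n1oc x y : x <= y -> nu1 `]x, y]%classic = (f1 y - f1 x)%:E := @ls_oc c1 x y.
  have n2oc x y : x <= y -> nu2 `]x, y]%classic = (f2 y - f2 x)%:E := @ls_oc c2 x y.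
  have mue A : measurable A -> mu A = (nu1 A + nu2 A)%E.
    move=> mA.
    rewrite -measure_addE; apply: (lebesgue_measure_unique _ mA).
    move=> X /ocitvP[->|[[x y] /= xy ->]]; first by rewrite !measure0.
    transitivity (nu1 `]x, y]%classic + nu2 `]x, y]%classic)%E; last first.
      exact: esym (measure_addE _ _ _).
    rewrite n1oc ?n2oc ?(ltW xy)// lebesgue_measure_itv/= lte_fin xy.
    by rewrite -!EFinD /f1 /f2; congr EFin; lra.
  exists nu1 => // A mA; rewrite [leRHS]mue// leeDl//.
have mab : measurable (`]a, b]%classic : set (measurableTypeR R)) by exact: measurable_itv.
have fab : (nu1 `]a, b]%classic < +oo)%E by rewrite n1oc ?(ltW ab)// ltey.
pose nu : {finite_measure set (measurableTypeR R) -> \bar R} := mfrestr mab fab.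
have dom : nu `<< mu.
  apply/null_content_dominatesP => A mA muA; apply/eqP.
  rewrite eq_le measure_ge0 andbT /nu /mfrestr /= /mrestr.
  have mA' : measurable (A `&` `]a, b]%classic) by exact: measurableI.
  apply: le_trans (num _ mA') _; rewrite -muA.
  by apply: le_measure; rewrite ?inE//; exact: subIsetl.
(* The density makes [f1] a primitive of an integrable function, and such a primitive is
   differentiable almost everywhere. *)
pose g := @Radon_Nikodym_SigmaFinite.f _ (measurableTypeR R) R nu lebesgue_measure.
have gi : mu.-integrable setT g by exact: Radon_Nikodym_SigmaFinite.f_integrable.
have gf x : g x \is a fin_num by exact: Radon_Nikodym_SigmaFinite.f_fin_num.
pose h := fine \o g.
have hg : EFin \o h = g by apply/funext => x; rewrite /= fineK.
have hi : mu.-integrable setT (EFin \o h) by rewrite hg.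
have Fh s : a < s < b -> \int[mu]_(x in `]a, s]) h x = f1 s - f1 a.
  move=> /andP[as_ sb].
  have ms : measurable (`]a, s]%classic : set (measurableTypeR R)) by exact: measurable_itv.
  rewrite /Rintegral (eq_integral g); last by move=> x _; rewrite -hg.
  have <- := @Radon_Nikodym_SigmaFinite.f_integral _ (measurableTypeR R) R nu lebesgue_measure dom _ ms.
  rewrite -[RHS]/(fine (f1 s - f1 a)%:E) -n1oc ?(ltW as_)//.
  congr (fine (nu1 _)).
  by apply/setIidl => z; rewrite /= !in_itv/= => /andP[-> zs]/=; lra.
have his y : mu.-integrable [set` Interval (BRight a) (BRight y)] (EFin \o (h : R -> R)).
  by apply: integrableS hi => //; exact: (measurable_itv (Interval (BRight a) (BRight y))).
have H0 := FTC1 his (open_integrable_locally openT hi).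
apply: aeS H0 => s H /andP[as_ sb].
have [/derivableP/dderP + _] := H as_; set d := 'D_1 _ s => D.
have D1 := dderD (dderD D (@dder_cst _ _ (f1 a) s)) (dderZ (- 2^-1) (dder_id s)).
eexists; apply: (@dder_eq _ _ _ _ _ _ (Num.min (s - a) (b - s)) _ _ D1).
  by rewrite lt_min !subr_gt0 as_.
move=> z; rewrite lt_min !ltr_norml => /andP[/andP[z1 z2] /andP[z3 z4]].
rewrite Fh; last by lra.
by rewrite /f1 -[_ *: _]/(_ * _); lra.
Unshelve. all: by end_near. Qed.

Let dist_max a s s' : `|Num.max a s - Num.max a s'| <= `|s - s'|.
Proof.
have A1 := ler_norm (s - s'); have A2 := ler_norm (s' - s).
rewrite distrC in A2; rewrite ler_norml.
by apply/andP; case: (leP a s) => ?; case: (leP a s') => ?; split; lra.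
Qed.

Let dist_min b s s' : `|Num.min b s - Num.min b s'| <= `|s - s'|.
Proof.
have A1 := ler_norm (s - s'); have A2 := ler_norm (s' - s).
rewrite distrC in A2; rewrite ler_norml.
by apply/andP; case: (leP b s) => ?; case: (leP b s') => ?; split; lra.
Qed.

(** Clamping the argument to [[a, b]] and rescaling reduce this to a function that is 1/2-Lipschitz
    on the whole line; near an interior point the clamping is the identity. *)
Lemma lipschitz_ae_dder F L a b : lipon L a b F ->
  {ae mu, forall s, a < s < b -> exists d, dder F s d}.
Proof.
move=> FL; have [ab|ba] := ltP a b; last first.
  by apply: aeW => s /andP[as_ sb]; lra.
pose K s := Num.max a (Num.min b s).
have Kab s : a <= K s <= b by rewrite le_max lexx ge_max (ltW ab) ge_min lexx.
have KL s s' : `|K s - K s'| <= `|s - s'|.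
  exact: le_trans (dist_max _ _ _) (dist_min _ _ _).
pose c := (2 * (`|L| + 1))^-1.
have L1 : 0 < `|L| + 1 by have := normr_ge0 L; lra.
have c0 : 0 < c by rewrite invr_gt0 mulr_gt0.
pose G s := c * F (K s).
have GL s s' : `|G s - G s'| <= `|s - s'| / 2.
  rewrite /G -mulrBr normrM (gtr0_norm c0).
  apply: (@le_trans _ _ (c * ((`|L| + 1) * `|s - s'|))).
    rewrite ler_wpM2l ?(ltW c0)//; apply: le_trans (FL _ _ (Kab _) (Kab _)) _.
    apply: (@le_trans _ _ ((`|L| + 1) * `|K s - K s'|)).
      by rewrite ler_wpM2r//; have := ler_norm L; lra.
    by rewrite ler_wpM2l// ltW.
  by rewrite /c invfM -mulrA mulKf ?gt_eqF// mulrC.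
have := half_lipschitz_ae_derivable GL ab; apply: aeS => s H /andP[as_ sb].
have [|d D] := H; first by rewrite as_.
exists (c^-1 *: d); apply: (@dder_eq _ _ _ _ _ _ (Num.min (s - a) (b - s)) _ _ (dderZ c^-1 D)).
  by rewrite lt_min !subr_gt0 as_.
move=> z; rewrite lt_min !ltr_norml => /andP[/andP[z1 z2] /andP[z3 z4]].
rewrite /G [_ *: _]mulKf ?gt_eqF//; congr F.
have az : a <= s + z by lra. have zb : s + z <= b by lra.
by rewrite /K min_r// max_r.
Qed.

(** Running costs are controlled on the open interval only. The endpoints being null, [h] can be
    replaced by its extension [k] by zero, which is bounded and measurable on the line. *)
Lemma indefinite_integral (h : R -> R) (t M : R) : 0 < t ->
  measurable_fun (`]0, t[%classic : set R) h -> (forall s, 0 < s < t -> `|h s| <= M) ->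
  let J s := \int[mu]_(x in `[0, s]) h x in
  [/\ J 0 = 0, lipon M 0 t J & {ae mu, forall s, 0 < s < t -> dder J s (h s)}].
Proof.
move=> t0 mh hM J.
pose k := h \_ `]0, t[.
have M0 : 0 <= M by apply: le_trans (hM (t / 2) _); [|lra].
have mk : measurable_fun setT k by apply/(measurable_restrictT _ _).1.
have kM s : `|k s| <= M.
  by rewrite /k patchE; case: ifPn; rewrite ?normr0// inE/= in_itv/=; exact: hM.
have ki a b : mu.-integrable `[a, b] (EFin \o k).
  apply: measurable_bounded_integrable.
  - exact: (measurable_itv `[a, b]).
  - by rewrite /= lebesgue_measure_itv/= lte_fin; case: ifP => _; rewrite ?ltey// -EFinB ltey.
  - exact: measurable_funS mk.
  - exists M; split; first exact: num_real.
    by move=> x Mx s _ /=; apply: le_trans (kM s) _; exact: ltW.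
have kio a b : mu.-integrable `]a, b] (EFin \o k).
  apply: integrableS (ki a b); first exact: (measurable_itv `[a, b]).
    exact: (measurable_itv `]a, b]).
  exact: (@subset_itv_oc_cc _ _ a b).
have JE s : 0 <= s <= t -> J s = \int[mu]_(x in `[0, s]) k x.
  move=> /andP[s0 st]; rewrite /J /Rintegral.
  have ms (f : R -> R) : measurable_fun (`]0, t[%classic : set R) f ->
      (\int[mu]_(x in `[0%R, s]) (f x)%:E = \int[mu]_(x in `]0%R, s[) (f x)%:E)%E.
    move=> mf.
    have mf' : measurable_fun (`]0, s[%classic : set R) f.
      by apply: measurable_funS mf => //; apply: subset_itvl; rewrite bnd_simp.
    rewrite -integral_itv_obnd_cbnd; last exact/measurable_EFinP/measurable_fun_itv_bndo_bndcP.
    by rewrite -integral_itv_bndo_bndc//; exact/measurable_EFinP.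
  rewrite !ms//; last exact: measurable_funS mk.
  congr fine; apply: eq_integral => x; rewrite inE/= in_itv/= => /andP[x0 xs].
  by rewrite /k patchE mem_set//= in_itv/= x0; lra.
have J0 : J 0 = 0 by rewrite /J set_itv1 Rintegral_set1.
have JB s s' : 0 <= s <= s' -> s' <= t -> `|J s - J s'| <= M * `|s - s'|.
  move=> /andP[s0 ss'] s't.
  rewrite distrC !JE; [|lra|lra].
  rewrite Rintegral_itvB ?bnd_simp//.
  have mss : (mu `]s, s']%classic = (s' - s)%:E)%E.
    rewrite lebesgue_measure_itv/= lte_fin; case: ltP => // s's.
    have s_s' : s = s' by apply: le_anti; rewrite ss' s's.
    by rewrite s_s' subrr.
  have msm := measurable_itv `]s, s'].
  apply: le_trans (le_normr_Rintegral _ _) _ => //.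
  apply: (@le_trans _ _ (\int[mu]_(x in `]s, s']) M)).
    apply: le_Rintegral => //.
    - by have /integrable_norm := kio s s'.
    - apply: measurable_bounded_integrable.
      + exact: msm.
      + by change (mu `]s, s']%classic < +oo)%E; rewrite mss ltey.
      + exact: measurable_cst.
      by exists M; split; [exact: num_real|move=> x Mx ? _ /=; rewrite ger0_norm// ltW].
  apply: (@le_trans _ _ (M * fine (mu `]s, s']%classic))); first by rewrite Rintegral_cst.
  rewrite mss/=.
  by rewrite ler0_norm ?subr_le0// opprB.
have kJ : {ae mu, forall s, 0 < s < t -> dder J s (k s)}.
  have kl : locally_integrable setT k.
    apply: integrable_locally => //; apply: measurable_bounded_integrable.
    - exact: (measurable_itv `]0, t[).
    - by rewrite /= lebesgue_measure_itv/= lte_fin t0 -EFinB ltey.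
    - exact: mh.
    - exists M; split; first exact: num_real.
      by move=> x Mx s /=; rewrite in_itv/= => /hM/le_trans; apply; exact: ltW.
  have kis y : mu.-integrable [set` Interval (BLeft 0) (BRight y)] (EFin \o (k : R -> R)).
    exact: ki.
  have H0 := FTC1 kis kl.
  apply: aeS H0 => s H /andP[s0 st].
  have [|D E] := H; first by rewrite lte_fin.
  rewrite -E; apply/dderP; rewrite derive1E; apply: (near_eq_is_derive _ (derivableP D)).
  near=> z; rewrite JE//; apply/andP; split; apply: ltW; near: z.
  - exact: lt_nbhsr.
  - exact: lt_nbhsl.
split => //.
- move=> s s' /andP[s0 st] /andP[s'0 s't].
  have [ss'|/ltW s's] := leP s s'; first by apply: JB => //; lra.
  by rewrite distrC [`|s - s'|]distrC; apply: JB => //; lra.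
- apply: aeS kJ => s H st; have := H st.
  by rewrite /k patchE mem_set//= in_itv.
Unshelve. all: by end_near. Qed.


Let mtrans (c : R) : measurable_fun setT (fun s : R => s + c).
Proof. exact: measurable_funD. Qed.

(** Lebesgue measure is determined by half-open intervals, whose length is translation invariant.
    This serves to restart a trajectory at a later time. *)
Lemma ae_translate (c : R) (P : R -> Prop) : {ae mu, forall s, P s} ->
  {ae mu, forall s, P (s + c)}.
Proof.
have inv (A : set R) : measurable A -> mu A = mu ((fun s => s + c) @^-1` A).
  move=> mA.
  pose f : measurableTypeR R -> measurableTypeR R := fun s => s + c.
  have mf : measurable_fun setT f by exact: mtrans.
  rewrite (@lebesgue_measure_unique R (pushforward mu f) _ A mA)//.
  move=> X /ocitvP[->|[[x y] /= xy ->]]; first by rewrite !measure0.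
  rewrite /pushforward (_ : _ @^-1` _ = `]x - c, y - c]%classic); last first.
    by apply/seteqP; split => z; rewrite /f /= !in_itv/=; lra.
  rewrite !lebesgue_measure_itv/= !lte_fin ltrD2r xy -!EFinB; congr EFin; lra.
move=> [B [mB B0 PB]].
exists ((fun s => s + c) @^-1` B); split.
- by rewrite -[X in measurable X]setTI; exact: mtrans.
- by rewrite -B0; apply/esym; exact: inv.
- by move=> s /= nP; exact: PB.
Qed.

End ae_derivable.

(** * Measurable selection *)

Section compact_metric.
Context {R : realType} {A : metricType R}.

Lemma ball_mdist (a : A) e b : ball a e b = (mdist a b < e) :> Prop.
Proof. by rewrite -metricType_numDomainType.ball_mdistE. Qed.

Lemma open_mball (a : A) e : open (ball a e).
Proof.
rewrite openE => b; rewrite ball_mdist => ab.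
apply/nbhs_ballP; exists (e - mdist a b); first by rewrite /= subr_gt0.
move=> y; rewrite !ball_mdist => bc.
by have := metric_triangle a b y; lra.
Qed.

Hypothesis cA : compact [set: A].

Lemma compact_totally_bounded e : 0 < e ->
  exists s : seq A, forall a, exists2 b, b \in s & ball b e a.
Proof.
move=> e0; apply: contrapT => H.
have /choice[f Hf] : forall s : seq A, exists a, forall b, b \in s -> ~ ball b e a.
  move=> s; apply: contrapT => Hs; apply: H; exists s => a.
  apply: contrapT => Ha; apply: Hs; exists a => b bs ab; apply: Ha.
  by exists b.
pose l := fix l n := if n is n'.+1 then f (l n') :: l n' else [::].
pose x n := f (l n).
have xl i n : (i < n)%N -> x i \in l n.
  elim: n => // n IH; rewrite ltnS leq_eqVlt => /orP[/eqP ->|/IH H'].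
    by rewrite /= inE eqxx.
  by rewrite /= inE H' orbT.
have [|p [_ pc]] := cA (F := x @ \oo); first exact: filterT.
have e20 : 0 < e / 2 by rewrite divr_gt0.
have inf n : exists2 m, (n <= m)%N & ball p (e / 2) (x m).
  have [|y [[m nm <-] By]] := pc [set x m | m in [set m | (n <= m)%N]] (ball p (e / 2)) _ (nbhsx_ballx _ _ e20).
    by exists n => // m nm; exists m.
  by exists m.
have [i _ Bi] := inf 0%N; have [m im Bm] := inf i.+1.
apply: (Hf (l m) (x i) (xl _ _ im)).
by apply: ball_splitr Bi Bm.
Qed.

Lemma compact_dense_sequence (a0 : A) :
  exists a_ : nat -> A, forall a e, 0 < e -> exists j, ball (a_ j) e a.
Proof.
have /choice[s Hs] : forall n : nat, exists s : seq A,
    forall a, exists2 b, b \in s & ball b n.+1%:R^-1 a.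
  by move=> n; apply: compact_totally_bounded; rewrite invr_gt0.
(* One natural number codes a precision [k] and a position in the finite net [s k]; [a0] fills the
   codes without meaning. *)
exists (fun n => if unpickle n is Some (k, i) then nth a0 (s k) i else a0) => a e e0.
have [k ke] : exists k : nat, k.+1%:R^-1 <= e.
  exists (Num.trunc e^-1).
  rewrite invf_ple ?posrE//; apply: ltW; exact: truncnS_gt.
have [b bs Bb] := Hs k a.
exists (pickle (k, index b (s k))); rewrite pickleK nth_index//.
exact: le_ball ke _ Bb.
Qed.

Lemma compact_nonneg_zero (f : A -> R) : continuous f -> (forall a, 0 <= f a) ->
  (forall k : nat, exists a, f a < k.+1%:R^-1) -> exists a, f a = 0.
Proof.
move=> cf f0 H; have [a _] := H 0%N.
have [|c _ Hc] := @compact_EVT_min A R f setT _ cA (continuous_subspaceT cf); first by exists a.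
exists c; apply/eqP; rewrite eq_le f0 andbT leNgt; apply/negP => fc.
have [b] := H (Num.trunc (f c)^-1).
apply/negP; rewrite -leNgt; apply: le_trans (Hc b _); last by rewrite inE.
by rewrite invf_ple ?posrE//; apply: ltW; exact: truncnS_gt.
Qed.

End compact_metric.

Section borel.
Context {R : realType} {A : metricType R}.
Hypothesis cA : compact [set: A].
Implicit Types (D : set R) (c : R -> A).

(** A superlevel set is a countable union of boxes [C], small in time and in control: a box is taken
    when it contains one point where [G] exceeds [r] by the oscillation allowed at its scale, and
    then all its points exceed [r]. *)
Lemma measurable_comp_unif D c (G : R -> A -> R) : measurable D ->
  (forall W, open W -> measurable (D `&` c @^-1` W)) ->
  (forall e : R, 0 < e -> exists2 d : R, 0 < d & forall s s' a a', D s -> D s' ->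
     `|s - s'| < d -> ball a d a' -> `|G s a - G s' a'| < e) ->
  measurable_fun D (fun s => G s (c s)).
Proof.
move=> mD mc HG _; apply: (measurability _ (RGenOInfty.measurableE R)) => //.
move=> _ [_ [r ->] <-].
have e_gt0 (k : nat) : 0 < k.+1%:R^-1 :> R by rewrite invr_gt0.
have /choice[d Hd] : forall k : nat, exists d : R, 0 < d /\ forall s s' a a', D s -> D s' ->
     `|s - s'| < d -> ball a d a' -> `|G s a - G s' a'| < k.+1%:R^-1.
  by move=> k; have [d d0 Hd] := HG _ (e_gt0 k); exists d.
have d20 k : 0 < d k / 2 by rewrite divr_gt0//; case: (Hd k).
have /choice[l Hl] := fun k => compact_totally_bounded cA (d20 k).
pose C (i : nat * rat * nat) := let: (k, q, j) := i in
  D `&` ball (ratr q : R) (d k / 2) `&` c @^-1` ball (nth (c 0) (l k) j) (d k / 2).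
have mC i : measurable (C i).
  case: i => [[k q] j]; rewrite /C setIAC; apply: measurableI.
    by apply: mc; exact: open_mball.
  exact: measurable_ball.
pose sel i := exists2 s, C i s & G s (c s) > r + i.1.1.+1%:R^-1.
rewrite (_ : _ `&` _ = \bigcup_i (if `[< sel i >] then C i else set0)); last first.
  apply/seteqP; split => s /=.
    rewrite in_itv/= andbT => -[Ds rG].
    have [k ke] : exists k : nat, k.+1%:R^-1 < G s (c s) - r.
      exists (Num.trunc (G s (c s) - r)^-1).
      by rewrite invf_plt ?posrE ?subr_gt0//; exact: truncnS_gt.
    have d40 : 0 < d k / 2 by [].
    have [q sq] : exists q : rat, ball (ratr q : R) (d k / 2) s.
      have [|q] := @rat_in_itvoo R (s - d k / 2) (s + d k / 2); first by lra.
      by rewrite in_itv/= => /andP[q1 q2]; exists q; rewrite /ball/= ltr_norml; lra.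
    have [b bl Bb] := Hl k (c s).
    have Cs : C (k, q, index b (l k)) s.
      by rewrite /C nth_index//; split => //.
    exists (k, q, index b (l k)) => //.
    rewrite ifT//; apply/asboolP; exists s => //=.
    by rewrite ltrBrDl in ke.
  move=> [i _]; case: ifPn => // /asboolP[s' Cs' rs'] Cs.
  rewrite in_itv/= andbT.
  move: i Cs' rs' Cs => [[k q] j] /= [[Ds' Bs'] Bc'] rs' [[Ds Bs] Bc]; split => //.
  have := (Hd k).2 s s' (c s) (c s') Ds Ds' _ _.
  have h1 : `|s - s'| < d k by exact: (ball_splitr Bs Bs').
  have h2 : ball (c s) (d k) (c s').
    exact: ball_splitr Bc Bc'.
  move=> /(_ h1 h2); rewrite ltr_norml => /andP[h3 _].
  move: h3 rs'; set u := _^-1; set v := G s' _; set w := G s _ => h3 rs'; lra.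
apply: countable_bigcupT_measurable => // i; case: ifP => // _.
Qed.


(* A zero of a continuous function is approximated by points of a dense
   sequence, and conversely compactness turns small values into a zero. *)
Lemma measurable_has_zero (a0 : A) D (F : R -> A -> R) : measurable D ->
  (forall a, measurable_fun D (F ^~ a)) -> (forall s, D s -> continuous (F s)) ->
  (forall s a, D s -> 0 <= F s a) ->
  measurable (D `&` [set s | exists a, F s a = 0]).
Proof.
move=> mD mF cF F0; have [a_ Ha] := compact_dense_sequence cA a0.
rewrite (_ : _ `&` _ = \bigcap_k \bigcup_j (D `&` (F ^~ (a_ j)) @^-1` `]-oo, k.+1%:R^-1[)).
  apply: bigcapT_measurable => k; apply: bigcup_measurable => j _.
  exact: mF.
apply/seteqP; split => s /=.
  move=> [Ds [a Fa]] k _.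
  have := cF s Ds a; move=> /cvgrPdist_lt/(_ k.+1%:R^-1).
  rewrite invr_gt0 => /(_ (ltr0Sn _ _)) /nbhs_ballP[e /= e0 He].
  have [j Bj] := Ha a e e0; exists j => //; split=> //=.
  rewrite in_itv/=; have := He (a_ j) (ball_sym Bj).
  by rewrite Fa sub0r normrN; apply: le_lt_trans; exact: ler_norm.
move=> H; have [_ _ [Ds _]] := H 0%N I; split => //.
apply: (compact_nonneg_zero cA (cF s Ds)) => [a|k]; first exact: F0.
have [j _ [_ /=]] := H k I; rewrite in_itv/= => Fj; by exists (a_ j).
Qed.

(** [m s] is the minimum of [g] over the zeros of [F s]. It exceeds [r] exactly when no zero
    satisfies [g a <= r], which is again a question about the existence of zeros. *)
Let argmin_step (a0 : A) D (F : R -> A -> R) (g : A -> R) : measurable D -> continuous g ->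
  (forall a, measurable_fun D (F ^~ a)) -> (forall s, D s -> continuous (F s)) ->
  (forall s a, D s -> 0 <= F s a) -> (forall s, D s -> exists a, F s a = 0) ->
  exists m : R -> R, [/\ measurable_fun D m &
    forall s, D s -> exists a, F s a + `|g a - m s| = 0].
Proof.
move=> mD cg mF cF F0 Fz.
have /choice[m Hm] : forall s, exists m : R, D s ->
    (exists2 a, F s a = 0 & g a = m) /\ (forall a, F s a = 0 -> m <= g a).
  move=> s; have [Ds|] := pselect (D s); last by move=> ?; exists 0.
  have cZ : compact [set a | F s a = 0].
    apply: (subclosed_compact _ cA) => //.
    rewrite (_ : [set a | _] = F s @^-1` [set 0])//.
    by apply: closed_comp => [a _|]; [exact: cF|exact: closed_eq].
  have Z0 : [set a | F s a = 0] !=set0 by have [a ?] := Fz s Ds; exists a.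
  have [c cZ' Hc] := compact_EVT_min Z0 cZ (continuous_subspaceT cg).
  exists (g c) => _; split; first by exists c => //; rewrite inE in cZ'.
  by move=> a Fa; apply: Hc; rewrite inE.
exists m; split; last first.
  by move=> s /Hm[[a Fa ga] _]; exists a; rewrite Fa ga subrr normr0 addr0.
move=> _; apply: (measurability _ (RGenOInfty.measurableE R)) => //.
move=> _ [_ [r ->] <-].
(* [|z| + z] vanishes exactly for [z <= 0], so it encodes the constraint [g a <= r] as a zero of a
   nonnegative continuous function. *)
have pos (z : R) : 0 <= `|z| + z by have := ler_norm (- z); rewrite normrN; lra.
rewrite (_ : _ `&` _ = D `\` (D `&` [set s | exists a, F s a + (`|g a - r| + (g a - r)) = 0])).
  apply: measurableD => //; apply: measurable_has_zero => //.
  - by move=> a; apply: measurable_funD.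
  - move=> s Ds a; apply: cvgD; first exact: cF.
    have cgr : g x - r @[x --> a] --> g a - r.
      by apply: cvgB; [exact: cg|exact: cvg_cst].
    by apply: cvgD => //; apply: cvg_norm.
  - by move=> s a Ds; rewrite addr_ge0 ?F0// pos.
apply/seteqP; split => s /=; rewrite in_itv/= andbT.
  move=> [Ds rm]; split=> //; move=> [_ [a /eqP]].
  rewrite paddr_eq0 ?F0// => /andP[/eqP Fa /eqP ga]; have := (Hm s Ds).2 a Fa.
  have := normr_ge0 (g a - r); lra.
move=> [Ds H]; split=> //; rewrite ltNge; apply/negP => mr; apply: H; split=> //.
have [[a Fa ga] _] := Hm s Ds; exists a; rewrite Fa add0r.
by rewrite ler0_norm ?addNr// ga subr_le0.
Qed.

(* Minimizing successively the distances to the points of a dense sequence over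
   the set of zeros singles out one zero, depending measurably on [s]. *)
Lemma measurable_selection (a0 : A) D (F : R -> A -> R) : measurable D ->
  (forall a, measurable_fun D (F ^~ a)) -> (forall s, D s -> continuous (F s)) ->
  (forall s a, D s -> 0 <= F s a) -> (forall s, D s -> exists a, F s a = 0) ->
  exists c : R -> A, (forall W, open W -> measurable (D `&` c @^-1` W)) /\
    forall s, D s -> F s (c s) = 0.
Proof.
move=> mD mF cF F0 Fz; have [a_ Ha] := compact_dense_sequence cA a0.
pose good (F : R -> A -> R) := [/\ (forall a, measurable_fun D (F ^~ a)),
  (forall s, D s -> continuous (F s)),
  (forall s a, D s -> 0 <= F s a) & (forall s, D s -> exists a, F s a = 0)].
have cdist b : continuous (mdist b : A -> R).
  move=> a; apply/cvgrPdist_lt => e e0; near=> a'.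
  have : ball a e a' by near: a'; exact: nbhsx_ballx.
  rewrite ball_mdist => aa'; rewrite ltr_norml; apply/andP; split.
    by have := metric_triangle b a a'; lra.
  by have := metric_triangle b a' a; rewrite (metric_sym a'); lra.
have /choice[m Hm] : forall jF : nat * (R -> A -> R), exists m : R -> R, good jF.2 ->
    measurable_fun D m /\ good (fun s a => jF.2 s a + `|mdist (a_ jF.1) a - m s|).
  move=> [j G]; have [gG|] := pselect (good G); last by move=> ?; exists (fun=> 0).
  have [mG cG G0 Gz] := gG.
  have [m [mm mz]] := argmin_step a0 mD (cdist (a_ j)) mG cG G0 Gz.
  exists m => _ /=; split=> //; split => //.
  - move=> a; apply: measurable_funD => //; apply: measurableT_comp => //.
    exact: measurable_funB.
  - move=> s Ds a; apply: cvgD; first exact: cG.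
    by apply: cvg_norm; apply: cvgB; [exact: cdist|exact: cvg_cst].
  - by move=> s a Ds; rewrite addr_ge0// G0.
pose FF := fix FF n := if n is j.+1 then
  (fun s a => FF j s a + `|mdist (a_ j) a - m (j, FF j) s|) else F.
have gFF n : good (FF n).
  by elim: n => // n IH; have [_] := Hm (n, FF n) IH.
have FFle n k s a : D s -> FF n s a <= FF (n + k)%N s a.
  move=> Ds; elim: k => [|k IH]; first by rewrite addn0.
  by rewrite addnS /=; apply: le_trans IH _; rewrite lerDl.
(* The functions [FF n] increase with [n], so their zero sets are nested nonempty compact sets; a
   cluster point of chosen zeros lies in all of them. *)
have cross s : D s -> exists a, forall n, FF n s a = 0.
  move=> Ds.
  have /choice[z Hz] : forall n, exists a, FF n s a = 0.
    by move=> n; have [_ _ _ /(_ s Ds)] := gFF n.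
  have [|p [_ pc]] := cA (F := z @ \oo); first exact: filterT.
  exists p => n; have [_ cFn Fn0 _] := gFF n.
  apply/eqP; rewrite eq_le Fn0// andbT; apply/ler_addgt0Pr => e e0; rewrite add0r.
  have := cFn s Ds p; move=> /cvgrPdist_lt/(_ e e0) He.
  have [|y [[k nk <-] /=]] := pc [set z k | k in [set k | (n <= k)%N]] _ _ He.
    by exists n => // k nk; exists k.
  have -> : FF n s (z k) = 0.
    apply/eqP; rewrite eq_le Fn0// andbT -(Hz k) -(subnKC nk); exact: FFle.
  by rewrite subr0 => /ltW; apply: le_trans; exact: ler_norm.
have /choice[c Hc] : forall s, exists a, D s -> forall n, FF n s a = 0.
  move=> s; have [Ds|] := pselect (D s); last by move=> ?; exists a0.
  by have [a Hca] := cross s Ds; exists a.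
exists c; split=> [W oW|s Ds]; last exact: (Hc s Ds 0%N).
have dm s j : D s -> mdist (a_ j) (c s) = m (j, FF j) s.
  move=> Ds; have /= := Hc s Ds j.+1; rewrite (Hc s Ds j) add0r.
  by move=> /normr0_eq0 /eqP; rewrite subr_eq0 => /eqP.
(* [c s] lies in [W] when some small ball inside [W] around a point of the dense sequence contains
   it, and the distance from [c s] to that point is the measurable function [m (j, FF j)]. *)
have -> : D `&` c @^-1` W = \bigcup_(jk : nat * nat)
    (if `[< ball (a_ jk.1) jk.2.+1%:R^-1 `<=` W >] then
     D `&` (m (jk.1, FF jk.1)) @^-1` `]-oo, jk.2.+1%:R^-1[ else set0).
  apply/seteqP; split => s /=.
    move=> [Ds Ws]; move: oW; rewrite openE => /(_ _ Ws)/nbhs_ballP[e /= e0 He].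
    pose k := Num.trunc (e / 2)^-1.
    have ke : k.+1%:R^-1 < e / 2.
      by rewrite invf_plt ?posrE ?divr_gt0//; exact: truncnS_gt.
    have k0 : 0 < k.+1%:R^-1 :> R by rewrite invr_gt0.
    have [j Bj] := Ha (c s) _ k0; exists (j, k) => //.
    rewrite ifT; first by split => //=; rewrite in_itv/= -dm// -ball_mdist.
    apply/asboolP => y By; apply: He.
    apply: (le_ball (_ : k.+1%:R^-1 + k.+1%:R^-1 <= e)).
      by rewrite [leRHS]splitr lerD// ltW.
    exact: ball_triangle (ball_sym Bj) By.
  move=> [[j k] _]/=; case: ifPn => // /asboolP sW [Ds]; rewrite /= in_itv/= => mk.
  by split=> //; apply: sW; rewrite ball_mdist dm.
apply: countable_bigcupT_measurable => // -[j k]; case: ifP => // _.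
by have [mm _] := Hm (j, FF j) (gFF j); exact: mm.
Unshelve. all: by end_near. Qed.

End borel.

(** * Weak second derivatives and B-splines *)

Section sandwich.
Context {R : realType}.
Local Notation mu := (@lebesgue_measure R).

(* The library's integral of a nonnegative function is a supremum over simple
   functions below it, hence monotone even without measurability. *)
Let le_integral_nonneg (f g : R -> \bar R) : (forall x, 0 <= f x)%E ->
  (forall x, f x <= g x)%E -> (\int[mu]_x f x <= \int[mu]_x g x)%E.
Proof.
move=> f0 fg; rewrite !ge0_integralTE//; last by move=> x; exact: le_trans (fg x).
apply: le_ereal_sup => _ [h hf <-]; exists h => // x.
exact: le_trans (hf x) (fg x).
Qed.

(** [F] may fail to be measurable, as may slices of the integrands fed to [integral_rV]. Positive
    and negative parts are compared separately, and the integrable bounds keep both finite. *)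
Lemma Rintegral_sandwich (L F U : R -> R) :
  mu.-integrable setT (EFin \o L) -> mu.-integrable setT (EFin \o U) ->
  (forall x, L x <= F x <= U x) ->
  \int[mu]_x L x <= \int[mu]_x F x <= \int[mu]_x U x.
Proof.
move=> iL iU H.
have LF x : ((EFin \o L) x <= (EFin \o F) x)%E.
  by rewrite lee_fin; case/andP: (H x).
have FU x : ((EFin \o F) x <= (EFin \o U) x)%E.
  by rewrite lee_fin; case/andP: (H x).
have pos (f g : R -> \bar R) : (forall x, f x <= g x)%E ->
    (\int[mu]_x (f ^\+ x) <= \int[mu]_x (g ^\+ x))%E.
  move=> fg; apply: le_integral_nonneg => x; first exact: funepos_ge0.
  by apply: (@funepos_le _ _ setT f g) => [y _|]; [exact: fg|rewrite inE].
have neg (f g : R -> \bar R) : (forall x, f x <= g x)%E ->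
    (\int[mu]_x (g ^\- x) <= \int[mu]_x (f ^\- x))%E.
  move=> fg; apply: le_integral_nonneg => x; first exact: funeneg_ge0.
  by apply: (@funeneg_le _ _ setT f g) => [y _|]; [exact: fg|rewrite inE].
have n0 (f : R -> \bar R) : (0 <= \int[mu]_x (f ^\- x))%E.
  by apply: integral_ge0 => x _; exact: funeneg_ge0.
have p0 (f : R -> \bar R) : (0 <= \int[mu]_x (f ^\+ x))%E.
  by apply: integral_ge0 => x _; exact: funepos_ge0.
have FP : (\int[mu]_x ((EFin \o F) ^\+ x) \is a fin_num)%E.
  rewrite ge0_fin_numE//; apply: le_lt_trans (pos _ _ FU) _.
  by have := integrable_pos_fin_num measurableT iU; rewrite ge0_fin_numE.
have FN : (\int[mu]_x ((EFin \o F) ^\- x) \is a fin_num)%E.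
  rewrite ge0_fin_numE//; apply: le_lt_trans (neg _ _ LF) _.
  by have := integrable_neg_fin_num measurableT iL; rewrite ge0_fin_numE.
have iF : (\int[mu]_x (F x)%:E \is a fin_num)%E by rewrite integralE fin_numB FP FN.
have fL : (\int[mu]_x (L x)%:E \is a fin_num)%E by exact: integrable_fin_num.
have fU : (\int[mu]_x (U x)%:E \is a fin_num)%E by exact: integrable_fin_num.
rewrite /Rintegral; apply/andP; split; apply: fine_le => //.
  by rewrite integralE [leRHS]integralE; apply: leeB; [exact: pos|exact: neg].
by rewrite integralE [leRHS]integralE; apply: leeB; [exact: pos|exact: neg].
Qed.

Definition tensor n (k : 'I_n -> R -> R) (z : 'rV[R]_n) : R := \prod_(l < n) k l (z 0 l).

Lemma tensor_row_mx n (k : 'I_n.+1 -> R -> R) (x : R) (v : 'rV[R]_n) :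
  tensor k (row_mx (x%:M : 'rV[R]_1) v : 'rV[R]_n.+1) = k ord0 x * tensor (k \o lift ord0) v.
Proof.
rewrite /tensor big_ord_recl; congr (_ * _).
  congr (k _ _).
  rewrite (_ : ord0 = lshift n (0 : 'I_1)); last exact: val_inj.
  transitivity ((x%:M : 'rV[R]_1) 0 0); last by rewrite mxE eqxx.
  exact: (@row_mxEl R 1 1 n x%:M v 0 0).
apply: eq_bigr => i _; congr (k _ _).
rewrite (_ : lift ord0 i = rshift 1 i); last exact: val_inj.
exact: (@row_mxEr R 1 1 n x%:M v 0 i).
Qed.

(** Induction on the dimension: once the remaining variables are integrated, both bounds are linear
    combinations of kernels in the first variable, to which [Rintegral_sandwich] applies. *)
Lemma integral_rV_sandwich n p q (c : 'I_p -> R) (k : 'I_p -> 'I_n -> R -> R)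
    (c' : 'I_q -> R) (k' : 'I_q -> 'I_n -> R -> R) (F : 'rV[R]_n -> R) :
  (forall i l, mu.-integrable setT (EFin \o k i l)) ->
  (forall i l, mu.-integrable setT (EFin \o k' i l)) ->
  (forall z, \sum_i c i * tensor (k i) z <= F z <= \sum_i c' i * tensor (k' i) z) ->
  \sum_i c i * \prod_(l < n) \int[mu]_x k i l x <= integral_rV F
    <= \sum_i c' i * \prod_(l < n) \int[mu]_x k' i l x.
Proof.
elim: n c k c' k' F => [|n IH] c k c' k' F ik ik' H.
  have := H 0; rewrite /tensor.
  by under eq_bigr do rewrite big_ord0; under [X in _ <= _ <= X -> _]eq_bigr do rewrite big_ord0;
    under [X in _ -> X <= _ <= _]eq_bigr do rewrite big_ord0;
    under [X in _ -> _ <= _ <= X]eq_bigr do rewrite big_ord0.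
pose V r (c : 'I_r -> R) (k : 'I_r -> 'I_n.+1 -> R -> R) x :=
  \sum_i (c i * k i ord0 x) * \prod_(l < n) \int[mu]_x k i (lift ord0 l) x.
have Vint r (d : 'I_r -> R) (h : 'I_r -> 'I_n.+1 -> R -> R) :
    (forall i l, mu.-integrable setT (EFin \o h i l)) ->
    mu.-integrable setT (EFin \o V r d h) /\
    \int[mu]_x V r d h x = \sum_i d i * \prod_(l < n.+1) \int[mu]_x h i l x.
  move=> ih.
  have E : EFin \o V r d h =
      (fun x => \sum_(i < r) ((d i * \prod_(l < n) \int[mu]_x h i (lift ord0 l) x)%:E * (EFin \o h i ord0) x)%E)%E.
    apply/funext => x /=; rewrite /V -sumEFin; apply: eq_bigr => i _.
    by rewrite -EFinM mulrAC.
  have ii i : mu.-integrable setT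
      (fun x => ((d i * \prod_(l < n) \int[mu]_x h i (lift ord0 l) x)%:E * (EFin \o h i ord0) x)%E).
    by apply: integrableZl => //; exact: ih.
  split; first by rewrite E; apply: integrable_sum => // i _; exact: ii.
  rewrite /Rintegral -[fun x => (V r d h x)%:E]/(EFin \o V r d h) E.
  rewrite integral_sum//=.
  rewrite (eq_bigr (fun i => (d i * \prod_(l < n.+1) \int[mu]_x h i l x)%:E)).
    by rewrite sumEFin.
  move=> i _; rewrite integralZl//; last exact: ih.
  rewrite -[X in (_ * X)%E]fineK; last first.
    by apply: integrable_fin_num => //; exact: ih.
  by rewrite -EFinM big_ord_recl -mulrA [X in _ * X]mulrC.
have [iV VE] := Vint p c k ik; have [iV' VE'] := Vint q c' k' ik'.
rewrite -VE -VE' /=; apply: Rintegral_sandwich => // x.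
have := IH (fun i => c i * k i ord0 x) (fun i => k i \o lift ord0)
  (fun i => c' i * k' i ord0 x) (fun i => k' i \o lift ord0)
  (fun v : 'rV[R]_n => F (row_mx (x%:M : 'rV[R]_1) v)).
apply.
- by move=> i l; exact: ik.
- by move=> i l; exact: ik'.
move=> v; have := H (row_mx (x%:M : 'rV[R]_1) v).
under eq_bigr do rewrite tensor_row_mx mulrA.
by under [X in _ <= _ <= X -> _]eq_bigr do rewrite tensor_row_mx mulrA.
Qed.

End sandwich.

(** * Truncated powers and B-splines in one variable *)

Section splines.
Context {R : realType}.
Local Notation mu := (@lebesgue_measure R).
Implicit Types (k f : R -> R) (hs : seq R) (y h : R).

(** The truncated power, normalized so that differentiation lowers the degree by one. At [n = 0] it
    is the constant 1 and not a step function, so [spline] has its usual shape only from two steps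
    on. *)
Definition tpow (n : nat) y : R := (Num.max 0 y) ^+ n / (n`!)%:R.

Definition bdiff h f y : R := f y - f (y - h).

Definition bdiffs hs f : R -> R := foldr bdiff f hs.

(* [spline hs] is, up to normalization, the B-spline with steps [hs], and
   [prim_spline hs] a primitive of it. *)
Definition prim_spline hs := bdiffs hs (tpow (size hs)).
Definition spline hs := bdiffs hs (tpow (size hs).-1).

Let tpow1 y : tpow 1 y = Num.max 0 y.
Proof. by rewrite /tpow expr1 divr1. Qed.

(** The degree is at least two because the positive part has a corner at 0; there the remainder is
    at most [h ^+ 2] for [|h| < 1]. *)
Lemma dder_tpow n y : dder (tpow n.+2) y (tpow n.+1 y).
Proof.
have [y0|y0] := ltP y 0.
  rewrite /tpow [Num.max 0 y]max_l ?(ltW y0)// expr0n/= mul0r.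
  apply: (@dder_eq _ _ (fun=> 0) _ _ _ (- y)); [by rewrite oppr_gt0| |exact: dder_cst].
  move=> h hy; rewrite max_l ?expr0n/= ?mul0r//.
  by have := ler_norm h; lra.
have P : dder (fun y : R => y ^+ n.+2 / (n.+2`!)%:R) y (y ^+ n.+1 / (n.+1`!)%:R).
  apply/dderP.
  have D := is_deriveZ ((n.+2`!)%:R^-1) (is_deriveX n.+1 (is_derive_id y (1 : R))).
  have -> : (fun y : R => y ^+ n.+2 / (n.+2`!)%:R) = (n.+2`!)%:R^-1 \*: (id ^+ n.+2).
    by apply/funext => z; rewrite /= exprfctE mulrC.
  apply: is_derive_eq.
  rewrite /= factS natrM invfM [_ *: 1]mulr1 -[_ *: _]/(_ * _).
  by rewrite [X in X * _]mulrC -mulrA mulKf// mulrC.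
have [->|yn0] := eqVneq y 0.
  rewrite /tpow maxxx expr0n/= mul0r => e e0.
  exists (Num.min 1 e); first by rewrite lt_min ltr01.
  move=> h; rewrite lt_min => /andP[h1 he].
  rewrite add0r maxxx expr0n/= mul0r subr0 scaler0 subr0.
  have m0 : 0 <= Num.max 0 h by rewrite le_max lexx.
  have mh : Num.max 0 h <= `|h| by rewrite ge_max normr_ge0 ler_norm.
  have f1 : 1 <= (n.+2`!)%:R :> R by rewrite (ler_nat R 1) fact_gt0.
  rewrite ger0_norm ?divr_ge0 ?exprn_ge0//.
  apply: (@le_trans _ _ (Num.max 0 h ^+ n.+2)).
    by rewrite ler_pdivrMr; [rewrite ler_peMr ?exprn_ge0|lra].
  apply: (@le_trans _ _ (`|h| ^+ n.+2)); first by rewrite lerXn2r ?nnegrE.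
  apply: (@le_trans _ _ (`|h| ^+ 2)); first by rewrite ler_wiXn2l// ltW.
  by rewrite expr2 ler_wpM2r// ltW.
have {}y0 : 0 < y by rewrite lt_def yn0.
rewrite /tpow [Num.max 0 y]max_r ?(ltW y0)//.
apply: (dder_eq y0 _ P) => h hy.
rewrite max_r//; have := ler_norm (- h); rewrite normrN; lra.
Qed.

Lemma dder_shift f y d h : dder f (y - h) d -> dder (fun z => f (z - h)) y d.
Proof.
move=> H e e0; have [r r0 Hr] := H e e0; exists r => // z zr.
by rewrite [y + z - h]addrAC; exact: Hr.
Qed.

Lemma dder_bdiffs hs f f' : (forall y, dder f y (f' y)) ->
  forall y, dder (bdiffs hs f) y (bdiffs hs f' y).
Proof.
move=> H; elim: hs => //= h hs IH y.
rewrite /bdiff -[_ - _]/(_ + _).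
have := dderD (IH y) (dderZ (- 1) (dder_shift (IH (y - h)))).
rewrite scaleN1r; apply: dder_eq ltr01 _ => z _.
by rewrite scaleN1r.
Qed.

Lemma dder_prim_spline h h' hs y :
  dder (prim_spline [:: h, h' & hs]) y (spline [:: h, h' & hs] y).
Proof. by apply: dder_bdiffs => z; exact: dder_tpow. Qed.

(** Differentiation removes one step and leaves a difference of two translates. Through this
    identity a weak derivative becomes a finite difference. *)
Lemma dder_spline h0 h h' hs y :
  dder (spline [:: h0, h, h' & hs]) y
    (spline [:: h, h' & hs] y - spline [:: h, h' & hs] (y - h0)).
Proof.
rewrite /spline /=.
exact: (@dder_bdiffs [:: h0, h, h' & hs] _ _ (@dder_tpow (size hs)) y).
Qed.

Lemma dder_continuous f (d : R -> R) : (forall y, dder f y (d y)) -> continuous f.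
Proof.
by move=> H y; have /dderP[D _] := H y; apply: differentiable_continuous; apply/derivable1_diffP.
Qed.

Lemma dder_mvt f (d : R -> R) a b : (forall y, dder f y (d y)) -> a <= b ->
  exists2 c, a <= c <= b & f b - f a = d c * (b - a).
Proof.
move=> H ab; have [x _||c] := @MVT_segment R f d a b ab.
- exact/dderP.
- by apply: continuous_subspaceT; exact: dder_continuous H.
by rewrite in_itv/= => cab E; exists c.
Qed.

Lemma bdiffs_eq0 hs f y : all (> 0) hs -> (forall z, z <= 0 -> f z = 0) -> y <= 0 ->
  bdiffs hs f y = 0.
Proof.
move=> + f0; elim: hs y => [|h hs IH] y /=; first by move=> _; exact: f0.
by move=> /andP[h0 hs0] y0; rewrite /bdiff !IH ?subrr//; lra.
Qed.

(** Induction on the steps. The derivative is a backward difference of the shorter primitive, which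
    is monotone. For the plateau, the mean value theorem writes the difference with step [h] as [h]
    times a value of the shorter primitive on its own plateau. *)
Lemma prim_splineP h hs : all (> 0) (h :: hs) ->
  [/\ {homo prim_spline (h :: hs) : y y' / y <= y'},
      forall y, y <= 0 -> prim_spline (h :: hs) y = 0 &
      forall y, \sum_(z <- h :: hs) z <= y -> prim_spline (h :: hs) y = \prod_(z <- h :: hs) z].
Proof.
elim: hs h => [h|h' hs IH h].
  rewrite /= andbT big_seq1 big_seq1 => h0.
  have E y : prim_spline [:: h] y = Num.max 0 y - Num.max 0 (y - h).
    by rewrite /prim_spline /= /bdiff !tpow1.
  split=> [y y' yy'|y y0|y hy]; rewrite !E.
  - by case: (leP 0 y) => ?; case: (leP 0 (y - h)) => ?; case: (leP 0 y') => ?;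
      case: (leP 0 (y' - h)) => ?; lra.
  - by case: (leP 0 y) => ?; case: (leP 0 (y - h)) => ?; lra.
  - by case: (leP 0 y) => ?; case: (leP 0 (y - h)) => ?; lra.
move=> /[dup] /andP[h0 hs0] /andP[_ /IH[nd z0 top]].
split=> [y y' yy'|y y0|y].
- rewrite -subr_ge0.
  have [c _ ->] := dder_mvt (dder_prim_spline h h' hs) yy'.
  rewrite mulr_ge0 ?subr_ge0// /spline /= /bdiff nd// lerBlDr lerDl; exact: ltW.
- apply: (@bdiffs_eq0 [:: h, h' & hs] (tpow (size hs).+2)) y0; first by rewrite /= h0.
  by move=> z zle; rewrite /tpow max_l// expr0n mul0r.
- move=> hy; have {}hy : h + \sum_(z <- h' :: hs) z <= y by rewrite big_cons in hy.
  rewrite [RHS]big_cons.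
  have yh : y - h <= y by rewrite lerBlDr lerDl ltW.
  have [c /andP[hc _] E] := dder_mvt (f := bdiffs (h' :: hs) (tpow (size hs).+2))
    (@dder_bdiffs (h' :: hs) _ _ (@dder_tpow (size hs))) yh.
  rewrite /prim_spline /= [LHS]/bdiff E -[bdiffs _ _ c]/(prim_spline (h' :: hs) c).
  by rewrite top ?subKr; [rewrite mulrC|move: hy hc; set S := \sum_(_ <- _) _; lra].
Qed.

Lemma splineP h h' hs : all (> 0) [:: h, h' & hs] ->
  [/\ forall y, 0 <= spline [:: h, h' & hs] y,
      forall y, y <= 0 -> spline [:: h, h' & hs] y = 0 &
      forall y, \sum_(z <- [:: h, h' & hs]) z <= y -> spline [:: h, h' & hs] y = 0].
Proof.
move=> /[dup] hs0 /andP[h0 /prim_splineP[nd z0 top]].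
have E y : spline [:: h, h' & hs] y = prim_spline (h' :: hs) y - prim_spline (h' :: hs) (y - h).
  by [].
split=> [y|y y0|y].
- by rewrite E subr_ge0 nd// lerBlDr lerDl ltW.
- by rewrite E !z0 ?subrr//; lra.
- by rewrite big_cons E => hy; rewrite !top ?subrr//; lra.
Qed.

Lemma integral_spline h0 h h' hs z : all (> 0) [:: h0, h, h' & hs] ->
  let k y := spline [:: h0, h, h' & hs] (y - z) in
  mu.-integrable setT (EFin \o k) /\
  \int[mu]_y k y = \prod_(c <- [:: h0, h, h' & hs]) c.
Proof.
move=> hp k; set L := [:: h0, h, h' & hs] in hp k *.
have [k0 kl kr] := splineP hp.
have ck0 := dder_continuous (dder_spline h0 h h' hs).
pose K y := prim_spline L (y - z).
have dK y : dder K y (k y) by apply: dder_shift; exact: dder_prim_spline.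
have ck : continuous k.
  move=> y; apply: (@continuous_comp _ _ _ (fun y => y - z)); last exact: ck0.
  by apply: cvgB; [exact: cvg_id|exact: cvg_cst].
pose b := z + \sum_(c <- L) c + 1.
have zb : z < b.
  suff : 0 <= \sum_(c <- L) c by rewrite /b; lra.
  by rewrite big_seq sumr_ge0// => c /(allP hp)/ltW.
have kE : k = k \_ `[z, b].
  apply/funext => y; rewrite patchE; case: ifPn => //; rewrite notin_setE/= in_itv/= => /negP.
  rewrite negb_and -!ltNge => /orP[yz|by_]; first by rewrite /k kl//; lra.
  by rewrite /k kr//; move: by_; rewrite /b; set S := \sum_(_ <- _) _; lra.
have ikb : mu.-integrable `[z, b] (EFin \o k).
  apply: continuous_compact_integrable; first exact: segment_compact.
  exact: continuous_subspaceT.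
split.
  have mzb : measurable (`[z, b]%classic : set (measurableTypeR R)).
    exact: (measurable_itv `[z, b]).
  have [H _] := integrable_mkcond (mu := mu) (EFin \o k) mzb.
  apply: eq_integrable (H ikb) => // y _.
  rewrite patchE; case: ifPn => // yzb; rewrite /= kE patchE ifN//.
rewrite {1}kE -Rintegral_mkcond /Rintegral.
rewrite (@continuous_FTC2 _ _ K z b)//=.
- have [_ pl pr] := prim_splineP hp.
  rewrite /K subrr (pl 0)// subr0 pr// /b; set S := \sum_(_ <- _) _; lra.
- exact: continuous_subspaceT.
- have cK := dder_continuous dK.
  split=> [y _||].
  + by have /dderP[] := dK y.
  + by apply: cvg_at_right_filter; exact: cK.
  + by apply: cvg_at_left_filter; exact: cK.
- by move=> y _; rewrite derive1E; have /dderP[_ ->] := dK y.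
Qed.


Lemma spline_dder r L y : (1 < size L)%N ->
  dder (spline (r :: L)) y (spline L y - spline L (y - r)).
Proof. by case: L => [|h [|h' L]]// _; exact: dder_spline. Qed.

Lemma spline_ge0 L y : (1 < size L)%N -> all (> 0) L -> 0 <= spline L y.
Proof. by case: L => [|h [|h' L]]// _ /splineP[]. Qed.

Lemma spline_supp L y : (1 < size L)%N -> all (> 0) L -> spline L y != 0 ->
  0 < y < \sum_(c <- L) c.
Proof.
case: L => [|h [|h' L]]// _ /splineP[_ l r] y0; rewrite !ltNge -negb_or.
by apply: contra y0 => /orP[/l ->|/r ->].
Qed.

Lemma integral_splineP L z : (2 < size L)%N -> all (> 0) L ->
  mu.-integrable setT (EFin \o (fun y => spline L (y - z))) /\
  \int[mu]_y spline L (y - z) = \prod_(c <- L) c.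
Proof. by case: L => [|h0 [|h [|h' L]]]// _ /integral_spline; exact. Qed.

Let tpow_continuous n : continuous (tpow n.+1).
Proof.
case: n => [|n]; last exact: dder_continuous (dder_tpow n).
have -> : tpow 1 = fun y => (y + `|y|) * 2^-1.
  apply/funext => y; rewrite tpow1; case: (leP 0 y) => y0.
    by rewrite ger0_norm//; lra.
  by rewrite ltr0_norm//; lra.
move=> y; apply: cvgM; last exact: cvg_cst.
by apply: cvgD; [exact: cvg_id|exact: norm_continuous].
Qed.

Lemma spline_continuous L : (1 < size L)%N -> continuous (spline L).
Proof.
have bc hs (f : R -> R) : continuous f -> continuous (bdiffs hs f).
  move=> cf; elim: hs => //= h hs IH y; apply: cvgB; first exact: IH.
  apply: (@continuous_comp _ _ _ (fun z => z - h)); last exact: IH.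
  by apply: cvgB; [exact: cvg_id|exact: cvg_cst].
by case: L => [|h [|h' L]]// _; apply: bc; exact: tpow_continuous.
Qed.

End splines.

(** * Tensor products of B-splines as test functions *)

Section C1_products.
Context {R : realType} {n : nat}.
Local Notation E := 'rV[R]_n.
Implicit Types (F G : E -> R) (v q : E) (l : 'I_n).

Definition C1d F := (forall q, differentiable F q) /\
  forall v, continuous (fun q => 'D_v F q).

Lemma C1dP F : C1d F -> C1 setT F.
Proof.
move=> [dF cF]; split=> [q _|v]; first exact: dF.
exact: continuous_subspaceT.
Qed.

Lemma C1d_continuous F : C1d F -> continuous F.
Proof. by move=> [dF _] q; exact: differentiable_continuous. Qed.

Lemma C1d_cst (c : R) : C1d (fun=> c).
Proof.
split=> [q|v]; first exact: differentiable_cst.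
have -> : 'D_v (fun=> c) = fun=> 0 :> R by apply/funext => z; rewrite derive_cst.
exact: cst_continuous.
Qed.

Lemma C1dM F G : C1d F -> C1d G -> C1d (fun q => F q * G q) /\
  forall v q, 'D_v (fun q => F q * G q) q = F q * 'D_v G q + G q * 'D_v F q.
Proof.
move=> CF CG; have [dF cF] := CF; have [dG cG] := CG.
have D v q : 'D_v (fun q => F q * G q) q = F q * 'D_v G q + G q * 'D_v F q.
  by rewrite [LHS]deriveM//; exact: diff_derivable.
split; last exact: D.
split=> [q|v]; first exact: differentiableM.
rewrite (_ : 'D_v _ = fun q => F q * 'D_v G q + G q * 'D_v F q); last exact/funext/D.
move=> q; exact: cvgD (cvgM (C1d_continuous CF (x:=q)) (cG v q))
  (cvgM (C1d_continuous CG (x:=q)) (cF v q)).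
Qed.

Lemma C1dB F G : C1d F -> C1d G -> C1d (fun q => F q - G q) /\
  forall v q, 'D_v (fun q => F q - G q) q = 'D_v F q - 'D_v G q.
Proof.
move=> [dF cF] [dG cG].
have D v q : 'D_v (fun q => F q - G q) q = 'D_v F q - 'D_v G q.
  by rewrite [LHS]deriveB//; exact: diff_derivable.
split; last exact: D.
split=> [q|v]; first exact: differentiableB.
rewrite (_ : 'D_v _ = fun q => 'D_v F q - 'D_v G q); last exact/funext/D.
by move=> q; exact: cvgB (cF v q) (cG v q).
Qed.

Lemma C1d_coord (k k' : R -> R) l : (forall y, dder k y (k' y)) -> continuous k' ->
  C1d (fun q : E => k (q 0 l)) /\
  forall v q, 'D_v (fun q : E => k (q 0 l)) q = v 0 l * k' (q 0 l).
Proof.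
move=> dk ck.
have dkd y : differentiable k y by have /dderP[/derivable1_diffP] := dk y.
have dc q : differentiable (fun q : E => q 0 l : R) q by exact: differentiable_coord.
have D v q : 'D_v (fun q : E => k (q 0 l)) q = v 0 l * k' (q 0 l).
  rewrite deriveE; last exact: (differentiable_comp (dc q)).
  rewrite (diff_comp (dc q) (dkd _)) /=.
  rewrite diff1E// derive1E; have /dderP[_ ->] := dk (q 0 l).
  rewrite -deriveE//; congr (_ * _).
  apply: cvg_lim => //; apply: cvg_near_cst; near=> h.
  have h0 : h != 0 by near: h; exact: nbhs_dnbhs_neq.
  by rewrite /= !mxE addrK -[_ *: _]/(_ * _) mulKf.
split=> //; split=> [q|v]; first exact: (differentiable_comp (dc q)).
rewrite (_ : 'D_v _ = fun q => v 0 l * k' (q 0 l)); last exact/funext/D.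
move=> q; have c : {for q, continuous (fun q : E => k' (q 0 l))}.
  apply: (@continuous_comp _ _ _ (fun q : E => q 0 l : R)); first exact: coord_continuous.
  exact: ck.
by apply: cvgM c; exact: cvg_cst.
Unshelve. all: by end_near. Qed.

Lemma C1d_prod (k k' : 'I_n -> R -> R) (s : seq 'I_n) : uniq s ->
  (forall l y, dder (k l) y (k' l y)) -> (forall l, continuous (k' l)) ->
  C1d (fun q : E => \prod_(l <- s) k l (q 0 l)) /\
  forall j q, 'D_('e_j) (fun q : E => \prod_(l <- s) k l (q 0 l)) q =
    if j \in s then \prod_(l <- s) (if l == j then k' l else k l) (q 0 l) else 0.
Proof.
move=> + dk ck; elim: s => [_|a s IH /= /andP[as_ us]].
  have -> : (fun q : E => \prod_(l <- [::]) k l (q 0 l)) = fun=> 1.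
    by apply/funext => q; rewrite big_nil.
  by split=> [|j q]; [exact: C1d_cst|rewrite derive_cst].
have [CI DI] := IH us.
have [Ca Da] := C1d_coord a (dk a) (ck a).
have -> : (fun q : E => \prod_(l <- a :: s) k l (q 0 l)) =
    (fun q => k a (q 0 a) * \prod_(l <- s) k l (q 0 l)).
  by apply/funext => q; rewrite big_cons.
have [C D] := C1dM Ca CI; split=> // j q.
rewrite D Da DI inE big_cons mxE eqxx/= [j == a]eq_sym.
have [aj|aj] := eqVneq a j; last by rewrite mul0r mulr0 addr0; case: ifP => //; rewrite mulr0.
rewrite -aj (negbTE as_) mulr0 add0r mul1r mulrC; congr (_ * _).
apply: eq_big_seq => l ls; case: eqP => // la.
by move: as_; rewrite -la ls.
Qed.

Definition bump (z : E) (L : 'I_n -> seq R) (y : E) : R :=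
  \prod_l spline (L l) (y 0 l - z 0 l).

(** On bumps this is the convolution with the indicator of [[0, r]] along the j-th axis;
    [bump_derive] says that the j-th derivative undoes it, up to a difference of translates. *)
Definition add_step (j : 'I_n) (r : R) (L : 'I_n -> seq R) : 'I_n -> seq R :=
  fun l => if l == j then r :: L l else L l.

Let bump_factor (z : E) L l : (2 < size (L l))%N ->
  let k' x := spline (behead (L l)) (x - z 0 l)
    - spline (behead (L l)) (x - z 0 l - head 0 (L l)) in
  (forall y, dder (fun x => spline (L l) (x - z 0 l)) y (k' y)) /\ continuous k'.
Proof.
move: (L l) => [|h L']//; rewrite [size _]/= ltnS => sL' k'; split=> [y|y].
  by apply: dder_shift; exact: spline_dder.
have cs (c : R) : {for y, continuous (fun x => spline L' (x - c))}.
  apply: (@continuous_comp _ _ _ (fun x => x - c)); last exact: spline_continuous.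
  by apply: cvgB; [exact: cvg_id|exact: cvg_cst].
rewrite /k' /=; have -> : (fun x => spline L' (x - z 0 l) - spline L' (x - z 0 l - h)) =
    (fun x => spline L' (x - z 0 l) - spline L' (x - (z 0 l + h))).
  by apply/funext => x; rewrite opprD addrA.
exact: cvgB (cs _) (cs _).
Qed.

Lemma bump_C1 z L : (forall l, 2 < size (L l))%N -> C1d (bump z L).
Proof.
move=> sL.
by have [] := @C1d_prod (fun l x => spline (L l) (x - z 0 l)) _ (index_enum _)
  (index_enum_uniq _) (fun l => (bump_factor z (sL l)).1) (fun l => (bump_factor z (sL l)).2).
Qed.

Lemma bump_derive z L j r y : (forall l, 2 < size (L l))%N ->
  'D_('e_j) (bump z (add_step j r L)) y = bump z L y - bump (z + r *: 'e_j) L y.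
Proof.
move=> sL; have sL' l : (2 < size (add_step j r L l))%N.
  by rewrite /add_step; case: ifP => // _; exact: ltn_trans (sL l) _.
have [_ ->] := @C1d_prod (fun l x => spline (add_step j r L l) (x - z 0 l)) _ (index_enum _)
  (index_enum_uniq _) (fun l => (bump_factor z (sL' l)).1) (fun l => (bump_factor z (sL' l)).2).
rewrite mem_index_enum /bump (bigD1 j)//= [X in _ = X - _](bigD1 j)//=
  [X in _ = _ - X](bigD1 j)//= eqxx /add_step eqxx/=.
rewrite (eq_bigr (fun l => spline (L l) (y 0 l - z 0 l))); last first.
  by move=> l /negbTE ->.
rewrite [X in _ = _ - _ * X](eq_bigr (fun l => spline (L l) (y 0 l - z 0 l))); last first.
  by move=> l /negbTE lj; rewrite !mxE eqxx lj mulr0 addr0.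
by rewrite !mxE !eqxx mulr1 opprD addrA mulrBl.
Qed.

Lemma bump_ge0 z L y : (forall l, 1 < size (L l))%N -> (forall l, all (> 0) (L l)) ->
  0 <= bump z L y.
Proof. by move=> sL L0; apply: prodr_ge0 => l _; exact: spline_ge0. Qed.

Lemma bump_supp z L y : (forall l, 1 < size (L l))%N -> (forall l, all (> 0) (L l)) ->
  bump z L y != 0 -> forall l, z 0 l < y 0 l < z 0 l + \sum_(c <- L l) c.
Proof.
move=> sL L0 /prodf_neq0 H l; have /(spline_supp (sL l) (L0 l)) := H l isT.
by rewrite subr_gt0 ltrBlDl.
Qed.

Lemma integral_bump_sandwich p m (c : 'I_p -> R) (z : 'I_p -> E) (L : 'I_p -> 'I_n -> seq R)
    (c' : 'I_m -> R) (z' : 'I_m -> E) (L' : 'I_m -> 'I_n -> seq R) (F : E -> R) :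
  (forall i l, 2 < size (L i l))%N -> (forall i l, all (> 0) (L i l)) ->
  (forall i l, 2 < size (L' i l))%N -> (forall i l, all (> 0) (L' i l)) ->
  (forall y, \sum_i c i * bump (z i) (L i) y <= F y <= \sum_i c' i * bump (z' i) (L' i) y) ->
  \sum_i c i * \prod_l \prod_(d <- L i l) d <= integral_rV F
    <= \sum_i c' i * \prod_l \prod_(d <- L' i l) d.
Proof.
move=> sL L0 sL' L0' H.
have E k (d : 'I_k -> R) (w : 'I_k -> E) (M : 'I_k -> 'I_n -> seq R) :
    (forall i l, 2 < size (M i l))%N -> (forall i l, all (> 0) (M i l)) ->
    \sum_i d i * \prod_l \prod_(e <- M i l) e =
    \sum_i d i * \prod_(l < n) \int[lebesgue_measure]_x spline (M i l) (x - w i 0 l).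
  move=> sM M0; apply: eq_bigr => i _; congr (_ * _); apply: eq_bigr => l _.
  by have [_ ->] := integral_splineP (w i 0 l) (sM i l) (M0 i l).
rewrite (E _ _ z)// (E _ _ z')//.
apply: (@integral_rV_sandwich R n p m c (fun i l x => spline (L i l) (x - z i 0 l))
  c' (fun i l x => spline (L' i l) (x - z' i 0 l)) F).
- by move=> i l; have [] := integral_splineP (z i 0 l) (sL i l) (L0 i l).
- by move=> i l; have [] := integral_splineP (z' i 0 l) (sL' i l) (L0' i l).
- exact: H.
Qed.

Let boxed_test (V : set E) (a b : E) F : C1d F ->
  (forall y : E, F y != 0 -> forall l, a 0 l <= y 0 l <= b 0 l) ->
  (forall y : E, (forall l, a 0 l <= y 0 l <= b 0 l) -> V y) ->
  test_function V F.
Proof.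
move=> CF FB BV; pose B : set E := [set y | forall l, y ord0 l \in `[a 0 l, b 0 l]].
have cB : compact B.
  exact: (@rV_compact R n (fun l => `[a 0 l, b 0 l]%classic) (fun l => @segment_compact R _ _)).
have clB : closed B by apply: compact_closed => //; exact: norm_hausdorff.
have sB : closure [set z | F z != 0] `<=` B.
  rewrite [X in _ `<=` X](closure_id B).1//; apply: closure_subset => y /= Fy l.
  by rewrite in_itv; exact: FB.
split.
- exact: C1dP.
- by apply: subclosed_compact cB sB; exact: closed_closure.
- by move=> y /sB By; apply: BV => l; have := By l; rewrite in_itv.
Qed.

Let shift_le (z : E) r j l : 0 < r -> z 0 l <= (z + r *: 'e_j) 0 l <= z 0 l + (if l == j then r else 0).
Proof.
move=> r0; rewrite !mxE eqxx/=; case: eqP => _; rewrite ?mulr1 ?mulr0; lra.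
Qed.

Lemma bump_test (V : set E) (z : E) L : (forall l, 2 < size (L l))%N ->
  (forall l, all (> 0) (L l)) ->
  (forall y : E, (forall l, z 0 l <= y 0 l <= z 0 l + \sum_(c <- L l) c) -> V y) ->
  test_function V (bump z L).
Proof.
move=> sL L0 BV; apply: (@boxed_test V z (\row_l (z 0 l + \sum_(c <- L l) c))).
- exact: bump_C1.
- move=> y y0 l; rewrite mxE.
  by have /andP[/ltW -> /ltW ->] := bump_supp (fun l => ltnW (sL l)) L0 y0 l.
- by move=> y H; apply: BV => l; have := H l; rewrite mxE.
Qed.

Lemma bump_derive_test (V : set E) (z : E) L j r : (forall l, 2 < size (L l))%N ->
  (forall l, all (> 0) (L l)) -> 0 < r ->
  (forall y : E, (forall l, z 0 l <= y 0 l <= z 0 l + \sum_(c <- add_step j r L l) c) -> V y) ->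
  test_function V (fun y => bump z L y - bump (z + r *: 'e_j) L y).
Proof.
move=> sL L0 r0 BV.
apply: (@boxed_test V z (\row_l (z 0 l + \sum_(c <- add_step j r L l) c))).
- by have [] := C1dB (bump_C1 z sL) (bump_C1 (z + r *: 'e_j) sL).
- move=> y y0 l; rewrite mxE.
  have S : \sum_(c <- add_step j r L l) c = (if l == j then r else 0) + \sum_(c <- L l) c.
    by rewrite /add_step; case: ifP => _; rewrite ?big_cons ?add0r.
  have r0' : 0 <= if l == j then r else 0 by case: ifP => // _; exact: ltW.
  rewrite S; have [b0|b0] := eqVneq (bump z L y) 0.
    have b0' : bump (z + r *: 'e_j) L y != 0 by move: y0; rewrite b0 sub0r oppr_eq0.
    have := bump_supp (fun l => ltnW (sL l)) L0 b0' l.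
    have := shift_le z j l r0; move: (\sum_(_ <- _) _) (if _ then _ else _) r0' => ? ? ?; lra.
  have := bump_supp (fun l => ltnW (sL l)) L0 b0 l.
  move: (\sum_(_ <- _) _) (if _ then _ else _) r0' => ? ? ?; lra.
- by move=> y H; apply: BV => l; have := H l; rewrite mxE.
Qed.

End C1_products.

Section four_point.
Context {R : realType} {n : nat}.
Local Notation E := 'rV[R]_n.

(* Testing the second weak derivative against a tensor product of B-splines
   turns it into an integrated second difference. *)
Lemma sobolev_four_point (V : set E) (f : E -> R) : continuous f -> sobolev_oo 2 V f ->
  exists2 M, 0 <= M & forall i j (z : E) (s r e : R), 0 < s -> 0 < r -> 0 < e ->
    (forall y : E, (forall l, z 0 l <= y 0 l <= z 0 l + ((if l == i then s else 0) +
        (if l == j then r else 0) + e)) -> V y) ->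
    `|f z - f (z + s *: 'e_i) - f (z + r *: 'e_j) + f (z + s *: 'e_i + r *: 'e_j)| <= M * s * r.
Proof.
move=> cf [_ /= Hf].
have /choice[M_ HM] : forall ij : 'I_n * 'I_n, exists M : R, 0 <= M /\ exists g h,
    [/\ weak_partial V ij.1 f g, weak_partial V ij.2 g h & forall z, V z -> `|h z| <= M].
  move=> [i j]; have [g wg [_ /(_ j)[h wh [[_ [M hM]] _]]]] := Hf i.
  exists (Num.max 0 M); split; first by rewrite le_max lexx.
  exists g, h; split => // z /hM /le_trans; apply; by rewrite le_max lexx orbT.
exists (\sum_ij M_ ij); first by apply: sumr_ge0 => ij _; case: (HM ij).
move=> i j z s r e s0 r0 e0 BV.
have [M0 [g [h [wg wh hM]]]] := HM (i, j); rewrite /= in wg wh hM.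
have MM : M_ (i, j) <= \sum_ij M_ ij.
  by rewrite (bigD1 (i, j))//= lerDl sumr_ge0// => ij _; case: (HM ij).
pose c1 := z; pose c2 := z + s *: 'e_i; pose c3 := z + r *: 'e_j.
pose c4 := z + s *: 'e_i + r *: 'e_j.
rewrite -[X in f X - _ - _]/c1 -/c2 -/c3 -/c4.
(* The tolerance [w] pays for replacing [f] by its corner values; the main term does not depend on
   it. *)
suff H w : 0 < w -> `|f c1 - f c2 - f c3 + f c4| <= M_ (i, j) * s * r + 4 * w.
  apply: (@le_trans _ _ (M_ (i, j) * s * r)); last first.
    by rewrite -!mulrA ler_wpM2r// mulr_ge0// ltW.
  apply/ler_addgt0Pr => w w0; have := H (w / 4); rewrite divr_gt0// => /(_ isT).
  by have -> : 4 * (w / 4) = w by lra.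
move=> w0.
have near_f (c : E) : exists2 d, 0 < d & forall y : E, (forall l, `|c 0 l - y 0 l| < d) ->
    `|f y - f c| <= w.
  have := cf c; move=> /cvgrPdist_le/(_ w w0) /nbhs_ballP[d d0 Hd]; exists d => // y cy.
  by rewrite distrC; apply: Hd; split=> // a b; rewrite ord1; exact: cy.
have [d1 d10 H1] := near_f c1; have [d2 d20 H2] := near_f c2.
have [d3 d30 H3] := near_f c3; have [d4 d40 H4] := near_f c4.
pose m := Num.min (Num.min d1 d2) (Num.min (Num.min d3 d4) e).
have m0 : 0 < m by rewrite !lt_min d10 d20 d30 d40 e0.
have [md1 md2 md3 md4 me] : [/\ m <= d1, m <= d2, m <= d3, m <= d4 & m <= e].
  by rewrite /m; split; rewrite !ge_min lexx ?orbT.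
(* Three steps of size [eps] add up to less than [m], so each corner bump stays where [f] is within
   [w] of its corner value, and the large bump stays within the margin [e]. *)
pose eps := m / 4.
have eps0 : 0 < eps by rewrite divr_gt0.
pose L0 : 'I_n -> seq R := fun _ => [:: eps; eps; eps].
(* The bump with steps [L2] tests [h]. Its j-th derivative is a difference of bumps with steps [L1],
   which tests [g]; the i-th derivatives of these leave small bumps at the four corners. *)
pose L1 := add_step i s L0; pose L2 := add_step j r L1.
have sL0 l : (2 < size (L0 l))%N by [].
have sL1 l : (2 < size (L1 l))%N by rewrite /L1 /add_step; case: ifP.
have sL2 l : (2 < size (L2 l))%N.
  by rewrite /L2 /add_step; case: ifP => _ //; exact: ltnW (sL1 l).
have pL0 l : all (> 0) (L0 l) by rewrite /= eps0.
have pL1 l : all (> 0) (L1 l) by rewrite /L1 /add_step; case: ifP => _; rewrite /= ?s0 ?eps0.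
have pL2 l : all (> 0) (L2 l) by rewrite /L2 /add_step; case: ifP => _; rewrite /= ?r0 pL1.
have S0 l : \sum_(c <- L0 l) c = eps + (eps + eps) by rewrite !big_cons big_nil addr0.
have S2 l : \sum_(c <- L2 l) c = (if l == j then r else 0) + ((if l == i then s else 0) + (eps + (eps + eps))).
  rewrite /L2 /L1 /add_step; by do 2 case: ifP => _; rewrite ?big_cons big_nil ?add0r ?addr0.
have box (y : E) : (forall l, z 0 l <= y 0 l <= z 0 l + \sum_(c <- L2 l) c) -> V y.
  move=> H; apply: BV => l; have := H l; rewrite S2.
  have : eps + (eps + eps) <= e by rewrite /eps; lra.
  move: (if _ then _ else _) (if _ then _ else _) => a b; clear; lra.
have E2 := wh _ (bump_test sL2 pL2 box).
have {}E2 : integral_rV (fun y => g y * (bump z L1 y - bump c3 L1 y)) =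
    - integral_rV (fun y => h y * bump z L2 y).
  by rewrite -E2; congr integral_rV; apply/funext => y; rewrite bump_derive.
have E1 := wg _ (bump_derive_test sL1 pL1 r0 box).
pose F y := f y * (bump c1 L0 y - bump c2 L0 y - (bump c3 L0 y - bump c4 L0 y)).
have {}E1 : integral_rV F = integral_rV (fun y => h y * bump z L2 y).
  rewrite -[RHS]opprK -E2 -E1; congr integral_rV; apply/funext => y; congr (_ * _).
  have [_ ->] := C1dB (bump_C1 z sL1) (bump_C1 c3 sL1).
  have E4 : c4 = c3 + s *: 'e_i by rewrite /c4 /c3 addrAC.
  by rewrite !bump_derive// E4.
pose P0 := \prod_l \prod_(d <- L0 l) d.
have P00 : 0 < P0.
  by apply: prodr_gt0 => l _; rewrite !big_cons big_nil mulr1 !mulr_gt0.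
have P2 : \prod_l \prod_(d <- L2 l) d = r * s * P0.
  rewrite (eq_bigr (fun l => (if l == j then r else 1) *
      ((if l == i then s else 1) * \prod_(d <- L0 l) d))); last first.
    move=> l _; rewrite /L2 /L1 /add_step; do 2 case: ifP => _; rewrite ?big_cons big_nil; ring.
  rewrite big_split big_split/= -!big_mkcond !big_pred1_eq mulrA //.
have I1 : - (M_ (i, j) * (r * s * P0)) <= integral_rV (fun y => h y * bump z L2 y)
    <= M_ (i, j) * (r * s * P0).
  have := @integral_bump_sandwich R n 1 1 (fun=> - M_ (i, j)) (fun=> z) (fun=> L2)
    (fun=> M_ (i, j)) (fun=> z) (fun=> L2) (fun y => h y * bump z L2 y).
  rewrite !big_ord1 P2 mulNr; apply=> // y; rewrite !big_ord1.
  have b0 := bump_ge0 z y (fun l => ltnW (sL2 l)) pL2.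
  have [->|bn0] := eqVneq (bump z L2 y) 0; first by rewrite !mulr0 lexx.
  have /hM : V y.
    apply: box => l.
    by have /andP[/ltW -> /ltW ->] := bump_supp (fun l => ltnW (sL2 l)) pL2 bn0 l.
  by rewrite ler_norml => /andP[h1 h2]; rewrite !ler_wpM2r.
have near_bump (c : E) (d : R) (y : E) : eps + (eps + eps) < d -> (forall y : E, (forall l, `|c 0 l - y 0 l| < d) ->
    `|f y - f c| <= w) -> - (w * bump c L0 y) <= (f y - f c) * bump c L0 y <= w * bump c L0 y.
  move=> ed Hc; have b0 := bump_ge0 c y (fun l => ltnW (sL0 l)) pL0.
  have [->|bn0] := eqVneq (bump c L0 y) 0; first by rewrite !mulr0 oppr0 lexx.
  have /Hc : forall l, `|c 0 l - y 0 l| < d.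
    move=> l; have := bump_supp (fun l => ltnW (sL0 l)) pL0 bn0 l.
    rewrite S0 ltr_norml; clear -ed; lra.
  by rewrite ler_norml => /andP[h1 h2]; rewrite -mulNr !ler_wpM2r.
have ed (d : R) : m <= d -> eps + (eps + eps) < d by rewrite /eps; lra.
(* Each corner bump has integral [P0] and averages [f] up to [w], with the sign of its corner in the
   second difference. *)
have I2 : (f c1 - f c2 - f c3 + f c4 - 4 * w) * P0 <= integral_rV F
    <= (f c1 - f c2 - f c3 + f c4 + 4 * w) * P0.
  pose cs (u : R) (k : 'I_4) := nth 0 [:: f c1 + u; - f c2 + u; - f c3 + u; f c4 + u] k.
  pose zs (k : 'I_4) : E := nth 0 [:: c1; c2; c3; c4] k.
  have Ecs u : (f c1 - f c2 - f c3 + f c4 + 4 * u) * P0 = \sum_k cs u k * P0.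
    by rewrite !big_ord_recl big_ord0 /cs /=; ring.
  rewrite -mulrN !Ecs.
  apply: (integral_bump_sandwich (z := zs) (z' := zs) (L := fun=> L0) (L' := fun=> L0)) => // y.
  rewrite !big_ord_recl !big_ord0 /cs /zs /= /F.
  have := near_bump c1 d1 y (ed _ md1) H1; have := near_bump c2 d2 y (ed _ md2) H2.
  have := near_bump c3 d3 y (ed _ md3) H3; have := near_bump c4 d4 y (ed _ md4) H4.
  clear; lra.
rewrite E1 in I2.
move: I1 I2; set I := integral_rV _; set d := f c1 - _ - _ + _ => /andP[a1 a2] /andP[a3 a4].
rewrite ler_norml; apply/andP; split; rewrite -(ler_pM2r P00); clear -a1 a2 a3 a4; lra.
Qed.

End four_point.

(** * The signed distance to the interface *)

Section euclidean_lemmas.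
Context {R : realType} {n : nat}.
Local Notation E := 'rV[R]_n.
Implicit Types (u v w : E) (a : R).

Lemma dotC u v : dot u v = dot v u.
Proof. by apply: eq_bigr => i _; rewrite mulrC. Qed.

Lemma dotDl u v w : dot (u + v) w = dot u w + dot v w.
Proof. by rewrite -big_split; apply: eq_bigr => i _; rewrite mxE mulrDl. Qed.

Lemma dotZl a u v : dot (a *: u) v = a * dot u v.
Proof. by rewrite mulr_sumr; apply: eq_bigr => i _; rewrite mxE mulrA. Qed.

Lemma dotDr u v w : dot u (v + w) = dot u v + dot u w.
Proof. by rewrite !(dotC u) dotDl. Qed.

Lemma dotZr a u v : dot u (a *: v) = a * dot u v.
Proof. by rewrite !(dotC u) dotZl. Qed.

Lemma dotNl u v : dot (- u) v = - dot u v.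
Proof. by rewrite -scaleN1r dotZl mulN1r. Qed.

Lemma dotNr u v : dot u (- v) = - dot u v.
Proof. by rewrite !(dotC u) dotNl. Qed.

Lemma dotBl u v w : dot (u - v) w = dot u w - dot v w.
Proof. by rewrite dotDl dotNl. Qed.

Lemma dotBr u v w : dot u (v - w) = dot u v - dot u w.
Proof. by rewrite dotDr dotNr. Qed.

Lemma dot0l u : dot 0 u = 0.
Proof. by rewrite -(scale0r 0) dotZl mul0r. Qed.

Lemma dot_ge0 u : 0 <= dot u u.
Proof. by apply: sumr_ge0 => i _; rewrite -expr2 sqr_ge0. Qed.

Lemma enorm_ge0 u : 0 <= enorm u.
Proof. exact: sqrtr_ge0. Qed.

Lemma sqr_enorm u : enorm u ^+ 2 = dot u u.
Proof. by rewrite sqr_sqrtr// dot_ge0. Qed.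

Lemma enorm0 : enorm (0 : E) = 0.
Proof. by rewrite /enorm dot0l sqrtr0. Qed.

Lemma enormZ a u : enorm (a *: u) = `|a| * enorm u.
Proof. by rewrite /enorm dotZl dotZr mulrA -expr2 sqrtrM ?sqr_ge0// sqrtr_sqr. Qed.

Lemma enormN u : enorm (- u) = enorm u.
Proof. by rewrite -scaleN1r enormZ normrN1 mul1r. Qed.

Lemma enorm_distC u v : enorm (u - v) = enorm (v - u).
Proof. by rewrite -enormN opprB. Qed.

Lemma dot_enorm u v : `|dot u v| <= enorm u * enorm v.
Proof.
have [v0|v0] := eqVneq (enorm v) 0.
  have /eqP : dot v v = 0 by rewrite -sqr_enorm v0 expr0n.
  rewrite psumr_eq0 => [/allP vi|i _]; last by rewrite -expr2 sqr_ge0.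
  rewrite v0 mulr0 (_ : dot u v = 0) ?normr0//.
  apply: big1 => i _; have := vi i (mem_index_enum _).
  by rewrite /= mulf_eq0 orbb => /eqP ->; rewrite mulr0.
have v2 : 0 < dot v v by rewrite -sqr_enorm exprn_even_gt0.
have := dot_ge0 (dot v v *: u - dot u v *: v).
rewrite dotBl !dotBr !dotZl !dotZr (dotC v u) => H.
have H2 : 0 <= dot v v * (dot v v * dot u u - dot u v ^+ 2) by lra.
rewrite pmulr_rge0// subr_ge0 in H2.
rewrite -(@ler_pXn2r _ 2) ?nnegrE ?mulr_ge0 ?enorm_ge0//.
by rewrite exprMn !sqr_enorm real_normK ?num_real// mulrC.
Qed.

Lemma enormD u v : enorm (u + v) <= enorm u + enorm v.
Proof.
rewrite -(@ler_pXn2r _ 2) ?nnegrE ?addr_ge0 ?enorm_ge0//.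
rewrite sqr_enorm sqrrD !sqr_enorm dotDl !dotDr (dotC v u).
have := dot_enorm u v; have := ler_norm (dot u v); lra.
Qed.

Lemma enorm_triangle w u v : enorm (u - v) <= enorm (u - w) + enorm (w - v).
Proof. by have := enormD (u - w) (w - v); rewrite addrA subrK. Qed.

Lemma coord_le_enorm u i : `|u 0 i| <= enorm u.
Proof.
rewrite -(@ler_pXn2r _ 2) ?nnegrE ?enorm_ge0// sqr_enorm real_normK ?num_real//.
rewrite /dot (bigD1 i)//= -expr2 lerDl sumr_ge0// => j _.
by rewrite -expr2 sqr_ge0.
Qed.

Lemma norm_le_enorm u : `|u| <= enorm u.
Proof.
rewrite [leLHS](_ : _ = mx_norm u)// mx_normrE.
apply/bigmax_leP; split; first exact: enorm_ge0.
by move=> [a i] _; rewrite ord1; exact: coord_le_enorm.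
Qed.

Lemma coord_le_norm u i : `|u 0 i| <= `|u|.
Proof.
rewrite [leRHS](_ : _ = mx_norm u)// mx_normrE.
by apply: (le_bigmax _ (fun ij => `|u ij.1 ij.2|) (0, i)).
Qed.

Lemma enorm_le_sum u : enorm u <= \sum_i `|u 0 i|.
Proof.
have s0 : 0 <= \sum_i `|u 0 i| by apply: sumr_ge0.
rewrite -(@ler_pXn2r _ 2) ?nnegrE ?enorm_ge0// sqr_enorm expr2 mulr_suml.
apply: ler_sum => i _; rewrite -expr2 -real_normK ?num_real// expr2.
by rewrite ler_wpM2l// (bigD1 i)//= lerDl sumr_ge0.
Qed.

Lemma sum_le_enorm u : \sum_i `|u 0 i| <= n%:R * enorm u.
Proof.
apply: (@le_trans _ _ (\sum_(i < n) enorm u)).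
  by apply: ler_sum => i _; exact: coord_le_enorm.
by rewrite sumr_const card_ord mulr_natl.
Qed.

Lemma enorm_le_norm u : enorm u <= n%:R * `|u|.
Proof.
apply: le_trans (enorm_le_sum u) _.
apply: (@le_trans _ _ (\sum_(i < n) `|u|)).
  by apply: ler_sum => i _; exact: coord_le_norm.
by rewrite sumr_const card_ord mulr_natl.
Qed.

Lemma enorm_eq0 u : enorm u = 0 -> u = 0.
Proof.
move=> u0; apply/rowP => i; rewrite mxE; apply/normr0_eq0/eqP.
by rewrite eq_le normr_ge0 andbT -u0 coord_le_enorm.
Qed.

Lemma enorm_delta i : enorm ('e_i : E) = 1.
Proof.
rewrite /enorm /dot (bigD1 i)//= big1 ?addr0 ?mxE ?eqxx ?mulr1 ?sqrtr1//.
by move=> j ji; rewrite !mxE (negbTE ji) andbF mul0r.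
Qed.

Lemma near_enorm u : forall e, 0 < e -> exists2 d, 0 < d & forall v, `|u - v| < d -> enorm (u - v) < e.
Proof.
move=> e e0; exists (e / (n%:R + 1)); first by rewrite divr_gt0// ltr_wpDl.
move=> v uv; apply: le_lt_trans (enorm_le_norm _) _.
have n0 : 0 < n%:R + 1 :> R by rewrite ltr_wpDl.
move: uv; rewrite ltr_pdivlMr// mulrC => uv.
apply: le_lt_trans uv; by rewrite ler_wpM2r// lerDl.
Qed.

Lemma enorm_lipschitz_continuous (f : E -> R) :
  (forall u v, `|f u - f v| <= enorm (u - v)) -> continuous f.
Proof.
move=> H u A /nbhs_ballP[e /= e0 HA].
have [d d0 Hd] := near_enorm u e0; apply/nbhs_ballP; exists d => //= v.
rewrite -ball_normE /= => uv; apply: HA; rewrite -ball_normE /=.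
by apply: le_lt_trans (H u v) _; exact: Hd.
Qed.

End euclidean_lemmas.

(** * First-order expansions from bounded second differences *)

Section second_difference.
Context {R : realType}.
Local Notation mu := (@lebesgue_measure R).

Lemma ae_exists (P : R -> Prop) (a b : R) : {ae mu, forall s, P s} -> a < b ->
  exists2 s, a < s < b & P s.
Proof.
move=> [B [mB B0 PB]] ab; apply: contrapT => H.
have sB : `]a, b[%classic `<=` B.
  move=> s; rewrite /= in_itv/= => sab; apply: PB => Ps; apply: H; by exists s.
have mab : measurable (`]a, b[%classic : set R) by exact: (measurable_itv `]a, b[).
have : (mu `]a, b[%classic <= mu B)%E.
  by apply: le_measure; rewrite ?inE.
rewrite [X in (_ <= X)%E](_ : _ = 0%E)// lebesgue_measure_itv/= lte_fin ab -EFinB lee_fin; lra.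
Qed.

(** Points of differentiability [a] lie arbitrarily close to 0. The increments over [h] at [a] and
    at 0 differ by at most [M * |h| * a], so the quotients at 0 end up near the derivative at [a];
    hence they are Cauchy. *)
Lemma second_difference_dder (f : R -> R) (rho M : R) : 0 < rho -> 0 <= M ->
  lipon 1 (- rho) rho f ->
  (forall h r, `|h| < rho -> `|r| < rho -> `|f 0 - f h - f r + f (h + r)| <= M * `|h| * `|r|) ->
  exists d, dder f 0 d.
Proof.
move=> rho0 M0 fL H.
have ap (e : R) : 0 < e -> exists d : R, exists2 t : R, 0 < t & forall h : R, `|h| < t ->
    `|f h - f 0 - h * d| <= e * `|h|.
  move=> e0; have e20 : 0 < e / 2 by rewrite divr_gt0.
  pose m := Num.min rho (e / 2 / (M + 1)).
  have M1 : 0 < M + 1 by lra.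
  have m0 : 0 < m by rewrite lt_min rho0 divr_gt0.
  have [a /andP[a0 am] Pa] := ae_exists (lipschitz_ae_dder fL) m0.
  have ar : a < rho by apply: lt_le_trans am _; rewrite ge_min lexx.
  have [|d /(_ (e / 2) e20)[t t0 Ht]] := Pa; first by lra.
  exists d, (Num.min t rho); first by rewrite lt_min t0.
  move=> h; rewrite lt_min => /andP[ht hr].
  have h1 := Ht h ht; rewrite -[_ *: _]/(_ * _) in h1.
  have a' : `|a| < rho by rewrite gtr0_norm.
  have h2 := H h a hr a'; rewrite (gtr0_norm a0) in h2.
  have h3 : M * `|h| * a <= e / 2 * `|h|.
    rewrite mulrAC ler_wpM2r//; apply: (@le_trans _ _ ((M + 1) * a)).
      by rewrite ler_wpM2r ?(ltW a0)// lerDl.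
    by rewrite mulrC -ler_pdivlMr//; apply: ltW; apply: lt_le_trans am _; rewrite ge_min lexx orbT.
  have -> : f h - f 0 - h * d = (f (a + h) - f a - h * d) - (f 0 - f h - f a + f (h + a)).
    by rewrite [h + a]addrC; lra.
  by apply: le_trans (ler_normB _ _) _; lra.
pose q (h : R) := h^-1 * (f h - f 0).
have cq : cvg (q @ 0^').
  apply: cauchy_cvg; apply: cauchy_exP => e e0.
  have e20 : 0 < e / 2 by rewrite divr_gt0.
  have [d [t t0 Ht]] := ap _ e20; exists d.
  suff : \forall h \near 0^', ball d e (q h) by [].
  near=> h; have h0 : h != 0 by near: h; exact: nbhs_dnbhs_neq.
  have ht : `|h| < t by near: h; exact: dnbhs0_lt.
  rewrite -ball_normE /= /q.
  have -> : d - h^-1 * (f h - f 0) = - (h^-1 * (f h - f 0 - h * d)).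
    by rewrite [in RHS]mulrBr mulKf// opprB.
  rewrite normrN normrM normfV -ltr_pdivlMl ?invr_gt0 ?normr_gt0// invrK.
  apply: le_lt_trans (Ht h ht) _; rewrite mulrC ltr_pM2l ?normr_gt0//; lra.
have [l ql] := (cvg_ex _).1 cq; exists l => e e0.
move: ql => /cvgrPdist_le/(_ e e0)[t /= t0 Ht]; exists t => // h ht.
rewrite add0r -[_ *: _]/(_ * _); have [->|h0] := eqVneq h 0.
  by rewrite subrr mul0r subr0 normr0 mulr0.
have := Ht h; rewrite /ball/= sub0r normrN => /(_ ht h0); rewrite /q => Hq.
have -> : f h - f 0 - h * l = - (h * (l - h^-1 * (f h - f 0))).
  by rewrite mulrBr mulVKf// opprB; ring.
by rewrite normrN normrM mulrC ler_wpM2r.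
Unshelve. all: by end_near. Qed.

End second_difference.

Section expansion.
Context {R : realType} {n : nat}.
Local Notation mu := (@lebesgue_measure R).
Local Notation E := 'rV[R]_n.
Implicit Types (u z : E).

(** Added to [z], these are the vertices of an axis-parallel path from [z] to [z + u]. Balls of the
    sup norm are boxes, so the path stays in any ball that contains its two ends. *)
Definition trunc_row (k : nat) u : E := \row_i (if (i < k)%N then u 0 i else 0).

Let truncS (i : 'I_n) u : trunc_row i.+1 u = trunc_row i u + u 0 i *: 'e_i.
Proof.
apply/rowP => j; rewrite !mxE eqxx/= ltnS leq_eqVlt.
have [->|ji] := eqVneq j i; first by rewrite eqxx ltnn/= add0r mulr1.
by rewrite val_eqE (negbTE ji)/= mulr0 addr0.
Qed.

Let telescope (g : E -> R) z u : g (z + u) - g z =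
  \sum_(i < n) (g (z + trunc_row i u + u 0 i *: 'e_i) - g (z + trunc_row i u)).
Proof.
have -> : u = trunc_row n u by apply/rowP => j; rewrite mxE ltn_ord.
rewrite -[in LHS](addr0 z) -[X in _ - g (_ + X)](_ : trunc_row 0 u = 0); last first.
  by apply/rowP => j; rewrite !mxE.
have tt i : (i <= n)%N -> trunc_row i (trunc_row n u) = trunc_row i u.
  by move=> ni; apply/rowP => j; rewrite !mxE ltn_ord.
rewrite -addrA add0r -(telescope_sumr (fun k => g (z + trunc_row k u)) (leq0n n)) big_mkord.
by apply: eq_bigr => i _; rewrite tt ?(ltnW (ltn_ord i))// truncS addrA mxE ltn_ord.
Qed.

Let trunc_ball (x z : E) rho u k : ball x rho z -> ball x rho (z + u) -> ball x rho (z + trunc_row k u).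
Proof.
rewrite -!ball_normE /= => xz xzu.
have rho0 : 0 < rho by apply: le_lt_trans xz.
rewrite [ltLHS](_ : _ = mx_norm (x - (z + trunc_row k u)))// mx_normrE.
apply: bigmax_lt => //= -[a i] _ /=; rewrite ord1 !mxE; case: ifP => _.
  by apply: le_lt_trans xzu; have := coord_le_norm (x - (z + u)) i; rewrite !mxE.
by rewrite addr0; apply: le_lt_trans xz; have := coord_le_norm (x - z) i; rewrite !mxE.
Qed.

Variables (f : E -> R) (x : E) (rho M : R).
Hypothesis rho0 : 0 < rho.
Hypothesis M0 : 0 <= M.
Hypothesis fL : forall u v : E, `|f u - f v| <= enorm (u - v).
Hypothesis f4 : forall i j (z : E) (s r : R), ball x rho z -> `|s| < rho -> `|r| < rho ->
  `|f z - f (z + s *: 'e_i) - f (z + r *: 'e_j) + f (z + s *: 'e_i + r *: 'e_j)| <= M * `|s| * `|r|.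

Let fL1 i (z : E) : lipon 1 (- rho) rho (fun s => f (z + s *: 'e_i)).
Proof.
move=> s s' _ _; apply: le_trans (fL _ _) _.
by rewrite opprD addrACA subrr add0r -scalerBl enormZ enorm_delta mulr1 mul1r.
Qed.

Let partials : exists G : E -> E, forall z i, ball x rho z ->
  forall e : R, 0 < e -> exists2 t : R, 0 < t & forall h : R, `|h| < t ->
    `|f (z + h *: 'e_i) - f z - h * G z 0 i| <= e * `|h|.
Proof.
have /choice[G HG] : forall zi : E * 'I_n, exists d, ball x rho zi.1 ->
    dder (fun s => f (zi.1 + s *: 'e_(zi.2))) 0 d.
  move=> [z i]; have [xz|] := pselect (ball x rho z); last by move=> ?; exists 0.
  have [|d Hd] := second_difference_dder rho0 M0 (fL1 i z); last by exists d.
  move=> h r hr rr; rewrite scale0r addr0.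
  have := f4 i i xz hr rr.
  by rewrite -[z + h *: _ + r *: _]addrA -scalerDl.
exists (fun z => \row_i G (z, i)) => z i xz e /(HG (z, i) xz)[t t0 Ht].
exists t => // h /Ht; rewrite mxE /= add0r scale0r addr0.
by rewrite -[h *: G _]/(h * G _).
Qed.

(** The second difference with increments [h] and [r] compares two difference quotients of step [h];
    dividing by [h] leaves the bound [M * |r|] on the partial derivatives. *)
Let partial_lip (G : E -> E) : (forall z i, ball x rho z ->
  forall e : R, 0 < e -> exists2 t : R, 0 < t & forall h : R, `|h| < t ->
    `|f (z + h *: 'e_i) - f z - h * G z 0 i| <= e * `|h|) ->
  forall i j (z : E) (r : R), ball x rho z -> ball x rho (z + r *: 'e_j) -> `|r| < rho ->
    `|G (z + r *: 'e_j) 0 i - G z 0 i| <= M * `|r|.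
Proof.
move=> HG i j z r xz xzr rr; apply/ler_addgt0Pr => e e0.
have e20 : 0 < e / 2 by rewrite divr_gt0.
have [t t0 Ht] := HG _ i xz _ e20; have [t' t'0 Ht'] := HG _ i xzr _ e20.
pose m := Num.min rho (Num.min t t').
have m0 : 0 < m by rewrite !lt_min rho0 t0.
have [mr mt mt'] : [/\ m <= rho, m <= t & m <= t'].
  by rewrite /m; split; rewrite !ge_min lexx ?orbT.
have [h h0 hm] : exists2 h, 0 < h & h < m by exists (m / 2); lra.
have hh : `|h| = h by rewrite gtr0_norm.
have [hr ht ht'] : [/\ `|h| < rho, `|h| < t & `|h| < t'].
  by rewrite hh; split; apply: lt_le_trans hm _.
have h1 := Ht h ht; have h2 := Ht' h ht'; have h3 := f4 i j xz hr rr.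
rewrite hh in h1 h2 h3; rewrite -(ler_pM2l h0) -[X in X * _]hh -normrM.
have -> : h * (G (z + r *: 'e_j) 0 i - G z 0 i) =
    (f (z + h *: 'e_i) - f z - h * G z 0 i)
    - (f (z + r *: 'e_j + h *: 'e_i) - f (z + r *: 'e_j) - h * G (z + r *: 'e_j) 0 i)
    + (f z - f (z + h *: 'e_i) - f (z + r *: 'e_j) + f (z + h *: 'e_i + r *: 'e_j)).
  by rewrite [z + r *: _ + h *: _]addrAC; ring.
apply: le_trans (ler_normD _ _) _; apply: le_trans (lerD (ler_normB _ _) (lexx _)) _.
rewrite [leRHS]mulrDr; have -> : h * (M * `|r|) = M * h * `|r| by ring.
lra.
Qed.

Let convex_seg (z : E) i s t : ball x rho z -> ball x rho (z + s *: 'e_i) ->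
  0 <= t <= 1 -> ball x rho (z + (t * s) *: 'e_i).
Proof.
rewrite -!ball_normE /= => xz xzs /andP[t0 t1].
have -> : x - (z + (t * s) *: 'e_i) = (1 - t) *: (x - z) + t *: (x - (z + s *: 'e_i)).
  rewrite -scalerA !opprD !addrA scalerBl scale1r [t *: (_ - _ - _)]scalerBr.
  by rewrite [in RHS]addrA subrK.
apply: le_lt_trans (ler_normD _ _) _; rewrite !normrZ (ger0_norm t0) ger0_norm ?subr_ge0//.
have [->|tn0] := eqVneq t 0; first by rewrite subr0 mul0r addr0 mul1r.
have {}t0 : 0 < t by rewrite lt_def tn0.
have h1 : t * `|x - (z + s *: 'e_i)| < t * rho by rewrite ltr_pM2l.
have h2 : (1 - t) * `|x - z| <= (1 - t) * rho by rewrite ler_wpM2l ?subr_ge0// ltW.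
lra.
Qed.

Lemma second_difference_expansion : exists (G : E -> E) (C : R), [/\ 0 <= C,
  forall z u : E, ball x (rho / 2) z -> ball x (rho / 2) (z + u) ->
    `|f (z + u) - f z - dot (G z) u| <= C * enorm u ^+ 2 &
  forall z u : E, ball x (rho / 2) z -> ball x (rho / 2) (z + u) ->
    enorm (G (z + u) - G z) <= C * enorm u].
Proof.
have [G HG] := partials; have GL := partial_lip HG.
have r2 : rho / 2 <= rho by rewrite ler_pdivrMr// ler_peMr ?ler1n// ltW.
(* Halving the radius makes every increment between two points of the ball admissible in [f4]. *)
have small (z u : E) (k : 'I_n) : ball x (rho / 2) z -> ball x (rho / 2) (z + u) -> `|u 0 k| < rho.
  rewrite -!ball_normE /= => xz xzu; apply: le_lt_trans (coord_le_norm u k) _.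
  have -> : u = (x - z) - (x - (z + u)) by apply/rowP => j; rewrite !mxE; ring.
  apply: le_lt_trans (ler_normB _ _) _; lra.
have E1 (z : E) (i : 'I_n) (s : R) : ball x rho z -> ball x rho (z + s *: 'e_i) -> `|s| < rho ->
    `|f (z + s *: 'e_i) - f z - s * G z 0 i| <= M * s ^+ 2.
  move=> xz xzs sr.
  (* The remainder along the axis, with either sign [e]. As the partial derivative is [M]-Lipschitz,
     the rate of the remainder is at most [M * s ^+ 2], and [lipschitz_growth] bounds it from both
     sides. *)
  pose F (e : R) (t : R) := e * (f (z + (t * s) *: 'e_i) - (t * s) * G z 0 i).
  have FL (e : R) : `|e| = 1 -> lipon (`|s| * (1 + `|G z 0 i|)) 0 1 (F e).
    move=> e1 t t' _ _; rewrite /F -mulrBr normrM e1 mul1r.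
    have -> : f (z + (t * s) *: 'e_i) - t * s * G z 0 i - (f (z + (t' * s) *: 'e_i) - t' * s * G z 0 i)
      = (f (z + (t * s) *: 'e_i) - f (z + (t' * s) *: 'e_i)) - (t - t') * s * G z 0 i by ring.
    apply: le_trans (ler_normB _ _) _.
    have := fL (z + (t * s) *: 'e_i) (z + (t' * s) *: 'e_i).
    rewrite opprD addrACA subrr add0r -scalerBl enormZ enorm_delta mulr1 -mulrBl normrM => h.
    rewrite !normrM; lra.
  have key (e : R) : `|e| = 1 -> - (M * s ^+ 2) <= F e 1 - F e 0.
    move=> e1; have -> : - (M * s ^+ 2) = - (M * s ^+ 2) * (1 - 0) by rewrite subr0 mulr1.
    apply: (lipschitz_growth (FL e e1) ler01 (@negligible_set0 _ _ _ mu)) => t /andP[t0 t1] _ d d0.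
    have xt : ball x rho (z + (t * s) *: 'e_i) by apply: convex_seg => //; rewrite !ltW.
    have s1 : 0 < `|s| + 1 by have := normr_ge0 s; lra.
    have [r r0 Hr] := HG _ i xt _ (divr_gt0 d0 s1).
    exists (r / (`|s| + 1)); first by rewrite divr_gt0.
    move=> h /andP[h0 hr]; have hsr : `|h * s| < r.
      rewrite normrM (gtr0_norm h0); move: hr; rewrite ltr_pdivlMr//; apply: le_lt_trans.
      by rewrite ler_wpM2l ?(ltW h0)//; lra.
    have {hsr}Hr := Hr _ hsr.
    have ts : `|t * s| < rho.
      rewrite normrM gtr0_norm//; by apply: le_lt_trans sr; apply: ler_piMl => //; exact: ltW.
    have g := GL i i z (t * s) xz xt ts.
    have E2 : z + ((t + h) * s) *: 'e_i = z + (t * s) *: 'e_i + (h * s) *: 'e_i.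
      by rewrite -addrA -scalerDl mulrDl.
    rewrite /F E2 -mulrBr.
    set A := f (_ + _ + _) in Hr *; set B := f (_ + _) in Hr *.
    set G2 := G _ 0 i in Hr g; set G1 := G z 0 i in g *.
    have -> : A - (t + h) * s * G1 - (B - t * s * G1) = (A - B - h * s * G2) + h * s * (G2 - G1) by ring.
    have b1 : `|A - B - h * s * G2| <= d * h.
      apply: le_trans Hr _; rewrite normrM (gtr0_norm h0) mulrAC.
      rewrite ler_pdivrMr// -mulrA; rewrite ler_wpM2l ?(ltW d0)// ler_wpM2l ?(ltW h0)//; lra.
    have b2 : `|h * s * (G2 - G1)| <= M * s ^+ 2 * h.
      rewrite !normrM (gtr0_norm h0).
      apply: (@le_trans _ _ (h * `|s| * (M * `|t * s|))); first by rewrite ler_wpM2l// mulr_ge0// ltW.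
      rewrite normrM gtr0_norm// -(real_normK (num_real s)) expr2.
      have -> : h * `|s| * (M * (t * `|s|)) = t * (M * (`|s| * `|s|) * h) by ring.
      by apply: ler_piMl; [rewrite !mulr_ge0// ltW|exact: ltW].
    have b3 : `|e * (A - B - h * s * G2 + h * s * (G2 - G1))| <= d * h + M * s ^+ 2 * h.
      by rewrite normrM e1 mul1r; apply: le_trans (ler_normD _ _) _; exact: lerD.
    have := ler_norm (- (e * (A - B - h * s * G2 + h * s * (G2 - G1)))); rewrite normrN.
    lra.
  have k1 := key 1 (normr1 _); have k2 := key (- 1) (normrN1 _).
  move: k1 k2; rewrite /F !mul1r !mul0r scale0r addr0 subr0 !mulN1r => k1 k2.
  by rewrite ler_norml; apply/andP; split; lra.
have sb (z : E) : ball x (rho / 2) z -> ball x rho z by apply: le_ball.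
have E2 (z u : E) (k : 'I_n) : ball x (rho / 2) z -> ball x (rho / 2) (z + u) ->
    `|G (z + u) 0 k - G z 0 k| <= M * \sum_i `|u 0 i|.
  move=> xz xzu; rewrite (telescope (fun z => G z 0 k)) mulr_sumr.
  apply: le_trans (ler_norm_sum _ _ _) _; apply: ler_sum => i _.
  apply: GL; [exact/sb/trunc_ball| |exact: small xz xzu].
  by rewrite -addrA -truncS; exact/sb/trunc_ball.
(* With [S] the sum of the [|u_i|], the remainders on the axes and the variation of the partial
   derivatives contribute [M * S ^+ 2] each, and [S] is at most [n] times the Euclidean norm. *)
pose C := 2 * M * n%:R ^+ 2; exists G, C; split.
- by rewrite !mulr_ge0// exprn_ge0.
- move=> z u xz xzu; set S := \sum_i `|u 0 i|.
  have S0 : 0 <= S by apply: sumr_ge0.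
  have uS i : `|u 0 i| <= S by rewrite /S (bigD1 i)//= lerDl sumr_ge0.
  apply: (@le_trans _ _ (2 * M * S ^+ 2)); last first.
    rewrite /C -[leRHS]mulrA -exprMn; apply: ler_wpM2l; first by rewrite mulr_ge0.
    rewrite lerXn2r ?nnegrE ?mulr_ge0 ?enorm_ge0//.
    exact: sum_le_enorm.
  rewrite telescope /dot -sumrB.
  apply: le_trans (ler_norm_sum _ _ _) _.
  rewrite expr2 mulrA {2}/S mulr_sumr; apply: ler_sum => i _.
  set w := z + trunc_row i u.
  have xw : ball x (rho / 2) w by exact: trunc_ball.
  have xw' : ball x (rho / 2) (w + u 0 i *: 'e_i) by rewrite -addrA -truncS; exact: trunc_ball.
  have e1 := E1 w i _ (sb _ xw) (sb _ xw') (small _ _ i xz xzu).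
  have e2 := E2 z (trunc_row i u) i xz xw; rewrite -/w in e2.
  have e3 : \sum_j `|trunc_row i u 0 j| <= S.
    by apply: ler_sum => j _; rewrite mxE; case: ifP; rewrite ?normr0.
  have -> : f (w + u 0 i *: 'e_i) - f w - G z 0 i * u 0 i =
    (f (w + u 0 i *: 'e_i) - f w - u 0 i * G w 0 i) + u 0 i * (G w 0 i - G z 0 i) by ring.
  apply: le_trans (ler_normD _ _) _; rewrite normrM.
  have e4 : M * \sum_j `|trunc_row i u 0 j| <= M * S by rewrite ler_wpM2l.
  have e5 : `|u 0 i| * `|G w 0 i - G z 0 i| <= `|u 0 i| * (M * S).
    by rewrite ler_wpM2l//; apply: le_trans e2 e4.
  have e6 : M * u 0 i ^+ 2 <= M * (S * `|u 0 i|).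
    by rewrite ler_wpM2l// -(real_normK (num_real (u 0 i))) expr2 ler_wpM2r.
  lra.
- move=> z u xz xzu; apply: le_trans (enorm_le_sum _) _.
  apply: (@le_trans _ _ (\sum_(i < n) M * (n%:R * enorm u))).
    apply: ler_sum => i _; rewrite !mxE; apply: le_trans (E2 _ _ i xz xzu) _.
    by rewrite ler_wpM2l//; exact: sum_le_enorm.
  rewrite sumr_const card_ord -mulr_natl /C expr2.
  have : 0 <= M * n%:R * n%:R * enorm u by rewrite !mulr_ge0// enorm_ge0.
  lra.
Qed.

End expansion.

Section signed_distance.
Context {R : realType} {N : nat}.
Local Notation E := 'rV[R]_N.
Implicit Types (u v z : E).
Local Notation edist := Defs.edist.

Lemma euclid_dist_ge0 (S : set E) u : 0 <= edist S u.
Proof.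
rewrite /edist; have [->|S0] := eqVneq S set0; first by rewrite image_set0 inf0.
apply: lb_le_inf.
  by move/set0P : S0 => [v Sv]; exists (enorm (u - v)), v.
by move=> _ [v _ <-]; exact: enorm_ge0.
Qed.

Lemma euclid_dist_le (S : set E) u v : S v -> edist S u <= enorm (u - v).
Proof.
move=> Sv; apply: ge_inf; last by exists v.
by exists 0 => _ [w _ <-]; exact: enorm_ge0.
Qed.

Lemma euclid_dist_approx (S : set E) u e : S !=set0 -> 0 < e ->
  exists2 v, S v & enorm (u - v) < edist S u + e.
Proof.
move=> [w Sw] e0.
have [|_ [v Sv <-] H] := @inf_adherent R [set enorm (u - v) | v in S] e e0.
  by split; [exists (enorm (u - w)), w|exists 0 => _ [v _ <-]; exact: enorm_ge0].
by exists v.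
Qed.

Lemma euclid_dist_lipschitz (S : set E) u v : S !=set0 -> `|edist S u - edist S v| <= enorm (u - v).
Proof.
move=> S0; have H a b : edist S a - edist S b <= enorm (a - b).
  apply/ler_addgt0Pr => e e0; have [w Sw Hw] := euclid_dist_approx b S0 e0.
  have h1 := euclid_dist_le a Sw; have h2 := enorm_triangle b a w; lra.
have := H u v; have := H v u; rewrite enorm_distC ler_norml => h1 h2; apply/andP; split; lra.
Qed.

Lemma euclid_dist_gt0 (S : set E) u : S !=set0 -> closed S -> ~ S u -> 0 < edist S u.
Proof.
move=> S0 cS Su; rewrite lt_neqAle euclid_dist_ge0 andbT; apply/eqP => e0; apply: Su.
rewrite ((closure_id S).1 cS) => B /nbhs_ballP[e /= e00 HB].
have [v Sv Hv] := euclid_dist_approx u S0 e00; exists v; split => //; apply: HB.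
rewrite -ball_normE /=; apply: le_lt_trans (norm_le_enorm _) _.
by rewrite -[e]add0r e0.
Qed.

End signed_distance.

Section interface.
Context {R : realType} {N : nat}.
Local Notation E := 'rV[R]_N.
Implicit Types (u v z w : E).
Local Notation edist := Defs.edist.
Variables (Om1 Om2 H : set E) (x : E).
Hypothesis hO : hyp_Omega Om1 Om2 H.
Hypothesis Hx : H x.
Local Notation f := (signed_dist Om1 Om2 H).

Let oOm1 : open Om1. Proof. by case: hO => _ [] . Qed.
Let oOm2 : open Om2. Proof. by case: hO => _ [] . Qed.

Let H1 : H = closure Om1 `\` Om1.
Proof. by case: hO => _ _ eH _ _; rewrite {1}eH /boundary (interior_id Om1).1. Qed.

Let H2 : H = closure Om2 `\` Om2.
Proof. by case: hO => _ _ _ eH _; rewrite {1}eH /boundary (interior_id Om2).1. Qed.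

Lemma interface_cases z : [\/ Om1 z, Om2 z | H z].
Proof.
case: hO => HU _ _ _ _; have : [set: E] z by [].
by rewrite HU => -[[]|] ?; [apply: Or31|apply: Or32|apply: Or33].
Qed.

Lemma interface_notin1 z : H z -> ~ Om1 z.
Proof. by rewrite H1 => -[]. Qed.

Lemma interface_notin2 z : H z -> ~ Om2 z.
Proof. by rewrite H2 => -[]. Qed.

Lemma disjoint12 z : Om1 z -> ~ Om2 z.
Proof. by move=> w1 w2; case: hO => _ [_ _ o12] _ _ _; have : (Om1 `&` Om2) z by []; rewrite o12. Qed.

Lemma closed_interface : closed H.
Proof. by rewrite H1 setDE; apply: closedI; [exact: closed_closure|exact: open_closedC]. Qed.

Lemma closure_side1 z : closure Om1 z <-> Om1 z \/ H z.
Proof.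
split; last by case=> [/subset_closure//|]; rewrite H1 => -[].
by move=> cz; have [|n] := pselect (Om1 z); [left|right; rewrite H1].
Qed.

Lemma closure_side2 z : closure Om2 z <-> Om2 z \/ H z.
Proof.
split; last by case=> [/subset_closure//|]; rewrite H2 => -[].
by move=> cz; have [|n] := pselect (Om2 z); [left|right; rewrite H2].
Qed.

Let H0 : H !=set0. Proof. by exists x. Qed.

Lemma sdist1 z : Om1 z -> f z = edist H z.
Proof.
move=> w1; rewrite /signed_dist !indicE mem_set// memNset ?subr0 ?mul1r//.
exact: disjoint12.
Qed.

Lemma sdist2 z : Om2 z -> f z = - edist H z.
Proof.
move=> w2; rewrite /signed_dist !indicE (mem_set w2) memNset ?sub0r ?mulN1r//.
by move=> w1; exact: disjoint12 w1 w2.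
Qed.

Lemma sdist0 z : H z -> f z = 0.
Proof.
move=> Hz; rewrite /signed_dist !indicE !memNset ?subr0 ?mul0r//.
  exact: interface_notin2.
exact: interface_notin1.
Qed.

Lemma sdist_side1 z : Om1 z <-> 0 < f z.
Proof.
split=> [w1|].
  rewrite (sdist1 w1); apply: euclid_dist_gt0 => //; first exact: closed_interface.
  by move=> /interface_notin1.
case: (interface_cases z) => // [w2|Hz]; last by rewrite sdist0// ltxx.
by rewrite sdist2// oppr_gt0 ltNge euclid_dist_ge0.
Qed.

Lemma sdist_side2 z : Om2 z <-> f z < 0.
Proof.
split=> [w2|].
  rewrite (sdist2 w2) oppr_lt0; apply: euclid_dist_gt0 => //; first exact: closed_interface.
  by move=> /interface_notin2.
case: (interface_cases z) => // [w2|Hz]; last by rewrite sdist0// ltxx.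
by rewrite sdist1// ltNge euclid_dist_ge0.
Qed.

Lemma sdist_eq0 z : H z <-> f z = 0.
Proof.
split=> [|f0]; first exact: sdist0.
by case: (interface_cases z) => // [/sdist_side1|/sdist_side2]; rewrite f0 ltxx.
Qed.

Lemma abs_sdist z : `|f z| = edist H z.
Proof.
case: (interface_cases z) => [w|w|w].
- by rewrite sdist1// ger0_norm ?euclid_dist_ge0.
- by rewrite sdist2// normrN ger0_norm ?euclid_dist_ge0.
rewrite sdist0// normr0; apply/eqP; rewrite eq_le euclid_dist_ge0.
by have := euclid_dist_le z w; rewrite subrr enorm0 => ->.
Qed.

Let edist_cont : continuous (edist H).
Proof. by apply: enorm_lipschitz_continuous => u v; exact: euclid_dist_lipschitz. Qed.

Lemma continuous_sdist : continuous f.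
Proof.
move=> z A Az.
case: (interface_cases z) => [w|w|w].
- have : \forall w \near z, A (edist H w) by apply: edist_cont; rewrite -sdist1.
  have : \forall w \near z, Om1 w by apply: open_nbhs_nbhs.
  by apply: filterS2 => w' ow; rewrite -sdist1.
- have : \forall w \near z, A (- edist H w).
    by apply: (continuousN (edist_cont (x := z))); rewrite -sdist2.
  have : \forall w \near z, Om2 w by apply: open_nbhs_nbhs.
  by apply: filterS2 => w' ow; rewrite -sdist2.
- move: Az => /nbhs_ballP[e /= e0 HA].
  have [d d0 Hd] := near_enorm z e0; apply/nbhs_ballP; exists d => //= v.
  rewrite -ball_normE /= => zv; apply: HA; rewrite -ball_normE /= (sdist0 w) sub0r normrN abs_sdist.
  by apply: le_lt_trans (euclid_dist_le v w) _; rewrite enorm_distC; exact: Hd.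
Qed.

(** For values of opposite sign the segment meets H at some [w], and the distances to H of both ends
    are at most their distances to [w], which add up to the length of the segment. *)
Lemma sdist_lipschitz u v : `|f u - f v| <= enorm (u - v).
Proof.
have opp a b : f a <= 0 -> 0 <= f b -> f b - f a <= enorm (b - a).
  move=> fa fb; pose g (s : R) := f (a + s *: (b - a)).
  have cg : continuous g.
    move=> s; apply: (@continuous_comp _ _ _ (fun s : R => a + s *: (b - a)) f); last exact: continuous_sdist.
    by apply: cvgD; [exact: cvg_cst|apply: cvgZr_tmp; exact: cvg_id].
  have g0 : g 0 = f a by rewrite /g scale0r addr0.
  have g1 : g 1 = f b by rewrite /g scale1r addrC subrK.
  have [|s /[!in_itv]/= /andP[s0 s1] gs] := @IVT R g 0 1 0 ler01 (continuous_subspaceT cg).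
    by rewrite g0 g1 ge_min fa/= le_max fb orbT.
  set w := a + s *: (b - a) in gs *; have Hw : H w by apply/sdist_eq0.
  have h1 := euclid_dist_le a Hw; have h2 := euclid_dist_le b Hw.
  have e1 : enorm (a - w) = s * enorm (b - a).
    by rewrite /w opprD addrA subrr add0r enormN enormZ ger0_norm.
  have e2 : enorm (b - w) = (1 - s) * enorm (b - a).
    have -> : b - w = (1 - s) *: (b - a) by rewrite scalerBl scale1r /w opprD addrA.
    by rewrite enormZ ger0_norm// subr_ge0.
  move: h1 h2; rewrite -!abs_sdist (ler0_norm fa) (ger0_norm fb) e1 e2; lra.
have pos a b : 0 <= f a -> 0 <= f b -> `|f a - f b| <= enorm (a - b).
  by move=> fa fb; have := euclid_dist_lipschitz a b H0; rewrite -!abs_sdist (ger0_norm fa) (ger0_norm fb).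
have neg a b : f a <= 0 -> f b <= 0 -> `|f a - f b| <= enorm (a - b).
  move=> fa fb; have := euclid_dist_lipschitz a b H0; rewrite -!abs_sdist.
  by rewrite (ler0_norm fa) (ler0_norm fb) -opprD normrN.
case: (lerP 0 (f u)) => fu; case: (lerP 0 (f v)) => fv.
- exact: pos.
- by have h := opp _ _ (ltW fv) fu; rewrite ger0_norm//; lra.
- by have h := opp _ _ (ltW fu) fv; rewrite distrC enorm_distC ger0_norm//; lra.
- by apply: neg; exact: ltW.
Qed.

Lemma sdist_four_point : exists rho M : R, [/\ 0 < rho, 0 <= M &
  forall i j (z : E) (s r : R), ball x rho z -> `|s| < rho -> `|r| < rho ->
  `|f z - f (z + s *: 'e_i) - f (z + r *: 'e_j) + f (z + s *: 'e_i + r *: 'e_j)| <= M * `|s| * `|r|].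
Proof.
case: hO => _ _ _ _ [V [oV HV SV]].
have [M M0 HM] := sobolev_four_point continuous_sdist SV.
have /nbhs_ballP[e /= e0 He] : nbhs x V by apply: open_nbhs_nbhs; split => //; exact: HV.
(* There is room for two reflections of the base corner, which bring it to distance less than
   [3 * e / 8] from [x], and then for a box of side at most [3 * e / 8]. *)
exists (e / 8), M; split => //; first by rewrite divr_gt0.
pose D i j z s r := f z - f (z + s *: 'e_i) - f (z + r *: 'e_j) + f (z + s *: 'e_i + r *: 'e_j).
have pos i j (z : E) (s r : R) : 0 <= s < e / 8 -> 0 <= r < e / 8 -> `|x - z| < e / 2 ->
    `|D i j z s r| <= M * s * r.
  move=> /andP[s0 se] /andP[r0 re] xz.
  have [->|sn] := eqVneq s 0.
    rewrite /D scale0r !addr0; have -> : f z - f z - f (z + r *: 'e_j) + f (z + r *: 'e_j) = 0 by ring.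
    by rewrite normr0 mulr0 mul0r.
  have [->|rn] := eqVneq r 0.
    rewrite /D scale0r !addr0; have -> : f z - f (z + s *: 'e_i) - f z + f (z + s *: 'e_i) = 0 by ring.
    by rewrite normr0 mulr0.
  apply: (HM i j z s r (e / 8)); [by rewrite lt_def sn|by rewrite lt_def rn|by rewrite divr_gt0|].
  move=> y Hy.
  apply: He; rewrite -ball_normE /=.
  rewrite [ltLHS](_ : _ = mx_norm (x - y))// mx_normrE.
  apply: bigmax_lt => //= -[a l] _ /=; rewrite ord1.
  have := coord_le_norm (x - z) l; rewrite !mxE => h1.
  have := Hy l; have sr : 0 <= (if l == i then s else 0) + (if l == j then r else 0) <= s + r.
    by case: ifP => _; case: ifP => _; apply/andP; split; lra.
  move: sr; set w := (if _ then _ else _) + _ => /andP[w0 w1] /andP[y0 y1].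
  have := ler_norm (x 0 l - z 0 l); have := ler_norm (- (x 0 l - z 0 l)).
  rewrite normrN => h2 h3; rewrite ltr_norml; apply/andP; split; lra.
have alg1 (a b c d : R) : a - b - c + d = - (b - a - d + c) by ring.
have alg2 (a b c d : R) : a - b - c + d = - (c - d - a + b) by ring.
(* A negative increment is a positive one seen from the opposite corner, with the sign of the second
   difference reversed. *)
have negs i j z s r : D i j z s r = - D i j (z + s *: 'e_i) (- s) r.
  by rewrite /D scaleNr addrK; exact: alg1.
have negr i j z s r : D i j z s r = - D i j (z + r *: 'e_j) s (- r).
  by rewrite /D scaleNr addrK [z + r *: _ + s *: _]addrAC addrK; exact: alg2.
have shift (z : E) i (s a : R) : `|x - z| < a -> `|s| < e / 8 -> `|x - (z + s *: 'e_i)| < a + e / 8.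
  move=> xz se; rewrite opprD addrA; apply: le_lt_trans (ler_normB _ _) _; apply: ltrD => //.
  by apply: le_lt_trans (norm_le_enorm _) _; rewrite enormZ enorm_delta mulr1.
move=> i j z s r; rewrite -ball_normE /= -/(D i j z s r) => xz se re.
have half (z' : E) (s' : R) : 0 <= s' < e / 8 -> `|x - z'| < e / 4 -> `|D i j z' s' r| <= M * s' * `|r|.
  move=> s'0 xz'; have [r0|r0] := lerP 0 r.
    by rewrite (ger0_norm r0); apply: pos => //; [rewrite r0/= (le_lt_trans (ler_norm _) re)|lra].
  rewrite negr normrN (ltr0_norm r0); apply: pos => //.
    by rewrite oppr_ge0 (ltW r0)/= -ltr0_norm.
  have := shift z' j r _ xz' re; lra.
have [s0|s0] := lerP 0 s.
  by rewrite (ger0_norm s0); apply: half; [rewrite s0/= (le_lt_trans (ler_norm _) se)|lra].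
rewrite negs normrN (ltr0_norm s0); apply: half.
  by rewrite oppr_ge0 (ltW s0)/= -ltr0_norm.
have := shift z i s _ xz se; lra.
Qed.

End interface.

Section line_segments.
Context {R : realType} {N : nat}.
Local Notation E := 'rV[R]_N.
Implicit Types (u v z : E).

Lemma ball_enorm (x z : E) rho : ball x rho z ->
  exists2 d : R, 0 < d & forall u, enorm u < d -> ball x rho (z + u).
Proof.
rewrite -ball_normE /= => xz; exists (rho - `|x - z|); first by rewrite subr_gt0.
move=> u ud; rewrite opprD addrA; apply: le_lt_trans (ler_normB _ _) _.
by have := norm_le_enorm u; lra.
Qed.

Lemma dder_enorm (X : R -> E) (s : R) d : dder X s d -> forall e : R, 0 < e ->
  exists2 r : R, 0 < r & forall h : R, `|h| < r -> enorm (X (s + h) - X s - h *: d) <= e * `|h|.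
Proof.
move=> HX e e0; have n0 : 0 < (N%:R + 1 : R) by rewrite ltr_wpDl.
have [r r0 Hr] := HX _ (divr_gt0 e0 n0); exists r => // h /Hr H.
apply: le_trans (enorm_le_norm _) _.
apply: (@le_trans _ _ ((N%:R + 1) * `|X (s + h) - X s - h *: d|)).
  by rewrite ler_wpM2r// lerDl.
by move: H; rewrite mulrAC ler_pdivlMr// mulrC.
Qed.

End line_segments.

(** * Gradient, tangent vectors and normals at the interface *)

Section interface_chart.
Context {R : realType} {N : nat}.
Local Notation E := 'rV[R]_N.
Implicit Types (u v z w : E).
Local Notation edist := Defs.edist.
Variables (Om1 Om2 H : set E) (x : E).
Hypothesis hO : hyp_Omega Om1 Om2 H.
Hypothesis Hx : H x.
Local Notation f := (signed_dist Om1 Om2 H).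
Let fL := sdist_lipschitz hO Hx.

Section gradient_norm.
Variables (G : E -> E) (C rho : R).
Hypothesis C0 : 0 <= C.
Hypothesis fG : forall z u : E, ball x rho z -> ball x rho (z + u) ->
  `|f (z + u) - f z - dot (G z) u| <= C * enorm u ^+ 2.
Hypothesis GL : forall z u : E, ball x rho z -> ball x rho (z + u) ->
  enorm (G (z + u) - G z) <= C * enorm u.

(** A 1-Lipschitz function cannot grow faster than the distance along its gradient; [s] is chosen so
    that the quadratic error stays below the supposed excess. *)
Let grad_le1 z : ball x rho z -> enorm (G z) <= 1.
Proof.
move=> xz; rewrite leNgt; apply/negP => g1; set g := enorm (G z) in g1 *.
have [d d0 Hd] := ball_enorm xz.
pose s := Num.min (d / (2 * g)) ((g - 1) / (2 * (C + 1) * g)).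
have C1 : 0 < C + 1 by rewrite ltr_wpDl.
have g0 : 0 < g by lra.
have s0 : 0 < s by rewrite lt_min !divr_gt0 ?mulr_gt0// subr_gt0.
have sd : s * g < d.
  have : s <= d / (2 * g) by rewrite ge_min lexx.
  rewrite ler_pdivlMr ?mulr_gt0// => h; lra.
have sC : s * (2 * (C + 1) * g) <= g - 1.
  have : s <= (g - 1) / (2 * (C + 1) * g) by rewrite ge_min lexx orbT.
  by rewrite ler_pdivlMr// !mulr_gt0.
have eu : enorm (s *: G z) = s * g by rewrite enormZ gtr0_norm.
have := fG xz (Hd (s *: G z) _); rewrite eu => /(_ sd).
rewrite dotZr -sqr_enorm -/g ler_norml => /andP[+ _].
have := fL (z + s *: G z) z; rewrite addrAC subrr add0r eu => /ler_normlP[_ h1] h2.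
have h3 : s * g ^+ 2 <= s * g + C * (s * g) ^+ 2 by lra.
have h4 : g <= 1 + C * s * g.
  have sg : 0 < s * g by rewrite mulr_gt0.
  rewrite -(ler_pM2l sg); lra.
have : 0 <= s * g by rewrite mulr_ge0// ltW.
lra.
Qed.

(** Moving a fraction [s] of the way to an almost nearest interface point [y] lowers the distance to
    H at unit speed. The tolerance [s ^+ 2] for [y] is of lower order than the step. *)
Let grad_ge1 z : ball x rho z -> Om1 z -> 1 <= enorm (G z).
Proof.
move=> xz oz; rewrite leNgt; apply/negP => g1; set g := enorm (G z) in g1 *.
have [d d0 Hd] := ball_enorm xz; have D0 : 0 < f z by apply/(sdist_side1 hO Hx).
set D := f z in D0; have D1 : 0 < D + 1 by lra.
pose K := 1 + C * (D + 1) ^+ 2.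
have K0 : 0 < K by rewrite ltr_pwDl// mulr_ge0// exprn_ge0// ltW.
have q0 : 0 < D * (1 - g) by rewrite mulr_gt0// subr_gt0.
pose s := Num.min (1 / 2) (Num.min (d / (2 * (D + 1))) (D * (1 - g) / (2 * K))).
have s0 : 0 < s by rewrite !lt_min; apply/and3P; split; rewrite divr_gt0// mulr_gt0.
have s1 : s <= 1 / 2 by rewrite ge_min lexx.
have sd : s * (D + 1) < d.
  have : s <= d / (2 * (D + 1)) by rewrite !ge_min lexx orbT.
  rewrite ler_pdivlMr ?mulr_gt0// => h; lra.
have sK : s * (2 * K) <= D * (1 - g).
  have : s <= D * (1 - g) / (2 * K) by rewrite !ge_min lexx !orbT.
  by rewrite ler_pdivlMr// mulr_gt0.
have [|y Hy zy] := @euclid_dist_approx _ _ H z (s ^+ 2) _ (exprn_gt0 _ s0); first by exists x.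
have Ez : edist H z = D by rewrite -(abs_sdist hO) gtr0_norm.
rewrite Ez in zy; pose u := y - z.
have uz : enorm (z - y) = enorm u by rewrite enorm_distC.
have Du : D <= enorm u by rewrite -Ez -uz; exact: euclid_dist_le.
rewrite uz in zy.
have s21 : s ^+ 2 <= 1.
  by rewrite expr2; apply: (@le_trans _ _ (1 * s)); [rewrite ler_pM2r//; lra|lra].
have uD1 : enorm u <= D + 1 by lra.
have eu : enorm (s *: u) = s * enorm u by rewrite enormZ gtr0_norm.
have := fG xz (Hd (s *: u) _); rewrite eu => /(_ _)/ler_normlP[|h1 _].
  by apply: le_lt_trans sd; rewrite ler_pM2l.
have h2 : f (z + s *: u) <= (1 - s) * enorm u.
  apply: le_trans (ler_norm _) _; rewrite (abs_sdist hO); apply: le_trans (euclid_dist_le _ Hy) _.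
  have -> : z + s *: u - y = - ((1 - s) *: u).
    by apply/rowP => i; rewrite /u !mxE; ring.
  by rewrite enormN enormZ ger0_norm//; lra.
rewrite dotZr -/D in h1.
have := dot_enorm (G z) u; rewrite -/g => /ler_normlP[h3 _].
have h4 : s * (- dot (G z) u) <= s * (g * enorm u) by rewrite ler_pM2l.
have h5 : s * (enorm u * (1 - g)) <= s * (s * (1 + C * enorm u ^+ 2)) by lra.
rewrite (ler_pM2l s0) in h5.
have h6 : D * (1 - g) <= enorm u * (1 - g) by rewrite ler_wpM2r// subr_ge0 ltW.
have h7 : s * (1 + C * enorm u ^+ 2) <= s * K.
  by rewrite ler_pM2l// lerD2l ler_wpM2l// lerXn2r ?nnegrE ?enorm_ge0// ltW.
lra.
Qed.

(** The lower bound is available inside Omega_1; its points accumulate at [z], and [G] is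
    Lipschitz. *)
Lemma sdist_gradient_norm z : ball x rho z -> H z -> enorm (G z) = 1.
Proof.
move=> xz Hz; apply/eqP; rewrite eq_le grad_le1//=; apply/ler_addgt0Pr => e e0.
have [d d0 Hd] := ball_enorm xz.
have C1 : 0 < C + 1 by rewrite ltr_wpDl.
have m0 : 0 < Num.min d (e / (C + 1)) by rewrite lt_min d0 divr_gt0.
have [r r0 Hr] := near_enorm z m0.
have /(_ (ball z r) (nbhsx_ballx _ _ r0))[w [ow zw]] : closure Om1 z.
  by apply/(closure_side1 hO); right.
move: zw; rewrite -ball_normE /= => /Hr; rewrite enorm_distC lt_min => /andP[wd we].
have xw : ball x rho (z + (w - z)) by exact: Hd.
have := GL xz xw; have -> : z + (w - z) = w by rewrite addrC subrK.
move=> h1; rewrite addrC subrK in xw; have h2 := grad_ge1 xw ow.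
have h3 := enormD (G z) (G w - G z); rewrite addrC subrK in h3.
move: we; rewrite ltr_pdivlMr// => we; have := enorm_ge0 (w - z); lra.
Qed.

End gradient_norm.

Lemma interface_chart : exists (G : E -> E) (C rho : R), [/\ 0 < rho, 0 <= C,
  forall z u : E, ball x rho z -> ball x rho (z + u) ->
    `|f (z + u) - f z - dot (G z) u| <= C * enorm u ^+ 2,
  forall z u : E, ball x rho z -> ball x rho (z + u) ->
    enorm (G (z + u) - G z) <= C * enorm u &
  forall z, ball x rho z -> H z -> enorm (G z) = 1].
Proof.
have [rho [M [rho0 M0 f4]]] := sdist_four_point hO Hx.
have [G [C [C0 HG HGL]]] := second_difference_expansion rho0 M0 fL f4.
exists G, C, (rho / 2); split => //; first by rewrite divr_gt0.
by move=> z xz Hz; exact: (sdist_gradient_norm C0 HG HGL xz Hz).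
Qed.

Variables (G : E -> E) (C rho : R).
Hypothesis rho0 : 0 < rho.
Hypothesis C0 : 0 <= C.
Hypothesis fG : forall z u : E, ball x rho z -> ball x rho (z + u) ->
  `|f (z + u) - f z - dot (G z) u| <= C * enorm u ^+ 2.
Hypothesis GL : forall z u : E, ball x rho z -> ball x rho (z + u) ->
  enorm (G (z + u) - G z) <= C * enorm u.
Hypothesis G1 : forall z, ball x rho z -> H z -> enorm (G z) = 1.

Lemma sdist_chain (X : R -> E) (s : R) d : ball x rho (X s) -> dder X s d ->
  dder (fun r => f (X r)) s (dot (G (X s)) d).
Proof.
move=> xz HX e e0; set z := X s in xz *; set g := enorm (G z).
have g1 : 0 < g + 1 by rewrite ltr_wpDl ?enorm_ge0.
have e20 : 0 < e / 2 by rewrite divr_gt0.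
have [r r0 Hr] := dder_enorm HX (divr_gt0 e20 g1).
have [r' r'0 Hr'] := dder_enorm HX ltr01.
have [q q0 Hq] := ball_enorm xz.
pose D := enorm d + 1; have D0 : 0 < D by rewrite ltr_wpDl ?enorm_ge0.
have C1 : 0 < C + 1 by rewrite ltr_wpDl.
pose m := Num.min (Num.min r r') (Num.min (q / D) (e / 2 / ((C + 1) * D ^+ 2))).
exists m; first by rewrite !lt_min r0 r'0 !divr_gt0// mulr_gt0// exprn_gt0.
move=> h; rewrite !lt_min => /andP[/andP[hr hr'] /andP[hq he]].
pose u := X (s + h) - z.
have uh : enorm u <= D * `|h|.
  have := Hr' h hr'; rewrite -/z -/u mul1r => h1.
  have h2 := enormD (u - h *: d) (h *: d); rewrite subrK enormZ in h2.
  rewrite /D; lra.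
have uq : enorm u < q by apply: le_lt_trans uh _; rewrite mulrC -ltr_pdivlMr.
have := fG xz (Hq u uq); have -> : z + u = X (s + h) by rewrite addrC subrK.
set A := f _; set B := f _ => h1; have := Hr h hr; rewrite -/z -/u => h2.
rewrite -[h *: _]/(h * _).
have -> : A - B - h * dot (G z) d = (A - B - dot (G z) u) + dot (G z) (u - h *: d).
  by rewrite (dotBr (G z) u) dotZr; ring.
apply: le_trans (ler_normD _ _) _.
have h3 := dot_enorm (G z) (u - h *: d); rewrite -/g in h3.
have h4 : g * enorm (u - h *: d) <= e / 2 * `|h|.
  apply: (@le_trans _ _ ((g + 1) * (e / 2 / (g + 1) * `|h|))).
    by apply: ler_pM; rewrite ?enorm_ge0// lerDl.
  by rewrite mulrA [_ * (e / 2 / _)]mulrC divfK// gt_eqF.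
have h5 : C * enorm u ^+ 2 <= e / 2 * `|h|.
  apply: (@le_trans _ _ ((C + 1) * (D * `|h|) ^+ 2)).
    by apply: ler_pM; rewrite ?exprn_ge0 ?enorm_ge0 ?lerDl// lerXn2r ?nnegrE ?enorm_ge0// mulr_ge0// ltW.
  rewrite exprMn expr2 [_ ^+ 2 * _]mulrA [(C + 1) * _]mulrA ler_wpM2r// mulrA mulrC -ler_pdivlMr ?ltW//.
  by rewrite mulr_gt0// exprn_gt0.
lra.
Qed.

(** For each small [s] the intermediate value theorem corrects [z + s *: v] along the normal by some
    [th] of order [s ^+ 2] so as to reach H. The values [th] are merely chosen: their size alone
    gives the derivative at 0, the only regularity in [curve_in]. *)
Lemma orthogonal_tangent z v : ball x rho z -> H z -> dot (G z) v = 0 -> tangent_space H z v.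
Proof.
have below (y k d w : R) : y - - k <= d -> k = d + w -> 0 <= w -> y <= 0 by lra.
have above (y k d w : R) : - (y - k) <= d -> k = d + w -> 0 <= w -> 0 <= y by lra.
move=> xz Hz gv; set g := G z in gv.
have g1 : enorm g = 1 by exact: G1.
have [d d0 Hd] := ball_enorm xz.
pose a := enorm v + 1; have a0 : 0 < a by rewrite ltr_wpDl ?enorm_ge0.
(* The expansion errs by at most [C * a ^+ 2 * s ^+ 2]; one more [s ^+ 2] forces [f] to change sign
   between the corrections [- (K * s ^+ 2)] and [K * s ^+ 2]. *)
pose K := C * a ^+ 2 + 1; have K0 : 0 < K by rewrite ltr_wpDl// mulr_ge0// exprn_ge0// ltW.
pose r := Num.min (1 / K) (d / a); have r0 : 0 < r by rewrite lt_min !divr_gt0.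
have fz : f z = 0 by exact: (sdist0 hO).
have est (s th : R) : `|s| < r -> `|th| <= K * s ^+ 2 ->
    `|f (z + (s *: v + th *: g)) - th| <= C * a ^+ 2 * s ^+ 2.
  rewrite lt_min => /andP[s1 s2] Hth.
  have ua : enorm (s *: v + th *: g) <= `|s| * a.
    apply: le_trans (enormD _ _) _; rewrite !enormZ g1 mulr1 /a mulrDr mulr1 lerD2l.
    apply: le_trans Hth _; rewrite -(real_normK (num_real s)) expr2 mulrA ler_piMl// mulrC.
    by rewrite -ler_pdivlMr ?ltW.
  have ud : enorm (s *: v + th *: g) < d by apply: le_lt_trans ua _; rewrite -ltr_pdivlMr.
  have := fG xz (Hd _ ud); rewrite fz subr0 dotDr !dotZr gv -sqr_enorm g1 expr1n mulr1 mulr0 add0r => h.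
  apply: le_trans h _; rewrite -mulrA ler_wpM2l//.
  rewrite -(real_normK (num_real s)) -exprMn lerXn2r ?nnegrE ?enorm_ge0//.
    by rewrite mulr_ge0// ltW.
  by rewrite mulrC.
have /choice[th Hth] : forall s : R, exists th : R, `|s| < r ->
    `|th| <= K * s ^+ 2 /\ H (z + (s *: v + th *: g)).
  move=> s; have [sr|] := boolP (`|s| < r); last by exists 0.
  pose F (th : R) := f (z + (s *: v + th *: g)).
  have cF : continuous F.
    move=> th; apply: (@continuous_comp _ _ _ (fun th : R => z + (s *: v + th *: g)) f).
      apply: cvgD; first exact: cvg_cst.
      by apply: cvgD; [exact: cvg_cst|apply: cvgZr_tmp; exact: cvg_id].
    exact: (continuous_sdist hO Hx).
  have k0 : 0 <= K * s ^+ 2 by rewrite mulr_ge0 ?sqr_ge0// ltW.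
  have KC : K * s ^+ 2 = C * a ^+ 2 * s ^+ 2 + s ^+ 2 by rewrite mulrDl mul1r.
  have s20 := sqr_ge0 s.
  have k1 := est s (K * s ^+ 2) sr; rewrite (ger0_norm k0) lexx in k1.
  have /ler_normlP[{}k1 _] := k1 isT.
  have k2 := est s (- (K * s ^+ 2)) sr; rewrite normrN (ger0_norm k0) lexx in k2.
  have /ler_normlP[_ {}k2] := k2 isT.
  have kk : - (K * s ^+ 2) <= K * s ^+ 2 by rewrite (le_trans _ k0)// oppr_le0.
  have [|th /[!in_itv]/= /andP[t0 t1] Ft] := @IVT R F (- (K * s ^+ 2)) (K * s ^+ 2) 0 kk (continuous_subspaceT cF).
    rewrite ge_min le_max; apply/andP; split; apply/orP; [left|right]; rewrite /F.
      exact: below k2 KC s20.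
    exact: above k1 KC s20.
  by exists th => _; split; [rewrite ler_norml t0|apply/(sdist_eq0 hO Hx)].
exists (fun s => z + (s *: v + th s *: g)); split.
- have [|t0 _] := Hth 0; first by rewrite normr0.
  rewrite expr0n/= mulr0 in t0; have {}t0 : th 0 = 0 by apply/normr0_eq0/eqP; rewrite eq_le t0 normr_ge0.
  by rewrite t0 !scale0r !addr0.
- apply/nbhs_ballP; exists r => //= s; rewrite /ball/= sub0r normrN => sr.
  by have [] := Hth s sr.
apply/dderP => e e0; exists (Num.min r (e / K)); first by rewrite lt_min r0 divr_gt0.
move=> h; rewrite lt_min => /andP[hr he]; rewrite add0r.
have [|t0 _] := Hth 0; first by rewrite normr0.
rewrite expr0n/= mulr0 in t0; have {}t0 : th 0 = 0 by apply/normr0_eq0/eqP; rewrite eq_le t0 normr_ge0.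
have -> : z + (h *: v + th h *: g) - (z + (0 *: v + th 0 *: g)) - h *: v = th h *: g.
  by apply/rowP => i; rewrite t0 !mxE; ring.
apply: le_trans (norm_le_enorm _) _; rewrite enormZ g1 mulr1.
have [ht _] := Hth h hr; apply: le_trans ht _.
rewrite -(real_normK (num_real h)) expr2 mulrA ler_wpM2r// mulrC.
by rewrite -ler_pdivlMr// ltW.
Qed.

Lemma tangent_orthogonal z v : ball x rho z -> tangent_space H z v -> dot (G z) v = 0.
Proof.
move=> xz [gam [g0 Hg dg]]; have dg' : dder gam 0 v by exact/dderP.
have xz' : ball x rho (gam 0) by rewrite g0.
have := sdist_chain xz' dg'; rewrite g0 => d1.
move: Hg => /nbhs_ballP[r /= r0 Hr].
have d2 : dder (fun=> 0 : R) 0 (dot (G z) v).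
  apply: dder_eq r0 _ d1 => h hr; rewrite add0r; apply/(sdist_eq0 hO Hx)/Hr.
  by rewrite /ball/= sub0r normrN.
exact: dder_unique d2 (dder_cst _ _).
Qed.

Let normal_pm z n : ball x rho z -> H z -> enorm n = 1 ->
  (forall v, tangent_space H z v -> dot n v = 0) -> exists2 c, `|c| = 1 & n = c *: G z.
Proof.
move=> xz Hz n1 Hn; pose g := G z; pose c := dot n g.
have g1 : dot g g = 1 by rewrite -sqr_enorm G1// expr1n.
have gw : dot g (n - c *: g) = 0 by rewrite dotBr dotZr g1 mulr1 dotC subrr.
have nw := Hn _ (orthogonal_tangent xz Hz gw).
have w0 : n - c *: g = 0.
  apply: enorm_eq0; rewrite /enorm [X in dot X _]/(_ - _).
  by rewrite dotBl nw dotZl gw mulr0 subr0 sqrtr0.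
exists c; last by apply/eqP; rewrite -subr_eq0 -/g w0.
move/eqP: w0; rewrite subr_eq0 => /eqP ncg.
by move: n1; rewrite ncg enormZ G1// mulr1.
Qed.

(** At distance [h] along [c *: G z] the signed distance is [h * c] up to [C * h ^+ 2], so its
    product with [c] is positive. At a point outside the closure of one side this fixes the sign of
    [c]. *)
Let normal_direction z (c : R) (Q : E -> Prop) : ball x rho z -> H z -> `|c| = 1 ->
  (\forall h \near 0^'+, Q (z + h *: (c *: G z))) ->
  exists2 w, Q w & 0 < c * f w.
Proof.
move=> xz Hz c1 HQ; have [d d0 Hd] := ball_enorm xz; have g1 := G1 xz Hz.
near (0 : R)^'+ => h.
have h0 : 0 < h by near: h; exact: nbhs_right_gt.
have hd : h < d by near: h; exact: nbhs_right_lt.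
have hC : h < (C + 1)^-1 by near: h; apply: nbhs_right_lt; rewrite invr_gt0 ltr_wpDl.
exists (z + h *: (c *: G z)); first by near: h.
have eu : enorm (h *: (c *: G z)) = h by rewrite !enormZ c1 g1 gtr0_norm// !mulr1.
have := fG xz (Hd (h *: (c *: G z)) _); rewrite eu => /(_ hd).
rewrite (sdist0 hO Hz) subr0 !dotZr -sqr_enorm g1 expr1n mulr1; set F := f _ => h1.
have c2 : c * c = 1 by rewrite -expr2 -(real_normK (num_real c)) c1 expr1n.
have : `|c * (F - h * c)| <= C * h ^+ 2 by rewrite normrM c1 mul1r.
have -> : c * (F - h * c) = c * F - h * (c * c) by ring.
rewrite c2 mulr1 => /ler_normlP[h2 _].
have C1 : 0 < C + 1 by rewrite ltr_wpDl.
move: hC; rewrite -[_^-1]mul1r ltr_pdivlMr// => hC.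
have : h * (h * (C + 1)) < h * 1 by rewrite ltr_pM2l.
have := sqr_ge0 h; rewrite expr2 in h2 *; lra.
Unshelve. all: by end_near. Qed.

Lemma normal_side1 z n : ball x rho z -> H z -> outward_unit_normal Om1 z n -> n = - G z.
Proof.
move=> xz Hz [n1 Hn Hout].
have eH : boundary Om1 = H by case: hO.
rewrite eH in Hn.
have [c c1 nc] := normal_pm xz Hz n1 Hn; rewrite nc in Hout *.
have [w nw fw] := @normal_direction z c (fun y => ~ closure Om1 y) xz Hz c1 Hout.
move: nw; rewrite (closure_side1 hO) => nw.
have fneg : f w < 0.
  case: (interface_cases hO w) => [w1|/(sdist_side2 hO Hx)//|w1]; [exfalso; apply: nw; by left|].
  by exfalso; apply: nw; right.
have cneg : c < 0 by rewrite ltNge; apply/negP => c0; have := mulr_ge0_le0 c0 (ltW fneg); lra.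
by move: c1; rewrite ltr0_norm// => /eqP; rewrite eqr_oppLR => /eqP ->; rewrite scaleN1r.
Qed.

Lemma normal_side2 z n : ball x rho z -> H z -> outward_unit_normal Om2 z n -> n = G z.
Proof.
move=> xz Hz [n1 Hn Hout].
have eH : boundary Om2 = H by case: hO.
rewrite eH in Hn.
have [c c1 nc] := normal_pm xz Hz n1 Hn; rewrite nc in Hout *.
have [w nw fw] := @normal_direction z c (fun y => ~ closure Om2 y) xz Hz c1 Hout.
move: nw; rewrite (closure_side2 hO) => nw.
have fpos : 0 < f w.
  case: (interface_cases hO w) => [/(sdist_side1 hO Hx)//|w1|w1]; [exfalso; apply: nw; by left|].
  by exfalso; apply: nw; right.
have cpos : 0 < c by rewrite -(pmulr_lgt0 _ fpos).
by move: c1; rewrite gtr0_norm// => ->; rewrite scale1r.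
Qed.

(** [tangential_gradient] is defined by choice, so a representative is exhibited: the projection of
    [w] on the tangent space. Uniqueness of derivatives along curves then determines the chosen
    vector on tangent directions. *)
Lemma tangential_gradientP (F : E -> R) w :
  (forall e : R, 0 < e -> exists2 r : R, 0 < r & forall z, H z -> enorm (z - x) < r ->
     `|F z - F x - dot w (z - x)| <= e * enorm (z - x)) ->
  forall v, dot (G x) v = 0 -> dot (tangential_gradient H F x) v = dot w v.
Proof.
move=> HF; have xx : ball x rho x by exact: ballxx.
have curve gam v : curve_in H x gam v -> dder (F \o gam) 0 (dot w v).
  move=> [g0 Hg dg] e e0; have dg' : dder gam 0 v by exact/dderP.
  pose D := enorm v + 1; have D0 : 0 < D by rewrite ltr_wpDl ?enorm_ge0.
  pose W := enorm w + 1; have W0 : 0 < W by rewrite ltr_wpDl ?enorm_ge0.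
  have e20 : 0 < e / 2 by rewrite divr_gt0.
  have [r r0 Hr] := HF _ (divr_gt0 e20 D0).
  have [r1 r10 Hr1] := dder_enorm dg' ltr01.
  have [r2 r20 Hr2] := dder_enorm dg' (divr_gt0 e20 W0).
  move: Hg => /nbhs_ballP[r3 /= r30 Hr3].
  exists (Num.min (Num.min r1 r2) (Num.min r3 (r / D))); first by rewrite !lt_min r10 r20 r30 divr_gt0.
  move=> h; rewrite !lt_min => /andP[/andP[h1 h2] /andP[h3 h4]].
  have {}Hr1 := Hr1 h h1; have {}Hr2 := Hr2 h h2.
  rewrite add0r g0 in Hr1 Hr2; rewrite add0r /= g0 -[h *: _]/(h * _).
  have Hgh : H (gam h) by apply: Hr3; rewrite /ball/= sub0r normrN.
  have uD : enorm (gam h - x) <= D * `|h|.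
    have := enormD (gam h - x - h *: v) (h *: v); rewrite subrK enormZ /D; lra.
  have ur : enorm (gam h - x) < r by apply: le_lt_trans uD _; rewrite mulrC -ltr_pdivlMr.
  have k1 := Hr _ Hgh ur.
  have -> : F (gam h) - F x - h * dot w v = (F (gam h) - F x - dot w (gam h - x)) + dot w (gam h - x - h *: v).
    by rewrite (dotBr w (gam h - x)) dotZr; ring.
  apply: le_trans (ler_normD _ _) _.
  have k2 := dot_enorm w (gam h - x - h *: v).
  have k3 : enorm w * enorm (gam h - x - h *: v) <= e / 2 * `|h|.
    apply: (@le_trans _ _ (W * (e / 2 / W * `|h|))).
      by apply: ler_pM; rewrite ?enorm_ge0// lerDl.
    by rewrite mulrA [_ * (e / 2 / _)]mulrC divfK// gt_eqF.
  have k4 : e / 2 / D * enorm (gam h - x) <= e / 2 * `|h|.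
    by rewrite mulrAC ler_pdivrMr// -[leRHS]mulrA [`|h| * D]mulrC ler_pM2l.
  lra.
pose g := G x; have gg : dot g g = 1 by rewrite -sqr_enorm G1// expr1n.
have [T0 T1] : is_tangential_gradient H F x (tangential_gradient H F x).
  apply: (@xgetPex _ 0 [set p | is_tangential_gradient H F x p]).
  exists (w - dot w g *: g); split.
    by apply: orthogonal_tangent => //; rewrite -/g dotBr dotZr gg mulr1 dotC subrr.
  move=> gam v cg; apply/dderP; rewrite dotBl dotZl.
  rewrite (_ : dot g v = 0) ?mulr0 ?subr0; first exact: curve.
  by apply: tangent_orthogonal => //; exists gam.
move=> v gv; have [gam cg] := orthogonal_tangent xx Hx gv.
by have /dderP d1 := T1 gam v cg; exact: dder_unique d1 (curve _ _ cg).
Qed.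

End interface_chart.

Section tangential_expansion.
Context {R : realType} {N : nat}.
Local Notation E := 'rV[R]_N.
Implicit Types (u v z w : E).

Lemma differentiable_expansion (psi : E * R -> R) (x : E) (t : R) :
  differentiable psi (x, t) -> exists w c, forall e : R, 0 < e ->
  exists2 r : R, 0 < r & forall u (h : R), enorm u < r -> `|h| < r ->
  `|psi (x + u, t + h) - psi (x, t) - dot w u - c * h| <= e * (enorm u + `|h|).
Proof.
move=> dpsi; have /eqaddoP H := diff_locally dpsi.
pose L := 'd psi (x, t).
exists (\row_i L ('e_i, 0)), (L (0, 1)) => e e0.
have := H _ e0; rewrite near_simpl => /nbhs_ballP[r /= r0 Hr].
exists r => // u h ur hr.
have b : ball (0 : E * R) r (u, h).
  rewrite prod_norm_ball /= sub0r normrN prod_normE/= gt_max hr andbT.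
  by apply: le_lt_trans (norm_le_enorm u) ur.
have := Hr _ b; rewrite /= !fctE /=.
have -> : (u, h) + (x, t) = (x + u, t + h) by rewrite addrC.
have -> : 'd psi (x, t) (u, h) = dot (\row_i L ('e_i, 0)) u + L (0, 1) * h.
  have -> : (u, h) = \sum_i u 0 i *: ('e_i, 0 : R) + h *: (0, 1) :> E * R.
    rewrite {1}[u]row_sum_delta.
    apply/eqP; rewrite -pair_eqE /= ; apply/andP; split; apply/eqP.
      rewrite /= scaler0 addr0 (big_morph (fun p : E * R => p.1) (id1 := 0) (op1 := +%R))//.
    rewrite /= (big_morph (fun p : E * R => p.2) (id1 := 0) (op1 := +%R))//= big1 ?add0r//.
      by rewrite [h *: _]mulr1.
    by move=> i _; rewrite scaler0.
  rewrite linearD linear_sum /= linearZ /= mulrC; congr (_ + _).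
  by apply: eq_bigr => i _; rewrite linearZ /= mxE mulrC.
rewrite !opprD !addrA => K; apply: le_trans K _; rewrite ler_wpM2l ?(ltW e0)//.
rewrite prod_normE /= ge_max; apply/andP; split.
  by apply: le_trans (norm_le_enorm u) _; rewrite lerDl.
by rewrite lerDr enorm_ge0.
Qed.

Variables (Om1 Om2 H : set E) (x : E).
Hypothesis hO : hyp_Omega Om1 Om2 H.
Hypothesis Hx : H x.

(** [phi] is expanded with the ambient gradient [w] of a local extension. Between points of H the
    normal component of the displacement is quadratic, so replacing [w] by the tangential gradient
    costs a second-order term. *)
Lemma tangential_expansion (T t : R) (phi : E -> R -> R) :
  C1_on_interface H T phi -> 0 < t < T ->
  let p := tangential_gradient H (fun z => phi z t) x in
  forall e : R, 0 < e -> exists2 r : R, 0 < r & forall z (s : R), H z ->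
    enorm (z - x) < r -> `|s - t| < r ->
    `|phi z s - phi x t - dot p (z - x) - derive1 (phi x) t * (s - t)|
    <= e * (enorm (z - x) + `|s - t|).
Proof.
move=> phiC /andP[t0 tT] p.
have [G [C [rho [rho0 C0 fG GL G1]]]] := interface_chart hO Hx.
have [|U [psi [oU Uxt [dpsi _] psiE]]] := phiC x t Hx; first by rewrite in_itv/= !ltW.
have [w [c Hwc]] := differentiable_expansion (dpsi _ Uxt).
have [q q0 Hq] : exists2 q : R, 0 < q & forall z (s : R), H z -> enorm (z - x) < q -> `|s - t| < q ->
    psi (z, s) = phi z s.
  have /nbhs_ballP[q /= q0 Hq] : nbhs (x, t) U by exact: open_nbhs_nbhs.
  exists (Num.min q (Num.min t (T - t))); first by rewrite !lt_min q0 t0 subr_gt0.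
  move=> z s Hz; rewrite !lt_min => /andP[zq _] /andP[sq /andP[st sT]].
  apply: psiE => //; last first.
    by move: st sT; rewrite !ltr_norml in_itv/= => /andP[? ?] /andP[? ?]; apply/andP; split; lra.
  apply: Hq; rewrite prod_norm_ball /= prod_normE/= gt_max [`|t - s|]distrC sq andbT.
  by rewrite distrC; exact: le_lt_trans (norm_le_enorm _) zq.
have {Hq}Hphi (e : R) : 0 < e -> exists2 r : R, 0 < r & forall z (s : R), H z ->
    enorm (z - x) < r -> `|s - t| < r ->
    `|phi z s - phi x t - dot w (z - x) - c * (s - t)| <= e * (enorm (z - x) + `|s - t|).
  move=> /Hwc[r r0 Hr]; exists (Num.min q r); first by rewrite lt_min q0.
  move=> z s Hz; rewrite !lt_min => /andP[zq zr] /andP[sq sr].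
  have := Hr _ _ zr sr; rewrite [x + _]addrC subrK [t + _]addrC subrK !Hq//.
    by rewrite subrr enorm0.
  by rewrite subrr normr0.
have -> : derive1 (phi x) t = c.
  have : is_derive t 1 (phi x) c.
    apply/dderP => e e0; have [r r0 Hr] := Hphi e e0; exists r => // h hr.
    have := Hr x (t + h) Hx; rewrite subrr enorm0 [t + h]addrC addrK => /(_ r0 hr).
    by rewrite dotC dot0l subr0 add0r -[h *: c]/(h * c) [h * c]mulrC.
  by move=> dphi; rewrite derive1E; exact: derive_val.
have pw : forall v, dot (G x) v = 0 -> dot p v = dot w v.
  apply: (tangential_gradientP hO Hx rho0 C0 fG G1) => e e0; have [r r0 Hr] := Hphi e e0.
  exists r => // z Hz zr; have := Hr z t Hz zr; rewrite subrr normr0 mulr0 subr0 addr0.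
  exact.
set g := G x in pw; have gg : dot g g = 1 by rewrite -sqr_enorm G1 ?expr1n//; exact: ballxx.
have xx : ball x rho x by exact: ballxx.
have [d d0 Hd] := ball_enorm xx.
move=> e e0; have e20 : 0 < e / 2 by rewrite divr_gt0.
pose B := enorm (p - w); have B0 : 0 <= B by exact: enorm_ge0.
have BC : 0 < B * C + 1 by rewrite ltr_wpDl// mulr_ge0.
have [r r0 Hr] := Hphi _ e20.
exists (Num.min r (Num.min d (e / 2 / (B * C + 1)))); first by rewrite !lt_min r0 d0 divr_gt0.
move=> z s Hz; rewrite !lt_min => /andP[zr /andP[zd ze]] /andP[sr _].
have h1 := Hr z s Hz zr sr.
set u := z - x in zr zd ze h1 *; pose k := dot g u.
have ku : `|k| <= C * enorm u ^+ 2.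
  have := fG _ _ xx (Hd u zd); have -> : x + u = z by rewrite /u addrC subrK.
  rewrite (sdist0 hO Hz) (sdist0 hO Hx) subrr sub0r.
  by rewrite normrN.
have h2 : dot p u = dot w u + k * dot (p - w) g.
  have := pw (u - k *: g); rewrite (dotBr g u) (dotBr p u) (dotBr w u) !dotZr gg mulr1 subrr dotBl => /(_ erefl); lra.
have h3 : `|k * dot (p - w) g| <= e / 2 * enorm u.
  have : `|dot (p - w) g| <= B.
    by have := dot_enorm (p - w) g; rewrite [enorm g]G1// mulr1.
  rewrite normrM => h; apply: (@le_trans _ _ (C * enorm u ^+ 2 * B)); first exact: ler_pM.
  rewrite expr2 mulrA mulrAC ler_wpM2r ?enorm_ge0//.
  apply: (@le_trans _ _ ((B * C + 1) * enorm u)).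
    by rewrite mulrAC [C * B]mulrC ler_wpM2r ?enorm_ge0// lerDl.
  by rewrite mulrC -ler_pdivlMr// ltW.
have -> : phi z s - phi x t - dot p u - c * (s - t) =
   (phi z s - phi x t - dot w u - c * (s - t)) - k * dot (p - w) g by rewrite h2; ring.
apply: le_trans (ler_normB _ _) _.
have : 0 <= e / 2 * `|s - t| by rewrite mulr_ge0// ltW.
lra.
Qed.

End tangential_expansion.

(** * Drifts, costs and multipliers *)

Section multipliers.
Context {R : realType}.

(** The infimum of the slopes over positive abscissas also supports points of negative abscissa: the
    segment to a point of positive abscissa crosses the vertical axis, where ordinates are
    nonnegative. *)
Let ratio_bound (S : set (R * R)) (q : R) : S !=set0 ->
  (exists2 c, S c & 0 < c.1) ->
  (forall c c' th, S c -> S c' -> 0 <= th <= 1 ->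
     S (th * c.1 + (1 - th) * c'.1, th * c.2 + (1 - th) * c'.2)) ->
  (forall L, S (0, L) -> 0 <= L) ->
  (forall c, S c -> 0 < c.1 -> q <= c.2 / c.1) ->
  exists m : R, [/\ forall c, S c -> m * c.1 <= c.2, q <= m &
    forall e : R, 0 < e -> exists c, [/\ S c, 0 < c.1 & c.2 / c.1 < m + e]].
Proof.
move=> [c0 Sc0] [c1 Sc1 c1p] cS zS Hq.
pose Q : set R := [set c.2 / c.1 | c in [set c | S c /\ 0 < c.1]].
have Q0 : Q !=set0 by exists (c1.2 / c1.1), c1.
have Qlb : has_lbound Q by exists q => _ [c [Sc cp] <-]; exact: Hq.
have qm : q <= inf Q by apply: lb_le_inf => // _ [c [Sc cp] <-]; exact: Hq.
exists (inf Q); split => //; last first.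
  move=> e e0; have [_ [c [Sc cp] <-] ce] := @inf_adherent R Q e e0 (conj Q0 Qlb).
  by exists c.
move=> [B L] Sc /=; have [B0|B0|B0] := ltgtP 0 B.
- rewrite -ler_pdivlMr//; apply: ge_inf => //; by exists (B, L).
- have LB : L / B <= inf Q.
    apply: lb_le_inf => // _ [[B' L'] [Sc' /= cp] <-].
    have BB : 0 < B' - B by lra.
    have := cS _ _ (B' / (B' - B)) Sc Sc'; rewrite /=.
    rewrite (_ : _ * B + _ = 0); last by field; rewrite gt_eqF.
    move=> /(_ _)/zS H.
    have : 0 <= B' * L - B * L'.
      have -> : B' * L - B * L' = (B' - B) * (B' / (B' - B) * L + (1 - B' / (B' - B)) * L').
        by field; rewrite gt_eqF.
      rewrite mulr_ge0 ?(ltW BB)//; apply: H; apply/andP; split.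
        by rewrite divr_ge0// ltW.
      by rewrite ler_pdivrMr// mul1r; lra.
    move=> h; rewrite ler_ndivrMr// mulrAC ler_pdivrMr//; lra.
  by move: LB; rewrite ler_ndivrMr.
- by rewrite -B0 mulr0; apply: zS; rewrite B0.
Qed.

(* [m_i] is the infimum of the slopes [L / B] over the points [(B, L)] of [S_i]
   with [0 < B]. *)
Lemma one_sided_multipliers (S1 S2 : set (R * R)) (delta : R) : 0 < delta ->
  (exists L, S1 (delta, L)) -> (exists L, S2 (delta, L)) ->
  (exists L, S1 (0, L)) -> (exists L, S2 (0, L)) ->
  (forall c c' th, S1 c -> S1 c' -> 0 <= th <= 1 ->
     S1 (th * c.1 + (1 - th) * c'.1, th * c.2 + (1 - th) * c'.2)) ->
  (forall c c' th, S2 c -> S2 c' -> 0 <= th <= 1 ->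
     S2 (th * c.1 + (1 - th) * c'.1, th * c.2 + (1 - th) * c'.2)) ->
  (forall c1 c2 mu, S1 c1 -> S2 c2 -> 0 <= mu <= 1 -> 0 <= c1.1 -> 0 <= c2.1 ->
     mu * c1.1 = (1 - mu) * c2.1 -> 0 <= mu * c1.2 + (1 - mu) * c2.2) ->
  exists m1 m2 : R, [/\ 0 <= m1 + m2, forall c, S1 c -> m1 * c.1 <= c.2 &
    forall c, S2 c -> m2 * c.1 <= c.2].
Proof.
move=> d0 [L1 S1d] [L2 S2d] [K1 S10] [K2 S20] cS1 cS2 HS.
have pair c1 c2 : S1 c1 -> S2 c2 -> 0 < c1.1 -> 0 < c2.1 -> 0 <= c1.2 / c1.1 + c2.2 / c2.1.
  move=> Sc1 Sc2 p1 p2; have s0 : 0 < c1.1 + c2.1 by rewrite addr_gt0.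
  (* This weight balances the first components, [mu * c1.1 = (1 - mu) * c2.1]. *)
  pose mu := c2.1 / (c1.1 + c2.1).
  have := HS c1 c2 mu Sc1 Sc2 _ (ltW p1) (ltW p2).
  have mu1 : 1 - mu = c1.1 / (c1.1 + c2.1) by rewrite /mu; field; rewrite gt_eqF.
  rewrite mu1 => H; have {H}: 0 <= mu * c1.2 + c1.1 / (c1.1 + c2.1) * c2.2.
    apply: H; last by rewrite /mu mulrAC [RHS]mulrAC [c2.1 * _]mulrC.
    apply/andP; split; first by rewrite divr_ge0 ?(ltW p2) ?(ltW s0).
    by rewrite /mu ler_pdivrMr// mul1r lerDr ltW.
  have -> : mu * c1.2 + c1.1 / (c1.1 + c2.1) * c2.2 =
      (c1.2 / c1.1 + c2.2 / c2.1) * (c1.1 * c2.1 / (c1.1 + c2.1)).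
    by rewrite /mu; field; rewrite !gt_eqF.
  by rewrite pmulr_lge0// divr_gt0// mulr_gt0.
(* The opposite point of abscissa [delta] bounds the slopes from below. Weight 1 on a point of the
   axis, against an opposite point of abscissa 0, shows that its ordinate is nonnegative. *)
have [m1 [Hm1 _ am1]] : exists m : R, [/\ forall c, S1 c -> m * c.1 <= c.2, - (L2 / delta) <= m &
    forall e : R, 0 < e -> exists c, [/\ S1 c, 0 < c.1 & c.2 / c.1 < m + e]].
  apply: ratio_bound => //; [by exists (delta, L1)|by exists (delta, L1)| |].
  - by move=> L SL; have := HS _ _ 1 SL S20; rewrite /= subrr !mul0r !mul1r addr0 ler01 lexx; apply.
  - by move=> c Sc cp; have := pair c _ Sc S2d cp d0; rewrite /=; lra.
have [m2 [Hm2 _ am2]] : exists m : R, [/\ forall c, S2 c -> m * c.1 <= c.2, - (L1 / delta) <= m &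
    forall e : R, 0 < e -> exists c, [/\ S2 c, 0 < c.1 & c.2 / c.1 < m + e]].
  apply: ratio_bound => //; [by exists (delta, L2)|by exists (delta, L2)| |].
  - by move=> L SL; have := HS _ _ 0 S10 SL; rewrite /= subr0 !mul0r !mul1r add0r ler01 lexx; apply.
  - by move=> c Sc cp; have := pair _ c S1d Sc d0 cp; rewrite /=; lra.
exists m1, m2; split => //; apply/ler_addgt0Pr => e e0.
have e20 : 0 < e / 2 by rewrite divr_gt0.
have [c [Sc cp cm]] := am1 _ e20; have [c' [Sc' cp' cm']] := am2 _ e20.
have := pair _ _ Sc Sc' cp cp'; lra.
Qed.

End multipliers.

Section one_side.
Context {R : realType} {N : nat} {A : metricType R}.
Local Notation E := 'rV[R]_N.
Variables (T : R) (Om : set E) (b : E -> R -> A -> E) (l : E -> R -> A -> R).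
Variables (Mb Lb Ml : R) (ml : R -> R).
Hypotheses (HC1 : hyp_C1 T Om b Mb Lb) (HC2 : hyp_C2 T Om l Ml ml) (HC3 : hyp_C3 T Om b l).

Lemma drift_near z (s : R) a : closure Om z -> 0 <= s <= T -> forall e : R, 0 < e ->
  exists2 d : R, 0 < d & forall a', ball a d a' -> enorm (b z s a' - b z s a) < e.
Proof.
move=> cz sT e e0; have [_ /subspace_continuousP H _ _] := HC1.
have D (a' : A) : ctrl_domain T Om (z, s, a') by split => //=; rewrite in_itv.
have [d d0 Hd] := near_enorm (b z s a) e0.
have := H (z, s, a) (D a) _ (nbhsx_ballx _ _ d0).
move=> /nbhs_ballP[r /= r0 Hr]; exists r => // a' aa'.
rewrite enorm_distC; apply: Hd; have := Hr (z, s, a'); rewrite /= -ball_normE /=; apply => //.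
by split=> //; split; exact: ballxx.
Qed.

Lemma cost_near z (s : R) a : closure Om z -> 0 <= s <= T -> forall e : R, 0 < e ->
  exists2 d : R, 0 < d & forall a', ball a d a' -> `|l z s a' - l z s a| < e.
Proof.
move=> cz sT e e0; have [H _ _ _] := HC2.
have D (a' : A) : ctrl_domain T Om (z, s, a') by split => //=; rewrite in_itv.
have [d d0 Hd] := H e e0; exists d => // a' aa'.
rewrite distrC; apply: (Hd (z, s, a) (z, s, a')) => //.
by split=> //; split; exact: ballxx.
Qed.

Lemma cost_modulus : forall e : R, 0 < e -> exists2 d : R, 0 < d &
  forall z (s : R) z' (s' : R) a, closure Om z -> closure Om z' -> 0 <= s <= T -> 0 <= s' <= T ->
    enorm (z - z') + `|s - s'| < d -> `|l z s a - l z' s' a| < e.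
Proof.
case: HC2 => _ _ [ml0 _ /cvgrPdist_lt mlc] Hl e e0.
have /nbhs_ballP[d /= d0 Hd] := mlc e e0.
exists d => // z s z' s' a cz cz' sT sT' zz.
have D z1 s1 : closure Om z1 -> 0 <= s1 <= T -> ctrl_domain T Om (z1, s1, a).
  by move=> cz1 sT1; split => //=; rewrite in_itv.
apply: le_lt_trans (Hl _ _ _ _ _ (D _ _ cz sT) (D _ _ cz' sT')) _.
set r := _ + _ in zz *; have r0 : 0 <= r by rewrite addr_ge0 ?enorm_ge0.
have [->|rn0] := eqVneq r 0; first by rewrite ml0.
have rp : 0 < r by rewrite lt_def rn0.
have := Hd r; rewrite /ball/= sub0r normrN gtr0_norm// => /(_ zz rp).
by rewrite sub0r normrN; apply: le_lt_trans; exact: ler_norm.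
Qed.

Lemma drift_cost_convex z (s : R) a a' (th : R) : closure Om z -> 0 <= s <= T -> 0 <= th <= 1 ->
  exists a'', b z s a'' = th *: b z s a + (1 - th) *: b z s a' /\
              l z s a'' = th * l z s a + (1 - th) * l z s a'.
Proof.
move=> cz sT /andP[t0 t1]; have [|_] := HC3 cz (s := s); first by rewrite in_itv.
set BL := (X in convex_set X) => cBL.
have := cBL (b z s a, l z s a) (b z s a', l z s a') (Itv01 t0 t1).
have BLa a1 : (b z s a1, l z s a1) \in BL by apply/mem_set; exists a1.
by move=> /(_ (BLa a) (BLa a'))/set_mem[a'' _ [ba la]]; exists a''.
Qed.

(** A squared distance, in the form that [measurable_selection] asks for: nonnegative, continuous in
    [a], and zero exactly at the controls with velocity [y] and cost [k]. *)
Definition mismatch z (s : R) y (k : R) a : R :=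
  dot (b z s a - y) (b z s a - y) + (l z s a - k) ^+ 2.

Lemma mismatch_ge0 z s y k a : 0 <= mismatch z s y k a.
Proof. by rewrite addr_ge0 ?dot_ge0 ?sqr_ge0. Qed.

Lemma mismatch_eq0 z s y k a : mismatch z s y k a = 0 -> b z s a = y /\ l z s a = k.
Proof.
move/eqP; rewrite paddr_eq0 ?dot_ge0 ?sqr_ge0// => /andP[/eqP d1].
rewrite sqrf_eq0 subr_eq0 => /eqP lk; split => //.
by apply/eqP; rewrite -subr_eq0; apply/eqP/enorm_eq0; rewrite /enorm d1 sqrtr0.
Qed.

Lemma mismatch_continuous z (s : R) y (k : R) : closure Om z -> 0 <= s <= T ->
  continuous (mismatch z s y k).
Proof.
move=> cz sT a; apply: cvgD.
  have cb : (enorm (b z s a' - y)) @[a' --> a] --> enorm (b z s a - y).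
    apply/cvgrPdist_lt => e e0; have [d d0 Hd] := drift_near a cz sT e0.
    apply/nbhs_ballP; exists d => //= a' /Hd.
    apply: le_lt_trans.
    have h1 := enorm_triangle (b z s a') (b z s a) y.
    have h2 := enorm_triangle (b z s a) (b z s a') y.
    rewrite (enorm_distC (b z s a) (b z s a')) in h1; rewrite ler_norml; apply/andP; split; lra.
  have : (enorm (b z s a' - y) * enorm (b z s a' - y)) @[a' --> a] --> enorm (b z s a - y) * enorm (b z s a - y).
    exact: cvgM.
  by under eq_fun do rewrite -expr2 sqr_enorm; rewrite -expr2 sqr_enorm.
have cl : (l z s a' - k) @[a' --> a] --> l z s a - k.
  apply: cvgB; last exact: cvg_cst.
  apply/cvgrPdist_lt => e e0; have [d d0 Hd] := cost_near a cz sT e0.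
  by apply/nbhs_ballP; exists d => //= a' /Hd; rewrite distrC.
by apply: (cvgM cl cl).
Qed.

(* The nearest point of the compact convex set of pairs [(b, l)] would otherwise
   separate it from [(y, k)]. *)
Lemma drift_cost_separation (a0 : A) z (s : R) y (k : R) : closure Om z -> 0 <= s <= T ->
  (forall (q : E) (kap sig : R), (forall a, sig <= dot q (b z s a) + kap * l z s a) ->
     sig <= dot q y + kap * k) ->
  exists a, b z s a = y /\ l z s a = k.
Proof.
move=> cz sT Hsep; have [cA _ _ _] := HC1.
pose D := mismatch z s y k.
have cD : continuous D by exact: mismatch_continuous.
have [|as_ _ Hmin] := @compact_EVT_min A R D setT _ cA (continuous_subspaceT cD); first by exists a0.
pose q := b z s as_ - y; pose kap := l z s as_ - k.
have D0 : 0 <= D as_ by exact: mismatch_ge0.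
have sqe (u v : E) (c : R) : dot (u + c *: v) (u + c *: v) = dot u u + 2 * c * dot u v + c ^+ 2 * dot v v.
  by rewrite dotDl !dotDr !dotZl !dotZr (dotC v u); ring.
have var a : 0 <= dot q (b z s a - b z s as_) + kap * (l z s a - l z s as_).
  set db := b z s a - b z s as_; set dl := l z s a - l z s as_.
  rewrite leNgt; apply/negP => neg; set m := dot q db + kap * dl in neg.
  pose n2 := dot db db + dl ^+ 2; have n20 : 0 <= n2 by rewrite addr_ge0 ?dot_ge0 ?sqr_ge0.
  have n21 : 0 < n2 + 1 by lra.
  (* With this step the quadratic term [th * n2] stays below [- m], so the first-order decrease
     [2 * m] wins and contradicts minimality. *)
  pose th := Num.min 1 (- m / (n2 + 1)).
  have th0 : 0 < th by rewrite lt_min ltr01 divr_gt0// oppr_gt0.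
  have th1 : 0 <= th <= 1 by rewrite (ltW th0) ge_min lexx.
  have [a'' [ba la]] := drift_cost_convex a as_ cz sT th1.
  have := Hmin a'' (mem_set I); rewrite /D /mismatch ba la.
  have -> : th *: b z s a + (1 - th) *: b z s as_ - y = q + th *: db.
    by rewrite /q /db scalerBl scale1r scalerBr; apply/rowP => i; rewrite !mxE; ring.
  have -> : th * l z s a + (1 - th) * l z s as_ - k = kap + th * dl by rewrite /kap /dl; ring.
  rewrite -/q -/kap sqe => h.
  have h1 : 0 <= th * (2 * m + th * n2) by rewrite /m /n2; lra.
  rewrite pmulr_rge0// in h1.
  have h2 : th * (n2 + 1) <= - m.
    by rewrite -ler_pdivlMr// ge_min lexx orbT.
  lra.
have := Hsep q kap (dot q (b z s as_) + kap * l z s as_) _.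
have h a : dot q (b z s as_) + kap * l z s as_ <= dot q (b z s a) + kap * l z s a.
  by have := var a; rewrite dotBr; lra.
move=> /(_ h) {}h.
have Dq : D as_ = dot q (b z s as_) + kap * l z s as_ - (dot q y + kap * k).
  by rewrite /D /mismatch -/q -/kap {2}/q dotBr expr2 {2}/kap; ring.
by exists as_; apply: mismatch_eq0; apply/eqP; rewrite eq_le D0 andbT -/D Dq subr_le0.
Qed.

End one_side.

(** * Limits of trajectories *)

Section enorm_curves.
Context {R : realType} {N : nat}.
Local Notation E := 'rV[R]_N.
Local Notation mu := (@lebesgue_measure R).
Implicit Types (X : R -> E) (F : R -> R) (s a b c L M : R).

Definition enorm_lipon L a b X :=
  forall s s' : R, a <= s <= b -> a <= s' <= b -> enorm (X s - X s') <= L * `|s - s'|.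

Lemma enorm_lipon_norm L a b X : enorm_lipon L a b X -> lipon L a b X.
Proof. by move=> HX s s' sab sab'; apply: le_trans (norm_le_enorm _) _; exact: HX. Qed.

Lemma enorm_lipon_coord L a b X i : enorm_lipon L a b X -> lipon L a b (fun s => X s 0 i).
Proof.
move=> HX s s' sab sab'; apply: le_trans _ (HX s s' sab sab').
by have := coord_le_enorm (X s - X s') i; rewrite !mxE.
Qed.

Lemma enorm_lipon_dot L a b X q : enorm_lipon L a b X ->
  lipon (enorm q * L) a b (fun s => dot q (X s)).
Proof.
move=> HX s s' sab sab'; rewrite -dotBr; apply: le_trans (dot_enorm _ _) _.
by rewrite -mulrA ler_wpM2l ?enorm_ge0//; exact: HX.
Qed.

Lemma liponD L L' a b F G : lipon L a b F -> lipon L' a b G ->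
  lipon (L + L') a b (fun s => F s + G s).
Proof.
move=> HF HG s s' sab sab'; rewrite opprD addrACA mulrDl.
by apply: le_trans (ler_normD _ _) _; apply: lerD; [exact: HF|exact: HG].
Qed.

Lemma liponZ L a b c F : lipon L a b F -> lipon (`|c| * L) a b (fun s => c * F s).
Proof. by move=> HF s s' sab sab'; rewrite -mulrBr normrM -mulrA ler_wpM2l//; exact: HF. Qed.

Lemma lipon_sub (V : normedModType R) L a b a' b' (F : R -> V) : a <= a' -> b' <= b ->
  lipon L a b F -> lipon L a' b' F.
Proof. by move=> aa bb HF s s' /andP[? ?] /andP[? ?]; apply: HF; apply/andP; split; lra. Qed.

Lemma enorm_lipon_sub L a b a' b' X : a <= a' -> b' <= b ->
  enorm_lipon L a b X -> enorm_lipon L a' b' X.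
Proof. by move=> aa bb HF s s' /andP[? ?] /andP[? ?]; apply: HF; apply/andP; split; lra. Qed.

Lemma ae_growth L a b c F : lipon L a b F -> a <= b ->
  {ae mu, forall s, a < s < b -> exists2 d, dder F s d & c <= d} -> c * (b - a) <= F b - F a.
Proof.
move=> FL ab Hae; apply: (lipschitz_growth FL ab Hae) => s sab /contrapT/(_ sab)[d dF cd] e e0.
have [r r0 Hr] := dF e e0; exists r => // h /andP[h0 hr].
have := Hr h; rewrite gtr0_norm// => /(_ hr); rewrite -[h *: d]/(h * d) => /ler_normlP[+ _].
have : c * h <= d * h by rewrite ler_wpM2r// ltW.
lra.
Qed.

Lemma dder_dot X s d q : dder X s d -> dder (fun r => dot q (X r)) s (dot q d).
Proof.
move=> dX e e0; have q1 : 0 < enorm q + 1 by rewrite ltr_wpDl ?enorm_ge0.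
have [r r0 Hr] := dX _ (divr_gt0 e0 (mulr_gt0 q1 (ltr_wpDl (ler0n R N) ltr01))).
exists r => // h /Hr H; rewrite -[h *: _]/(h * _) -dotZr -!dotBr.
apply: le_trans (dot_enorm _ _) _.
apply: (@le_trans _ _ ((enorm q + 1) * ((N%:R + 1) * `|X (s + h) - X s - h *: d|))).
  apply: ler_pM; rewrite ?enorm_ge0 ?lerDl//.
  by apply: le_trans (enorm_le_norm _) _; rewrite ler_wpM2r ?lerDl.
by rewrite mulrA; move: H; rewrite mulrAC ler_pdivlMr ?mulr_gt0// mulrC.
Qed.

(** An admissible trajectory comes with some Lipschitz constant of its own. Integrating its velocity
    in the direction of the increment [v] replaces it by the speed bound, which is uniform over
    trajectories. *)
Lemma enorm_lipon_ae L M a b X : lipon L a b X -> 0 <= M ->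
  {ae mu, forall s, a < s < b -> exists2 d, dder X s d & enorm d <= M} ->
  enorm_lipon M a b X.
Proof.
move=> XL M0 Hae.
have key s s' : a <= s -> s <= s' -> s' <= b -> enorm (X s' - X s) <= M * (s' - s).
  move=> as_ ss' sb; set v := X s' - X s.
  have L' : lipon (`|-1| * (enorm v * (N%:R * L))) s s' (fun r => -1 * dot v (X r)).
    apply: liponZ => r r' /andP[r1 r2] /andP[r3 r4]; rewrite -dotBr.
    apply: le_trans (dot_enorm _ _) _; rewrite -mulrA ler_wpM2l ?enorm_ge0//.
    apply: le_trans (enorm_le_norm _) _; rewrite -mulrA ler_wpM2l//.
    by apply: XL; apply/andP; split; lra.
  have := ae_growth (c := - (enorm v * M)) L' ss' _.
  have -> : -1 * dot v (X s') - -1 * dot v (X s) = - (enorm v ^+ 2).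
    by rewrite sqr_enorm {3}/v dotBr; ring.
  move=> H; have {}H : - (enorm v * M) * (s' - s) <= - enorm v ^+ 2.
    apply: H; apply: aeS Hae => r Hr /andP[r1 r2].
    have [|d dX dM] := Hr; first by apply/andP; split; lra.
    exists (-1 * dot v d); first by apply: (dderZ (-1)); exact: dder_dot.
    rewrite mulN1r lerN2; apply: le_trans (ler_norm _) _; apply: le_trans (dot_enorm _ _) _.
    by rewrite ler_wpM2l// enorm_ge0.
  have [v0|v0] := eqVneq (enorm v) 0; first by rewrite v0 mulr_ge0// subr_ge0.
  have vp : 0 < enorm v by rewrite lt_def v0 enorm_ge0.
  rewrite -(ler_pM2l vp) -expr2; lra.
move=> s s' /andP[s1 s2] /andP[s3 s4]; have [ss|ss] := leP s s'.
  by rewrite enorm_distC distrC ger0_norm ?subr_ge0//; exact: key.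
by rewrite gtr0_norm ?subr_gt0//; apply: key => //; exact: ltW.
Qed.

Lemma dder_row X s (d : E) : (forall i, dder (fun r => X r 0 i) s (d 0 i)) -> dder X s d.
Proof.
move=> H e e0; have /choice[r Hr] : forall i, exists r : R, 0 < r /\ forall h : R, `|h| < r ->
    `|X (s + h) 0 i - X s 0 i - h *: d 0 i| <= e * `|h|.
  by move=> i; have [r r0 Hr] := H i e e0; exists r.
exists (\big[Num.min/1]_i r i).
  by apply: (big_ind (fun y : R => 0 < y)) => // [y z y0 z0|i _]; [rewrite lt_min y0|have [] := Hr i].
move=> h hr; rewrite [leLHS](_ : _ = mx_norm (X (s + h) - X s - h *: d))// mx_normrE.
apply: bigmax_le; first by rewrite mulr_ge0// ltW.
move=> -[k i] _; rewrite ord1 !mxE; have [_] := Hr i; apply.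
apply: lt_le_trans hr _; exact: bigmin_le.
Qed.

Lemma enorm_lipon_ae_dder L a b X : enorm_lipon L a b X ->
  {ae mu, forall s, a < s < b -> exists d, dder X s d}.
Proof.
move=> XL.
have H : {ae mu, forall s, forall i, a < s < b -> exists d, dder (fun r => X r 0 i) s d}.
  have /(@filter_forall _ _ _ _ (ae_filter_ringOfSetsType mu)) : forall i,
      {ae mu, forall s, a < s < b -> exists d, dder (fun r => X r 0 i) s d}.
    by move=> i; exact: lipschitz_ae_dder (enorm_lipon_coord i XL).
  exact.
apply: aeS H => s Hs sab; have /choice[d Hd] : forall i, exists d, dder (fun r => X r 0 i) s d.
  by move=> i; exact: Hs.
by exists (\row_i d i); apply: dder_row => i; rewrite mxE.
Qed.

(** [ae_growth] with rate 0, applied to the difference in both orders. It identifies integrals with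
    increments of limits or of translated primitives. *)
Lemma lipon_ae_eq L L' a b F G : lipon L a b F -> lipon L' a b G -> a <= b ->
  {ae mu, forall s, a < s < b -> exists2 d, dder F s d & dder G s d} ->
  F b - F a = G b - G a.
Proof.
move=> FL GL ab Hae.
have H (F1 G1 : R -> R) L1 L1' : lipon L1 a b F1 -> lipon L1' a b G1 ->
    {ae mu, forall s, a < s < b -> exists2 d, dder F1 s d & dder G1 s d} ->
    0 <= (F1 b - F1 a) - (G1 b - G1 a).
  move=> F1L G1L Hae1.
  have := ae_growth (c := 0) (liponD F1L (liponZ (-1) G1L)) ab.
  rewrite mul0r => K; have {K} : 0 <= F1 b + -1 * G1 b - (F1 a + -1 * G1 a).
    apply: K; apply: aeS Hae1 => s Hs /Hs[d dF dG]; exists (d + -1 * d).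
      exact: dderD dF (dderZ (-1) dG).
    by rewrite mulN1r subrr.
  lra.
have h1 := H F G _ _ FL GL Hae.
have h2 := H G F _ _ GL FL (aeS (fun s Hs sab => let: ex_intro2 d a b := Hs sab in ex_intro2 _ _ d b a) Hae).
lra.
Qed.

End enorm_curves.

Section measurable_derivative.
Context {R : realType}.

Lemma lip_continuous (f : R -> R) (K : R) :
  (forall s s' : R, `|f s - f s'| <= K * `|s - s'|) -> continuous f.
Proof.
move=> H s; apply/cvgrPdist_lt => e e0.
have K1 : 0 < `|K| + 1 by rewrite ltr_wpDl.
apply/nbhs_ballP; exists (e / (`|K| + 1)) => /=; first by rewrite divr_gt0.
move=> s'; rewrite /ball/= ltr_pdivlMr// => h; apply: le_lt_trans (H _ _) _.
apply: le_lt_trans h; rewrite mulrC ler_wpM2l//.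
by apply: le_trans (ler_norm _) _; rewrite lerDl.
Qed.

Lemma lip_lipschitz (V : normedModType R) (Y : R -> V) (S : set R) (K : R) :
  (forall s s' : R, `|Y s - Y s'| <= K * `|s - s'|) -> [lipschitz Y s | s in S].
Proof.
move=> H; rewrite /lipschitz_on; near=> k => -[s s'] _ /=; apply: le_trans (H _ _) _; rewrite ler_wpM2r//.
Unshelve. all: by end_near. Qed.

Lemma measurable_dder (f : R -> R) (D : set R) d : continuous f ->
  (forall s, D s -> dder f s (d s)) -> measurable_fun D d.
Proof.
move=> cf Hd; pose h (m : nat) s := m.+1%:R * (f (s + m.+1%:R^-1) - f s).
apply: (@measurable_fun_cvg _ _ _ _ h).
  move=> m; apply: measurable_funTS; apply: continuous_measurable_fun => s.
  apply: cvgM; first exact: cvg_cst.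
  apply: cvgB; last exact: cf.
  apply: (@continuous_comp _ _ _ (fun s : R => s + m.+1%:R^-1) f); last exact: cf.
  by apply: cvgD; [exact: cvg_id|exact: cvg_cst].
move=> s Ds; apply/cvgrPdist_le => e e0; have [r r0 Hr] := Hd s Ds e e0.
near=> m; have m0 : (0 : R) < m.+1%:R^-1 by rewrite invr_gt0.
have mr : `|m.+1%:R^-1 : R| < r.
  by rewrite gtr0_norm//; near: m; exact: (near_infty_natSinv_lt (PosNum r0)).
have := Hr _ mr; rewrite (gtr0_norm m0) -[_ *: d s]/(_ * d s) => H.
rewrite distrC /h.
have -> : m.+1%:R * (f (s + m.+1%:R^-1) - f s) - d s =
    m.+1%:R * (f (s + m.+1%:R^-1) - f s - m.+1%:R^-1 * d s).
  by rewrite [RHS]mulrBr mulVKf// pnatr_eq0.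
by rewrite normrM normr_nat mulrC -ler_pdivlMr.
Unshelve. all: by end_near. Qed.

Lemma dder_coord {N : nat} (X : R -> 'rV[R]_N) s d i : dder X s d ->
  dder (fun r => X r 0 i) s (d 0 i).
Proof.
move=> H e e0; have [r r0 Hr] := H e e0; exists r => // h /Hr; apply: le_trans.
by have := coord_le_norm (X (s + h) - X s - h *: d) i; rewrite !mxE.
Qed.

(** Composition with it turns a function Lipschitz on [[0, eta]] into one Lipschitz on the line, so
    that preimages and difference quotients are Borel. *)
Definition clamp (eta s : R) := Num.max 0 (Num.min s eta).

Lemma clampE eta s : 0 <= s <= eta -> clamp eta s = s.
Proof. by move=> /andP[s0 se]; rewrite /clamp (min_idPl se) (max_idPr s0). Qed.

Lemma clamp_in eta s : 0 <= eta -> 0 <= clamp eta s <= eta.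
Proof. by move=> e0; rewrite /clamp le_max lexx ge_max e0 ge_min lexx orbT. Qed.

Lemma clamp_dist eta s s' : 0 <= eta -> `|clamp eta s - clamp eta s'| <= `|s - s'|.
Proof.
move=> e0; rewrite /clamp /Num.max /Num.min.
have := ler_norm (s - s'); have := ler_norm (- (s - s')); rewrite normrN.
move=> h1 h2; rewrite ler_norml.
clear -h1 h2 e0; case: (ltP s eta); case: (ltP s' eta) => ? ?; case: ltP => ?; case: ltP => ?;
  apply/andP; split; lra.
Qed.

End measurable_derivative.

(** * Limits of trajectories inside one side *)

Section one_sided_limit.
Context {R : realType} {N : nat} {A : metricType R}.
Local Notation E := 'rV[R]_N.
Local Notation mu := (@lebesgue_measure R).
Variables (T : R) (Om : set E) (b : E -> R -> A -> E) (l : E -> R -> A -> R).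
Variables (Mb Lb Ml : R) (ml : R -> R).
Hypotheses (HC1 : hyp_C1 T Om b Mb Lb) (HC2 : hyp_C2 T Om l Ml ml) (HC3 : hyp_C3 T Om b l).
Hypothesis Mb0 : 0 <= Mb.
Variable a0 : A.
Hypothesis oOm : open Om.

Lemma drift_cost_near (q : E) (kap : R) z0 (s0 : R) : closure Om z0 -> 0 <= s0 <= T ->
  forall e : R, 0 < e -> exists2 d : R, 0 < d & forall z (s : R) a, closure Om z -> 0 <= s <= T ->
    enorm (z - z0) + `|s - s0| < d ->
    dot q (b z0 s0 a) + kap * l z0 s0 a - e <= dot q (b z s a) + kap * l z s a.
Proof.
move=> cz0 sT0 e e0; have e20 : 0 < e / 2 by rewrite divr_gt0.
have k1 : 0 < `|kap| + 1 by rewrite ltr_wpDl.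
have [d2 d20 Hd2] := cost_modulus HC2 (divr_gt0 e20 k1).
pose Q := enorm q * `|Lb| + 1; have Q0 : 0 < Q by rewrite ltr_wpDl// mulr_ge0 ?enorm_ge0.
exists (Num.min d2 (e / 2 / Q)); first by rewrite lt_min d20 divr_gt0.
move=> z s a cz sT; set r := _ + _; rewrite lt_min => /andP[r2 r3].
have r0 : 0 <= r by rewrite addr_ge0 ?enorm_ge0.
have h1 := Hd2 z s z0 s0 a cz cz0 sT sT0 r2.
have h2 : `|kap * (l z s a - l z0 s0 a)| <= e / 2.
  rewrite normrM; apply: (@le_trans _ _ ((`|kap| + 1) * (e / 2 / (`|kap| + 1)))).
    by apply: ler_pM; rewrite ?lerDl// ltW.
  by rewrite mulrC divfK// gt_eqF.
have h3 : `|dot q (b z s a - b z0 s0 a)| <= e / 2.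
  have [_ _ _ HL] := HC1; apply: le_trans (dot_enorm _ _) _.
  apply: (@le_trans _ _ (enorm q * (Lb * r))).
    by rewrite ler_wpM2l ?enorm_ge0//; apply: HL; split => //=; rewrite in_itv.
  apply: (@le_trans _ _ (Q * r)).
    rewrite mulrA ler_wpM2r//; apply: (@le_trans _ _ (enorm q * `|Lb|)); last by rewrite lerDl.
    by rewrite ler_wpM2l ?enorm_ge0// ler_norm.
  by rewrite mulrC -ler_pdivlMr// ltW.
rewrite dotBr in h3; move: h2 h3; rewrite mulrBr => /ler_normlP[h2 _] /ler_normlP[h3 _]; lra.
Qed.

Variables (t eta : R) (Xn : nat -> R -> E) (Ln : nat -> R -> R) (tn : nat -> R).
Variables (F : set_system nat) (X : R -> E) (L : R -> R).
Context {FF : ProperFilter F}.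
Hypothesis eta0 : 0 < eta.
Hypothesis XnL : forall n, enorm_lipon Mb 0 eta (Xn n).
Hypothesis LnL : forall n, lipon Ml 0 eta (Ln n).
Hypothesis tT : eta <= t <= T.
Hypothesis tnT : forall n, eta <= tn n <= T.
Hypothesis tlim : forall e : R, 0 < e -> F [set n | `|tn n - t| < e].
Hypothesis Xlim : forall s : R, 0 <= s <= eta -> forall e : R, 0 < e ->
  F [set n | enorm (Xn n s - X s) < e].
Hypothesis Llim : forall s : R, 0 <= s <= eta -> forall e : R, 0 < e ->
  F [set n | `|Ln n s - L s| < e].

Lemma limit_enorm_lipon : enorm_lipon Mb 0 eta X.
Proof.
move=> s s' s0 s'0; apply/ler_addgt0Pr => e e0; have e20 : 0 < e / 2 by rewrite divr_gt0.
have [n [h1 h2]] := filter_ex (filterI (Xlim s0 e20) (Xlim s'0 e20)).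
have h3 := XnL n s0 s'0.
have h4 := enorm_triangle (Xn n s) (X s) (X s').
have h5 := enorm_triangle (Xn n s') (Xn n s) (X s').
rewrite /= enorm_distC in h1; rewrite /= in h2; lra.
Qed.

Lemma limit_lipon : lipon Ml 0 eta L.
Proof.
move=> s s' s0 s'0; apply/ler_addgt0Pr => e e0; have e20 : 0 < e / 2 by rewrite divr_gt0.
have [n [/= h1 h2]] := filter_ex (filterI (Llim s0 e20) (Llim s'0 e20)).
have h3 := LnL n s0 s'0; rewrite distrC in h1.
have -> : L s - L s' = (L s - Ln n s) + (Ln n s - Ln n s') + (Ln n s' - L s') by ring.
apply: le_trans (ler_normD _ _) _.
have := ler_normD (L s - Ln n s) (Ln n s - Ln n s'); lra.
Qed.

(** Derivatives of the approximations need not converge: their lower bound is integrated first, and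
    only the values at [s0] and [s1] pass to the limit. *)
Lemma limit_functional_growth (q : E) (kap c : R) s0 s1 : 0 <= s0 -> s0 <= s1 -> s1 <= eta ->
  F [set n | {ae mu, forall s, s0 < s < s1 ->
     exists d k, [/\ dder (Xn n) s d, dder (Ln n) s k & c <= dot q d + kap * k]}] ->
  c * (s1 - s0) <= dot q (X s1 - X s0) + kap * (L s1 - L s0).
Proof.
move=> s00 s01 s1e HF; apply/ler_addgt0Pr => e e0.
pose Q := enorm q + `|kap| + 1; have Q0 : 0 < Q by rewrite ltr_wpDl// addr_ge0 ?enorm_ge0.
have eQ : 0 < e / (2 * Q) by rewrite divr_gt0// mulr_gt0.
have i0 : 0 <= s0 <= eta by rewrite s00 (le_trans s01).
have i1 : 0 <= s1 <= eta by rewrite s1e (le_trans s00).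
have [n [[[/= x0 x1] [/= l0 l1]] Hn]] := filter_ex (filterI (filterI
  (filterI (Xlim i0 eQ) (Xlim i1 eQ)) (filterI (Llim i0 eQ) (Llim i1 eQ))) HF).
pose f s := dot q (Xn n s) + kap * Ln n s.
have fL : lipon (enorm q * Mb + `|kap| * Ml) s0 s1 f.
  apply: lipon_sub s00 s1e _; apply: liponD; first exact: enorm_lipon_dot.
  exact: liponZ.
have := ae_growth (c := c) fL s01 _; rewrite /f => H.
have {}H : c * (s1 - s0) <= dot q (Xn n s1) + kap * Ln n s1 - (dot q (Xn n s0) + kap * Ln n s0).
  apply: H; apply: aeS Hn => s Hs /Hs[d [k [dX dL cd]]].
  by exists (dot q d + kap * k) => //; apply: dderD (dderZ kap dL); exact: dder_dot.
have y (s : R) : enorm (Xn n s - X s) < e / (2 * Q) -> `|Ln n s - L s| < e / (2 * Q) ->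
    `|dot q (Xn n s - X s) + kap * (Ln n s - L s)| <= e / 2.
  move=> h1 h2; apply: le_trans (ler_normD _ _) _; rewrite normrM.
  have h3 := dot_enorm q (Xn n s - X s).
  have h4 : enorm q * enorm (Xn n s - X s) <= enorm q * (e / (2 * Q)) by rewrite ler_wpM2l ?enorm_ge0// ltW.
  have h5 : `|kap| * `|Ln n s - L s| <= `|kap| * (e / (2 * Q)) by rewrite ler_wpM2l// ltW.
  have h6 : Q * (e / (2 * Q)) = e / 2 by field; rewrite gt_eqF.
  have : 0 <= e / (2 * Q) by exact: ltW.
  rewrite -h6 /Q; lra.
have y0 := y s0 x0 l0; have y1 := y s1 x1 l1.
move: y0 y1 => /ler_normlP[y0 y0'] /ler_normlP[y1 y1'].
rewrite !dotBr in y0 y0' y1 y1' *; lra.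
Qed.

Hypothesis dyn : forall n, {ae mu, forall s, 0 < s < eta -> Om (Xn n s) ->
  exists a, dder (Xn n) s (b (Xn n s) (tn n - s) a) /\ dder (Ln n) s (l (Xn n s) (tn n - s) a)}.
Hypothesis XOm : forall s, 0 < s <= eta -> Om (X s).

Lemma limit_inclusion_growth (q : E) (kap sig : R) s0 : 0 < s0 < eta ->
  (forall a, sig <= dot q (b (X s0) (t - s0) a) + kap * l (X s0) (t - s0) a) ->
  forall e : R, 0 < e -> exists2 r : R, 0 < r & forall h : R, 0 < h < r ->
    (sig - e) * h <= dot q (X (s0 + h) - X s0) + kap * (L (s0 + h) - L s0).
Proof.
move=> /andP[s00 s0e] Hsig e e0; case/andP: tT => et tT'.
have Os0 : Om (X s0) by apply: XOm; rewrite s00 ltW.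
have ts0 : 0 <= t - s0 <= T by apply/andP; split; lra.
have [d1 d10 Hd1] := drift_cost_near q kap (subset_closure Os0) ts0 e0.
have [d d0 Hd] : exists2 d : R, 0 < d & forall z (s : R) a, 0 <= s <= T ->
    enorm (z - X s0) + `|s - (t - s0)| < d -> Om z /\
    dot q (b (X s0) (t - s0) a) + kap * l (X s0) (t - s0) a - e <= dot q (b z s a) + kap * l z s a.
  have /nbhs_ballP[d2 /= d20 Hd2] : nbhs (X s0) Om by exact: open_nbhs_nbhs.
  exists (Num.min d1 d2); first by rewrite lt_min d10.
  move=> z s a sT; rewrite lt_min => /andP[r1 r2].
  have Oz : Om z.
    apply: Hd2; rewrite -ball_normE /= distrC; apply: le_lt_trans (norm_le_enorm _) _.
    by apply: le_lt_trans r2; rewrite lerDl.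
  by split => //; apply: Hd1 => //; exact: subset_closure.
have Mb1 : 0 < Mb + 1 by rewrite ltr_wpDl.
(* Quarters of [d] cover the error of [Xn n s0], that of [tn n], and the displacement in space and
   time up to [s0 + h]. *)
pose r := Num.min (eta - s0) (d / (4 * (Mb + 1))).
have r0 : 0 < r by rewrite lt_min subr_gt0 s0e divr_gt0// mulr_gt0.
exists r => // h /andP[h0]; rewrite lt_min => /andP[he hd].
rewrite ltr_pdivlMr ?mulr_gt0// in hd.
have d40 : 0 < d / 4 by rewrite divr_gt0.
have i0 : 0 <= s0 <= eta by rewrite !ltW.
have -> : (sig - e) * h = (sig - e) * (s0 + h - s0) by ring.
apply: limit_functional_growth; rewrite ?(ltW s00) ?lerDl ?(ltW h0)//; first lra.
apply: filterS (filterI (Xlim i0 d40) (tlim d40)) => n /= [xn tn4].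
apply: aeS (dyn n) => s Hs /andP[s1 s2].
have se : s < eta by apply: lt_trans s2 _; rewrite addrC -ltrBrDr.
have sp : 0 < s by exact: lt_trans s00 s1.
have is_ : 0 <= s <= eta by rewrite !ltW.
have xs : enorm (Xn n s - X s0) + `|tn n - s - (t - s0)| < d.
  have h1 := enorm_triangle (Xn n s0) (Xn n s) (X s0).
  have h2 := XnL n is_ i0; rewrite gtr0_norm ?subr_gt0// in h2.
  have h3 : Mb * (s - s0) <= Mb * h by rewrite ler_wpM2l//; lra.
  have -> : tn n - s - (t - s0) = (tn n - t) - (s - s0) by ring.
  have := ler_normB (tn n - t) (s - s0); rewrite (gtr0_norm (x := s - s0)) ?subr_gt0//.
  have : (Mb + 1) * h < d / 4 by lra.
  have := tnT n; lra.
have ts : 0 <= tn n - s <= T.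
  have /andP[u1 u2] := tnT n; rewrite subr_ge0 (le_trans (ltW se) u1)/=.
  by apply: le_trans u2; rewrite gerBl ltW.
have [Os _] := Hd _ _ a0 ts xs.
have [|a [dX dL]] := Hs _ Os; first by rewrite sp se.
exists (b (Xn n s) (tn n - s) a), (l (Xn n s) (tn n - s) a); split => //.
have [_] := Hd _ _ a ts xs; have := Hsig a; lra.
Qed.

Let Y s := X (clamp eta s).
Let M s := L (clamp eta s).

Let YL s s' : enorm (Y s - Y s') <= Mb * `|s - s'|.
Proof.
apply: (le_trans (limit_enorm_lipon (clamp_in s (ltW eta0)) (clamp_in s' (ltW eta0)))).
by rewrite ler_wpM2l// clamp_dist// ltW.
Qed.

Let Ml0 : 0 <= Ml.
Proof.
have Os : Om (X eta) by apply: XOm; rewrite eta0 lexx.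
have [_ H _ _] := HC2; apply: le_trans (normr_ge0 _) (H (X eta) t a0 _).
split; first exact: subset_closure.
rewrite /= in_itv/=; case/andP: tT => et ->; rewrite andbT.
exact: le_trans (ltW eta0) et.
Qed.

Let ML s s' : `|M s - M s'| <= Ml * `|s - s'|.
Proof.
apply: (le_trans (limit_lipon (clamp_in s (ltW eta0)) (clamp_in s' (ltW eta0)))).
by rewrite ler_wpM2l// clamp_dist// ltW.
Qed.

Let YOm s : 0 < s < eta -> [/\ Om (Y s), closure Om (Y s) & 0 <= t - s <= T].
Proof.
move=> /andP[s0 se]; case/andP: tT => et tT'.
have Os : Om (Y s) by rewrite /Y clampE ?(ltW s0) ?(ltW se)//; apply: XOm; rewrite s0 ltW.
by split => //; [exact: subset_closure|apply/andP; split; lra].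
Qed.

(** At a common point of differentiability the growth bounds of all linear functionals pass to
    [(d, k)], and separation then yields a control. *)
Let inclusion s d k : 0 < s < eta -> dder Y s d -> dder M s k ->
  exists a, mismatch b l (Y s) (t - s) d k a = 0.
Proof.
move=> se dY dM; have [Os cs ts] := YOm se.
have [|a [ba la]] := drift_cost_separation HC1 HC2 HC3 a0 (y := d) (k := k) cs ts.
  move=> q kap sig Hsig; apply/ler_addgt0Pr => e e0.
  have e20 : 0 < e / 2 by rewrite divr_gt0.
  have Ys : Y s = X s by rewrite /Y clampE//; case/andP: se => ? ?; rewrite !ltW.
  rewrite Ys in Hsig; have [r r0 Hr] := limit_inclusion_growth se Hsig e20.
  have [r' r'0 Hr'] := dderD (dder_dot q dY) (dderZ kap dM) e20.
  case/andP: (se) => s0 s1.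
  pose m := Num.min (Num.min r r') (eta - s).
  have m0 : 0 < m by rewrite !lt_min r0 r'0 subr_gt0.
  have [h h0 hm] : exists2 h, 0 < h & h < m by exists (m / 2); lra.
  move: hm; rewrite !lt_min => /andP[/andP[hr hr'] hs].
  have := Hr h; rewrite h0 hr => /(_ isT) k1.
  have := Hr' h; rewrite gtr0_norm// => /(_ hr') /ler_normlP[_].
  rewrite /Y /M (clampE (s := s)) ?(ltW s0) ?(ltW s1)// (clampE (s := s + h)); last first.
    by apply/andP; split; lra.
  rewrite dotBr in k1; set D := dot q d + kap *: k.
  rewrite -[h *: _]/(h * _) -[kap *: L (s + h)]/(kap * _) -[kap *: L s]/(kap * _) => k2.
  have : (sig - e / 2) * h <= (D + e / 2) * h by lra.
  by rewrite ler_pM2r//; lra.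
by exists a; rewrite /mismatch ba la !subrr dot0l expr0n addr0.
Qed.

(** Velocity and cost are realized by the same control because the set of pairs is convex, not just
    its projections. Hence the limit [L] of the accumulated costs is exactly the cost of the
    selected control. *)
Lemma one_sided_trajectory : exists (alpha : R -> A) (Z : R -> E),
  [/\ control eta alpha,
      [/\ [lipschitz Z s | s in [set` `[0, eta]]], Z 0 = X 0 &
          \forall s \ae mu, s \in `]0, eta[ -> is_derive s 1 Z (b (Z s) (t - s) (alpha s))],
      forall s, s \in `]0, eta] -> Om (Z s) &
      Z eta = X eta /\
      \int[mu]_(s in `[0, eta]) l (Z s) (t - s) (alpha s) = L eta - L 0].
Proof.
have [cA _ bM bL] := HC1; have [lU lM _ lL] := HC2.
have Hae : {ae mu, forall s, 0 < s < eta -> exists d k, dder Y s d /\ dder M s k}.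
  have YL' : enorm_lipon Mb 0 eta Y by move=> s s' _ _; exact: YL.
  have ML' : lipon Ml 0 eta M by move=> s s' _ _; exact: ML.
  apply: aeS (aeI (enorm_lipon_ae_dder YL') (lipschitz_ae_dder ML')) => s [H1 H2] se.
  by have [d Hd] := H1 se; have [k Hk] := H2 se; exists d, k.
case: Hae => B [mB B0 PB].
pose D : set R := `]0, eta[%classic `\` B.
have mI : measurable (`]0, eta[%classic : set (measurableTypeR R)) by exact: (measurable_itv `]0, eta[).
have mD : measurable (D : set (measurableTypeR R)) by exact: measurableD.
have DI s : D s -> 0 < s < eta by case; rewrite /= in_itv.
have /choice[dk Hdk] : forall s, exists dk : E * R, D s -> dder Y s dk.1 /\ dder M s dk.2.
  move=> s; have [[Is Bs]|] := pselect (D s); last by move=> ?; exists (0, 0).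
  have [d [k [Hd Hk]]] : exists d k, dder Y s d /\ dder M s k.
    apply: contrapT => nP; apply/Bs/PB => /= /(_ _)P; apply/nP/P.
    by move: Is; rewrite /= in_itv.
  by exists (d, k).
have Ycont i : continuous (fun s => Y s 0 i).
  apply: (lip_continuous (K := Mb)) => s s'; apply: le_trans (YL s s').
  by have := coord_le_enorm (Y s - Y s') i; rewrite !mxE.
have mdY i : measurable_fun (D : set (measurableTypeR R)) (fun s => (dk s).1 0 i).
  by apply: (measurable_dder (Ycont i)) => s /Hdk[H _]; exact: dder_coord.
have mdM : measurable_fun (D : set (measurableTypeR R)) (fun s => (dk s).2).
  by apply: (measurable_dder (lip_continuous ML)) => s /Hdk[].
pose K := `|Lb| * (Mb + 1) + 1.
have K0 : 0 < K by rewrite ltr_wpDl// mulr_ge0// addr_ge0.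
have rate s s' : enorm (Y s - Y s') + `|(t - s) - (t - s')| <= (Mb + 1) * `|s - s'|.
  have -> : t - s - (t - s') = - (s - s') by ring.
  by rewrite normrN mulrDl mul1r lerD2r; exact: YL.
have mb a i : measurable_fun (D : set (measurableTypeR R)) (fun s => b (Y s) (t - s) a 0 i).
  apply: (@measurable_comp_unif R A cA D (cst a) (fun s _ => b (Y s) (t - s) a 0 i) mD).
    move=> W _; have [aW|aW] := pselect (W a).
      by rewrite (_ : cst a @^-1` W = setT) ?setIT//; apply/seteqP; split.
    by rewrite (_ : cst a @^-1` W = set0) ?setI0//; apply/seteqP; split.
  move=> e e0; exists (e / K); first by rewrite divr_gt0.
  move=> s s' _ _ /DI se /DI se' ss _.
  have [_ cs ts] := YOm se; have [_ cs' ts'] := YOm se'.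
  have := coord_le_enorm (b (Y s) (t - s) a - b (Y s') (t - s') a) i; rewrite !mxE => h.
  apply: le_lt_trans h _; apply: le_lt_trans (bL _ _ _ _ _ _ _) _; try by split; rewrite //= in_itv.
  apply: (@le_lt_trans _ _ (K * `|s - s'|)); last by rewrite mulrC -ltr_pdivlMr.
  apply: (@le_trans _ _ (`|Lb| * ((Mb + 1) * `|s - s'|))).
    apply: le_trans (ler_wpM2r _ (ler_norm _)) _; first by rewrite addr_ge0 ?enorm_ge0.
    by rewrite ler_wpM2l.
  by rewrite mulrA ler_wpM2r// lerDl.
have Gl : forall e : R, 0 < e -> exists2 d : R, 0 < d & forall s s' a a', 0 < s < eta -> 0 < s' < eta ->
     `|s - s'| < d -> ball a d a' -> `|l (Y s) (t - s) a - l (Y s') (t - s') a'| < e.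
  move=> e /lU[d d0 Hd]; have Mb1 : 0 < Mb + 1 by rewrite ltr_wpDl.
  exists (Num.min d (d / (Mb + 1))); first by rewrite lt_min d0 divr_gt0.
  move=> s s' a a' se se'; rewrite lt_min => /andP[sd sM] aa.
  have [_ cs ts] := YOm se; have [_ cs' ts'] := YOm se'.
  apply: (Hd (Y s, t - s, a) (Y s', t - s', a')); try by split; rewrite //= in_itv.
  split => /=; last by apply: le_ball aa; rewrite ge_min lexx.
  split => /=.
    rewrite -ball_normE /=; apply: le_lt_trans (norm_le_enorm _) _; apply: le_lt_trans (YL _ _) _.
    move: sM; rewrite ltr_pdivlMr//; apply: le_lt_trans.
    by rewrite mulrC ler_wpM2l// lerDl.
  by rewrite /ball/= (_ : t - s - (t - s') = - (s - s')) ?normrN//; ring.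
have mF a : measurable_fun (D : set (measurableTypeR R))
    (fun s => mismatch b l (Y s) (t - s) (dk s).1 (dk s).2 a).
  apply: measurable_funD; last first.
    apply: measurable_funX; apply: measurable_funB => //.
    apply: (@measurable_comp_unif R A cA D (cst a) (fun s _ => l (Y s) (t - s) a) mD).
      move=> W _; have [aW|aW] := pselect (W a).
        by rewrite (_ : cst a @^-1` W = setT) ?setIT//; apply/seteqP; split.
      by rewrite (_ : cst a @^-1` W = set0) ?setI0//; apply/seteqP; split.
    move=> e /Gl[d d0 Hd]; exists d => // s s' _ _ /DI se /DI se' ss _.
    by apply: Hd => //; exact: ballxx.
  apply: measurable_sum => i.
  have -> : (fun s => (b (Y s) (t - s) a - (dk s).1) 0 i * (b (Y s) (t - s) a - (dk s).1) 0 i) =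
      (fun s => (b (Y s) (t - s) a 0 i - (dk s).1 0 i) ^+ 2).
    by apply/funext => s; rewrite !mxE expr2.
  by apply: measurable_funX; apply: measurable_funB.
have [c [mc Hc]] : exists c : R -> A, (forall W, open W -> measurable (D `&` c @^-1` W)) /\
    forall s, D s -> mismatch b l (Y s) (t - s) (dk s).1 (dk s).2 (c s) = 0.
  apply: (measurable_selection cA a0 mD mF).
  - by move=> s /DI se; have [_ cs ts] := YOm se; move=> a; exact: (mismatch_continuous HC1 HC2).
  - by move=> s a _; exact: mismatch_ge0.
  - by move=> s Ds; have [dY dM] := Hdk s Ds; apply: inclusion (DI _ Ds) dY dM.
(* The selection is Borel on [D] only; the constant [a0] on the remaining null set keeps [alpha]
   Borel on the whole interval. *)
pose alpha s := if pselect (D s) then c s else a0.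
have alphaD s : D s -> alpha s = c s by rewrite /alpha; case: pselect.
have alphaN s : ~ D s -> alpha s = a0 by rewrite /alpha; case: pselect.
have malpha : control eta alpha.
  move=> W oW; have -> : [set` `]0, eta[] `&` alpha @^-1` W =
      (D `&` c @^-1` W) `|` (if pselect (W a0) then [set` `]0, eta[] `\` D else set0).
    apply/seteqP; split => [s [Is Ws]|s].
      have [Ds|Ds] := pselect (D s); first by left; split => //; rewrite /= -alphaD.
      right; move: Ws; rewrite /= alphaN// => Wa.
      by case: pselect.
    case=> [[Ds Ws]|]; first by split; [case: Ds|rewrite /= alphaD].
    by case: pselect => // Wa [Is nD]; split => //; rewrite /= alphaN.
  apply: measurableU; first exact: mc.
  by case: (pselect (W a0)) => Wa /=; [exact: measurableD|exact: measurable0].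
have Hder s : D s -> dder Y s (b (Y s) (t - s) (alpha s)) /\ dder M s (l (Y s) (t - s) (alpha s)).
  move=> Ds; have [dY dM] := Hdk s Ds.
  by have [bE lE] := mismatch_eq0 (Hc s Ds); rewrite alphaD// bE lE.
have aeD : {ae mu, forall s, 0 < s < eta -> D s}.
  exists B; split => // s; apply: contra_notP => Bs sI.
  by split; [rewrite /= in_itv|exact: Bs].
exists alpha, Y; split => //.
- split.
  + apply: lip_lipschitz => s s'.
    exact: le_trans (norm_le_enorm _) (YL s s').
  + by rewrite /Y clampE// lexx ltW.
  + apply: aeS aeD => s Hs; rewrite in_itv/= => /Hs/Hder[dY _].
    exact/dderP.
- move=> s; rewrite in_itv/= => /andP[s0 se].
  by rewrite /Y clampE ?(ltW s0)//; apply: XOm; rewrite s0.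
split; first by rewrite /Y clampE// lexx ltW.
have mh : measurable_fun (`]0, eta[%classic : set (measurableTypeR R)) (fun s => l (Y s) (t - s) (alpha s)).
  apply: (@measurable_comp_unif R A cA _ alpha (fun s a => l (Y s) (t - s) a) mI malpha).
  move=> e /Gl[d d0 Hd]; exists d => // s s' a a'; rewrite /= !in_itv /=; exact: Hd.
have hM s : 0 < s < eta -> `|l (Y s) (t - s) (alpha s)| <= Ml.
  by move=> /YOm[_ cs ts]; apply: lM; split => //=; rewrite in_itv.
have [J0 JL Jd] := indefinite_integral eta0 mh hM.
have ML' : lipon Ml 0 eta M by move=> s s' _ _; exact: ML.
have := lipon_ae_eq JL ML' (ltW eta0).
rewrite J0 subr0 /M !clampE ?lexx ?(ltW eta0)//; apply.
apply: aeS (aeI Jd aeD) => s [H1 H2] se; exists (l (Y s) (t - s) (alpha s)); first exact: H1.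
by have [] := Hder s (H2 se).
Qed.

End one_sided_limit.

(** * Regular trajectories and the value function *)

Section lipschitz_intervals.
Context {R : realType} {V : normedModType R}.

Lemma lipschitz_lipon (X : R -> V) (a b : R) :
  [lipschitz X s | s in [set` `[a, b]]] -> exists L, lipon L a b X.
Proof.
rewrite /lipschitz_on => H; have [L HL] := filter_ex H; exists L => s s' sab sab'.
by apply: (HL (s, s')); split; rewrite /= in_itv.
Qed.

Lemma lipon_lipschitz (X : R -> V) (a b L : R) :
  lipon L a b X -> [lipschitz X s | s in [set` `[a, b]]].
Proof.
move=> H; rewrite /lipschitz_on; near=> k => -[s s'] [/=]; rewrite !in_itv/= => si si'.
by apply: le_trans (H _ _ si si') _; rewrite ler_wpM2r//.
Unshelve. all: by end_near. Qed.

End lipschitz_intervals.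

Lemma dder_translate {R : realType} {V : normedModType R} (F : R -> V) (s c : R) d :
  dder F (s + c) d -> dder (fun r => F (r + c)) s d.
Proof.
move=> H e e0; have [q q0 Hq] := H e e0; exists q => // h hq.
by have -> : s + h + c = s + c + h; [rewrite addrAC|exact: Hq].
Qed.

Section admissible.
Context {R : realType} {N : nat} {A1 A2 : metricType R}.
Local Notation E := 'rV[R]_N.
Local Notation mu := (@lebesgue_measure R).
Variables (Om1 Om2 H : set E) (n1 n2 : E -> E) (T : R).
Variables (b1 : E -> R -> A1 -> E) (b2 : E -> R -> A2 -> E).
Variables (l1 : E -> R -> A1 -> R) (l2 : E -> R -> A2 -> R).
Variables (Mb Lb Ml : R) (ml : R -> R) (g : E -> R).
Local Notation A12 := (A1 * A2 * R)%type.
Hypothesis hO : hyp_Omega Om1 Om2 H.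
Hypotheses (HC11 : hyp_C1 T Om1 b1 Mb Lb) (HC12 : hyp_C1 T Om2 b2 Mb Lb).
Hypotheses (HC21 : hyp_C2 T Om1 l1 Ml ml) (HC22 : hyp_C2 T Om2 l2 Ml ml).
Local Notation dyn := (dynamics Om1 Om2 H b1 b2).
Local Notation cost := (running_cost Om1 Om2 H l1 l2).
Local Notation V := (Uplus Om1 Om2 H n1 n2 b1 b2 l1 l2 g).
Local Notation Tr := (Treg Om1 Om2 H n1 n2 b1 b2).
Implicit Types (z y : E) (s r : R) (a : A12).

Lemma side1_indic z : Om1 z -> [/\ \1_Om1 z = 1 :> R, \1_Om2 z = 0 :> R & \1_H z = 0 :> R].
Proof.
move=> Oz; rewrite !indicE mem_set// !memNset //.
  by move=> /(interface_notin1 hO).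
exact: disjoint12 hO _ Oz.
Qed.

Lemma side2_indic z : Om2 z -> [/\ \1_Om1 z = 0 :> R, \1_Om2 z = 1 :> R & \1_H z = 0 :> R].
Proof.
move=> Oz; rewrite !indicE (mem_set Oz) !memNset //.
  by move=> /(interface_notin2 hO).
by move=> Oz1; exact: disjoint12 hO _ Oz1 Oz.
Qed.

Lemma interface_indic z : H z -> [/\ \1_Om1 z = 0 :> R, \1_Om2 z = 0 :> R & \1_H z = 1 :> R].
Proof.
move=> Hz; rewrite !indicE (mem_set Hz) !memNset //.
  exact: interface_notin2 hO _ Hz.
exact: interface_notin1 hO _ Hz.
Qed.

Lemma dynamics1 z s a : Om1 z -> dyn z s a = b1 z s a.1.1.
Proof. by case/side1_indic => h1 h2 h3; rewrite /dynamics h1 h2 h3 !scale0r !addr0 scale1r. Qed.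

Lemma dynamics2 z s a : Om2 z -> dyn z s a = b2 z s a.1.2.
Proof. by case/side2_indic => h1 h2 h3; rewrite /dynamics h1 h2 h3 !scale0r add0r addr0 scale1r. Qed.

Lemma dynamicsH z s a : H z -> dyn z s a = bH b1 b2 z s a.
Proof. by case/interface_indic => h1 h2 h3; rewrite /dynamics h1 h2 h3 !scale0r !add0r scale1r. Qed.

Lemma cost1 z s a : Om1 z -> cost z s a = l1 z s a.1.1.
Proof. by case/side1_indic => h1 h2 h3; rewrite /running_cost h1 h2 h3 !mul0r !addr0 mul1r. Qed.

Lemma cost2 z s a : Om2 z -> cost z s a = l2 z s a.1.2.
Proof. by case/side2_indic => h1 h2 h3; rewrite /running_cost h1 h2 h3 !mul0r add0r addr0 mul1r. Qed.

Lemma costH z s a : H z -> cost z s a = lH l1 l2 z s a.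
Proof. by case/interface_indic => h1 h2 h3; rewrite /running_cost h1 h2 h3 !mul0r !add0r mul1r. Qed.

Lemma closure_sides z : [/\ Om1 z -> closure Om1 z, Om2 z -> closure Om2 z &
  H z -> closure Om1 z /\ closure Om2 z].
Proof.
split; [exact: subset_closure|exact: subset_closure|] => Hz.
by split; [apply/(closure_side1 hO)|apply/(closure_side2 hO)]; right.
Qed.

Lemma enorm_dynamics z s a : 0 <= s <= T -> ctrl_set a -> enorm (dyn z s a) <= Mb.
Proof.
move=> sT /andP[m0 m1]; have [_ _ B1 _] := HC11; have [_ _ B2 _] := HC12.
have [c1 c2 cH] := closure_sides z.
case: (interface_cases hO z) => Oz.
- by rewrite dynamics1//; apply: B1; split; [exact: c1|rewrite /= in_itv].
- by rewrite dynamics2//; apply: B2; split; [exact: c2|rewrite /= in_itv].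
have [d1 d2] := cH Oz; rewrite dynamicsH//; apply: le_trans (enormD _ _) _.
rewrite !enormZ !ger0_norm ?subr_ge0//.
have h1 : enorm (b1 z s a.1.1) <= Mb by apply: B1; split; rewrite //= in_itv.
have h2 : enorm (b2 z s a.1.2) <= Mb by apply: B2; split; rewrite //= in_itv.
have h3 : a.2 * enorm (b1 z s a.1.1) <= a.2 * Mb by rewrite ler_wpM2l.
have h4 : (1 - a.2) * enorm (b2 z s a.1.2) <= (1 - a.2) * Mb by rewrite ler_wpM2l ?subr_ge0.
lra.
Qed.

Lemma norm_cost z s a : 0 <= s <= T -> ctrl_set a -> `|cost z s a| <= Ml.
Proof.
move=> sT /andP[m0 m1]; have [_ B1 _ _] := HC21; have [_ B2 _ _] := HC22.
have [c1 c2 cH] := closure_sides z.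
case: (interface_cases hO z) => Oz.
- by rewrite cost1//; apply: B1; split; [exact: c1|rewrite /= in_itv].
- by rewrite cost2//; apply: B2; split; [exact: c2|rewrite /= in_itv].
have [d1 d2] := cH Oz; rewrite costH//; apply: le_trans (ler_normD _ _) _.
have m1' : 0 <= 1 - a.2 by rewrite subr_ge0.
rewrite !normrM (ger0_norm m0) (ger0_norm m1').
have h1 : `|l1 z s a.1.1| <= Ml by apply: B1; split; rewrite //= in_itv.
have h2 : `|l2 z s a.1.2| <= Ml by apply: B2; split; rewrite //= in_itv.
have h3 : a.2 * `|l1 z s a.1.1| <= a.2 * Ml by rewrite ler_wpM2l.
have h4 : (1 - a.2) * `|l2 z s a.1.2| <= (1 - a.2) * Ml by rewrite ler_wpM2l ?subr_ge0.
lra.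
Qed.

Let measurable_side (A : metricType R) (Om : set E) (l : E -> R -> A -> R) (cA : compact [set: A])
    (lU : forall e, 0 < e -> exists2 d, 0 < d & forall p q : E * R * A, ctrl_domain T Om p ->
       ctrl_domain T Om q -> ball p d q -> `|l p.1.1 p.1.2 p.2 - l q.1.1 q.1.2 q.2| < e)
    (D : set R) (K tau : R) (X : R -> E) (c : R -> A) : measurable D -> 0 <= K ->
  (forall s s', D s -> D s' -> enorm (X s - X s') <= K * `|s - s'|) ->
  (forall s, D s -> closure Om (X s) /\ 0 <= tau - s <= T) ->
  (forall W, open W -> measurable (D `&` c @^-1` W)) ->
  measurable_fun D (fun s => l (X s) (tau - s) (c s)).
Proof.
move=> mD K0 XK Dcl mc; apply: (@measurable_comp_unif R A cA D c (fun s al => l (X s) (tau - s) al) mD mc).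
move=> e /lU[d d0 Hd]; have K1 : 0 < K + 1 by rewrite ltr_wpDl.
exists (Num.min d (d / (K + 1))); first by rewrite lt_min d0 divr_gt0.
move=> s s' al al' Ds Ds'; rewrite lt_min => /andP[sd sM] aa.
have [cs ts] := Dcl _ Ds; have [cs' ts'] := Dcl _ Ds'.
apply: (Hd (X s, tau - s, al) (X s', tau - s', al')); try by split; rewrite //= in_itv.
split => /=; last by apply: le_ball aa; rewrite ge_min lexx.
split => /=.
  rewrite -ball_normE /=; apply: le_lt_trans (norm_le_enorm _) _; apply: le_lt_trans (XK _ _ Ds Ds') _.
  move: sM; rewrite ltr_pdivlMr//; apply: le_lt_trans.
  by rewrite mulrC ler_wpM2l// lerDl.
by rewrite /ball/= (_ : tau - s - (tau - s') = - (s - s')) ?normrN//; ring.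
Qed.

Lemma measurable_cost (tau K : R) (X : R -> E) (c : R -> A12) : 0 <= tau <= T -> 0 <= K ->
  enorm_lipon K 0 tau X -> control tau c ->
  measurable_fun (`]0, tau[%classic : set R) (fun s => cost (X s) (tau - s) (c s)).
Proof.
move=> /andP[tau0 tauT] K0 XK mc.
have [cA1 _ _ _] := HC11; have [cA2 _ _ _] := HC12; have [lU1 _ _ _] := HC21; have [lU2 _ _ _] := HC22.
pose I : set R := `]0, tau[%classic.
have mI : measurable I by exact: (measurable_itv `]0, tau[).
have II s : I s -> 0 <= s <= tau by rewrite /I /= in_itv/= => /andP[? ?]; rewrite !ltW.
pose Y s := X (clamp tau s).
have YX s : I s -> Y s = X s by move=> /II si; rewrite /Y clampE.
have cY : continuous Y.
  move=> s B /nbhs_ballP[e /= e0 HB]; have K1 : 0 < K + 1 by rewrite ltr_wpDl.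
  apply/nbhs_ballP; exists (e / (K + 1)) => /=; first by rewrite divr_gt0.
  move=> s'; rewrite /ball/= ltr_pdivlMr// => ss; apply: HB; rewrite -ball_normE /=.
  apply: le_lt_trans (norm_le_enorm _) _.
  apply: le_lt_trans (XK _ _ (clamp_in s tau0) (clamp_in s' tau0)) _.
  apply: le_lt_trans ss; apply: (@le_trans _ _ (K * `|s - s'|)).
    by rewrite ler_wpM2l// clamp_dist.
  by rewrite mulrC ler_wpM2l// lerDl.
pose D1 : set R := I `&` Y @^-1` Om1.
pose D2 : set R := I `&` Y @^-1` Om2.
pose D3 : set R := I `&` Y @^-1` H.
have [_ [oO1 oO2 _] _ _ _] := hO.
have mD1 : measurable D1.
  by apply: measurableI => //; apply: open_measurable; apply: open_comp => // s _; exact: cY.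
have mD2 : measurable D2.
  by apply: measurableI => //; apply: open_measurable; apply: open_comp => // s _; exact: cY.
have mD3 : measurable D3.
  apply: measurableI => //; apply: closed_measurable; apply: closed_comp => [s _|]; first exact: cY.
  exact: (closed_interface hO).
have DU : I = (D1 `|` D2) `|` D3.
  rewrite /D1 /D2 /D3 -!setIUr; apply/seteqP; split => [s Is|s [//]]; split => //.
  by case: (interface_cases hO (Y s)) => h; [left; left|left; right|right].
have XD D s s' : D `<=` I -> D s -> D s' -> enorm (X s - X s') <= K * `|s - s'|.
  by move=> DI /DI/II si /DI/II si'; exact: XK.
have tsT s : I s -> 0 <= tau - s <= T.
  by move=> /II /andP[? ?]; apply/andP; split; lra.
have mcI (D : set R) (B : topologicalType) (f : A12 -> B) :
    D `<=` I -> measurable D -> continuous f ->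
    forall W, open W -> measurable (D `&` (f \o c) @^-1` W).
  move=> DI mD cf W oW.
  have -> : D `&` (f \o c) @^-1` W = D `&` (I `&` c @^-1` (f @^-1` W)).
    by rewrite setIA (setIidl DI).
  by apply: measurableI => //; apply: mc; apply: open_comp => // y _; exact: cf.
have c11 : continuous (fun a : A12 => a.1.1) by move=> a; apply: cvg_comp; [exact: cvg_fst|exact: cvg_fst].
have c12 : continuous (fun a : A12 => a.1.2) by move=> a; apply: cvg_comp; [exact: cvg_fst|exact: cvg_snd].
have c2 : continuous (fun a : A12 => a.2) by move=> a; exact: cvg_snd.
have [s1 s2 s3] : [/\ D1 `<=` I, D2 `<=` I & D3 `<=` I] by split => s [].
have m1 (D : set R) : D `<=` I -> measurable D -> (forall s, D s -> closure Om1 (Y s)) ->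
    measurable_fun D (fun s => l1 (X s) (tau - s) (c s).1.1).
  move=> DI mD Dc; apply: (measurable_side cA1 lU1 (K := K)) => //.
  - by move=> s s'; exact: XD.
  - by move=> s Ds; rewrite -YX; [split; [exact: Dc|exact/tsT/DI]|exact: DI].
  - exact: (mcI D _ _ DI mD c11).
have m2 (D : set R) : D `<=` I -> measurable D -> (forall s, D s -> closure Om2 (Y s)) ->
    measurable_fun D (fun s => l2 (X s) (tau - s) (c s).1.2).
  move=> DI mD Dc; apply: (measurable_side cA2 lU2 (K := K)) => //.
  - by move=> s s'; exact: XD.
  - by move=> s Ds; rewrite -YX; [split; [exact: Dc|exact/tsT/DI]|exact: DI].
  - exact: (mcI D _ _ DI mD c12).
have m3 : measurable_fun D3 (fun s => (c s).2).
  move=> _; apply: (measurability _ (RGenOpens.measurableE R)) => //.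
  move=> _ [_ [p [q ->] <-]]; apply: (mcI D3 _ _ s3 mD3 c2); exact: interval_open.
rewrite -/I DU; apply/measurable_funU; [exact: measurableU|exact: mD3|split].
  apply/measurable_funU => //; split.
  - apply: (@eq_measurable_fun _ _ _ _ _ (fun s => l1 (X s) (tau - s) (c s).1.1)).
      by move=> s /set_mem[/YX YXs]; rewrite /= YXs => Os; rewrite cost1.
    by apply: m1 => // s [_ Os]; have [+ _ _] := closure_sides (Y s); exact.
  - apply: (@eq_measurable_fun _ _ _ _ _ (fun s => l2 (X s) (tau - s) (c s).1.2)).
      by move=> s /set_mem[/YX YXs]; rewrite /= YXs => Os; rewrite cost2.
    by apply: m2 => // s [_ Os]; have [_ + _] := closure_sides (Y s); exact.
apply: (@eq_measurable_fun _ _ _ _ _ (fun s => lH l1 l2 (X s) (tau - s) (c s))).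
  by move=> s /set_mem[/YX YXs]; rewrite /= YXs => Os; rewrite costH.
have cl s : D3 s -> closure Om1 (Y s) /\ closure Om2 (Y s).
  by move=> [_ Os]; have [_ _ ] := closure_sides (Y s); exact.
apply: measurable_funD; apply: measurable_funM => //.
- by apply: m1 => // s /cl[].
- by apply: measurable_funB => //; exact: measurable_cst.
- by apply: m2 => // s /cl[].
Qed.

Hypothesis Mb0 : 0 <= Mb.

Section trajectory.
Variables (y : E) (tau : R) (X : R -> E) (c : R -> A12).
Hypothesis tauT : 0 < tau <= T.
Hypothesis XcT : Tr y tau (X, c).
Local Notation cost_at := (fun s : R => cost (X s) (tau - s) (c s)).

Definition cost_upto (s : R) := \int[mu]_(r in `[0, s]) cost_at r.
Local Notation J := cost_upto.

Lemma treg_lipschitz : enorm_lipon Mb 0 tau X.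
Proof.
case/andP: tauT => tau0 tauT'; case: XcT => -[/lipschitz_lipon[L XL] _] [_ cs] Hae _.
apply: (enorm_lipon_ae XL Mb0); apply: aeS Hae => s Hs se.
have sI : s \in `]0, tau[ by rewrite in_itv.
have := Hs sI => /dderP dX; exists (dyn (X s) (tau - s) (c s)) => //.
apply: enorm_dynamics; last exact: cs.
by case/andP: se => ? ?; apply/andP; split; lra.
Qed.

Lemma treg_cost_bound s : 0 < s < tau -> `|cost_at s| <= Ml.
Proof.
case/andP: tauT => tau0 tauT'; case: XcT => _ [_ cs] _ _ se.
apply: norm_cost; last by apply: cs; rewrite in_itv.
by case/andP: se => ? ?; apply/andP; split; lra.
Qed.

Lemma treg_measurable_cost : measurable_fun (`]0, tau[%classic : set R) cost_at.
Proof.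
case/andP: tauT => tau0 tauT'; case: XcT => _ [mc _] _ _.
by apply: (measurable_cost _ Mb0 treg_lipschitz mc); rewrite (ltW tau0).
Qed.

Lemma treg_cost_upto : [/\ J 0 = 0, lipon Ml 0 tau J &
  {ae mu, forall s, 0 < s < tau -> dder J s (cost_at s)}].
Proof.
case/andP: tauT => tau0 _.
exact: (indefinite_integral tau0 treg_measurable_cost treg_cost_bound).
Qed.

(** The measurable control is forgotten here: a control at almost every time, together with the cost
    [J] as a second Lipschitz function, is the form in which trajectories enter the limit
    arguments. *)
Lemma treg_dynamics : {ae mu, forall s, 0 < s < tau -> exists a,
  [/\ ctrl_set a, dder X s (dyn (X s) (tau - s) a), dder J s (cost (X s) (tau - s) a) &
      H (X s) -> A0reg n1 n2 b1 b2 (X s) (tau - s) a]}.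
Proof.
have [_ _ HJ] := treg_cost_upto; case: XcT => _ [_ cs] Hae HA.
apply: aeS (aeI HJ (aeI Hae HA)) => s [H1 [H2 H3]] se; exists (c s).
have sI : s \in `]0, tau[ by rewrite in_itv.
by split; [exact: cs|exact/dderP/H2|exact: H1|exact: H3].
Qed.

Lemma total_cost_ge (Mg : R) : (forall z, `|g z| <= Mg) ->
  - (Ml * tau + Mg) <= total_cost Om1 Om2 H l1 l2 g tau (X, c).
Proof.
move=> gM; have [J0 JL _] := treg_cost_upto; case/andP: tauT => tau0 _.
have := JL tau 0; rewrite !lexx (ltW tau0) => /(_ isT isT); rewrite J0 !subr0 (gtr0_norm tau0).
rewrite /total_cost /= -/(J tau) => /ler_normlP[h1 _]; have /ler_normlP[h2 _] := gM (X tau).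
lra.
Qed.

(** The trajectory restarted at time [s] is admissible for the horizon [tau - s], and the uniqueness
    of primitives identifies its cost with the rest of the original one. *)
Lemma treg_tail s : 0 <= s < tau ->
  (V (X s) (tau - s) <= (total_cost Om1 Om2 H l1 l2 g tau (X, c) - J s)%:E)%E.
Proof.
move=> /andP[s0 st]; case/andP: tauT => tau0 tauT'.
have XL := treg_lipschitz; have [J0 JL HJ] := treg_cost_upto.
case: (XcT) => _ [mc cs] Hae HA.
pose X' r := X (r + s); pose c' r := c (r + s).
have I' r : 0 < r < tau - s -> 0 < r + s < tau by move=> /andP[? ?]; apply/andP; split; lra.
have T' r : tau - s - r = tau - (r + s) by ring.
have X'L : enorm_lipon Mb 0 (tau - s) X'.
  move=> r r' /andP[? ?] /andP[? ?]; rewrite (_ : r - r' = r + s - (r' + s)); last ring.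
  by apply: XL; apply/andP; split; lra.
have XcT' : Tr (X s) (tau - s) (X', c').
  split.
  - split; last by rewrite /X' add0r.
    exact: lipon_lipschitz (enorm_lipon_norm X'L).
  - split; last first.
      by move=> r; rewrite in_itv/= => /I' h; apply: cs; rewrite in_itv.
    move=> W oW; have -> : [set` `]0, tau - s[] `&` c' @^-1` W =
        [set` `]0, tau - s[] `&` (fun r : R => r + s) @^-1` ([set` `]0, tau[] `&` c @^-1` W).
      apply/seteqP; split => r [/=]; rewrite !in_itv/= => rI; first by split => //; split => //; exact: I'.
      by case.
    have mI : measurable (`]0, tau - s[%classic : set (measurableTypeR R)) by exact: (measurable_itv `]0, tau - s[).
    have mf : measurable_fun [set: measurableTypeR R] (fun r : measurableTypeR R => r + s : measurableTypeR R).
      by apply: continuous_measurable_fun => r; apply: cvgD; [exact: cvg_id|exact: cvg_cst].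
    apply: measurableI => //; rewrite -[X in measurable X]setTI; apply: mf => //; exact: mc.
  - apply: aeS (ae_translate s Hae) => r Hr; rewrite in_itv/= => /I' h.
    have /dderP dX : is_derive (r + s) 1 X (dyn (X (r + s)) (tau - (r + s)) (c (r + s))).
      by apply: Hr; rewrite in_itv.
    by apply/dderP; rewrite T'; exact: (dder_translate dX).
  - apply: aeS (ae_translate s HA) => r Hr; rewrite in_itv/= => /I' h Hh.
    by rewrite T'; apply: Hr => //; rewrite in_itv.
have ts : 0 < tau - s <= T by apply/andP; split; lra.
apply: ereal_inf_lbound; exists (X', c') => //; congr EFin.
rewrite /total_cost /= {2}/X' subrK -/(J tau).
suff -> : \int[mu]_(r in `[0, tau - s]) cost (X' r) (tau - s - r) (c' r) = J tau - J s by ring.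
pose h r := cost (X' r) (tau - s - r) (c' r).
have mh : measurable_fun (`]0, tau - s[%classic : set R) h.
  apply: (measurable_cost _ Mb0 X'L); first by apply/andP; split; lra.
  by case: XcT' => _ [].
have hM r : 0 < r < tau - s -> `|h r| <= Ml.
  by move=> /I' rI; rewrite /h T'; exact: treg_cost_bound.
have ts0 : 0 < tau - s by lra.
have [K0 KL HK] := indefinite_integral ts0 mh hM.
have JL' : lipon Ml 0 (tau - s) (fun r => J (r + s)).
  move=> r r' /andP[u1 u2] /andP[u3 u4]; rewrite (_ : r - r' = r + s - (r' + s)); last ring.
  by apply: JL; rewrite addr_ge0//= -lerBrDr.
have := lipon_ae_eq KL JL' (ltW ts0); rewrite K0 subr0 subrK add0r; apply.
apply: aeS (aeI HK (ae_translate s HJ)) => r [H1 H2] rI; exists (h r); first exact: H1.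
by rewrite /h T'; exact: (dder_translate (H2 (I' _ rI))).
Qed.

End trajectory.

(** With horizon 0 the conditions range over an empty interval, so that a constant trajectory is
    admissible with any control [a]. *)
Lemma uplus_initial (a : A12) z : (V z 0 <= (g z)%:E)%E.
Proof.
have E0 : [set` `]0, 0[] = set0 :> set R.
  by apply/seteqP; split => // r; rewrite /= in_itv/= => /andP[r0 /(lt_trans r0)]; rewrite ltxx.
apply: ereal_inf_lbound; exists (cst z, cst a) => /=.
  split; [split => //; apply: (lipon_lipschitz (L := 0))| |apply: aeW|apply: aeW].
  - by move=> s s' _ _; rewrite subrr normr0 mul0r.
  - split; first by move=> W _; rewrite E0 set0I; exact: measurable0.
    by move=> s; rewrite in_itv/= => /andP[r0 /(lt_trans r0)]; rewrite ltxx.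
  - by move=> s; rewrite in_itv/= => /andP[r0 /(lt_trans r0)]; rewrite ltxx.
  - by move=> s; rewrite in_itv/= => /andP[r0 /(lt_trans r0)]; rewrite ltxx.
rewrite /total_cost /=; congr EFin; rewrite set_itv1 /Rintegral integral_set1 ?add0r//.
Qed.

End admissible.

(** * Limits along an ultrafilter *)

Section ultrafilter_limits.
Context {R : realType}.

(** The limit is the supremum of the levels that [f] exceeds on a set of the filter; at a slightly
    higher level the ultrafilter must contain the complement. *)
Lemma ultra_bounded_limit (F : set_system nat) (f : nat -> R) (M : R) : UltraFilter F ->
  (forall n, `|f n| <= M) -> exists l : R, forall e : R, 0 < e -> F [set n | `|f n - l| < e].
Proof.
move=> UF fM; pose S : set R := [set a | F [set n | a <= f n]].
have SM : S (- M).
  by apply: filterE => n /=; have /ler_normlP[h _] := fM n; lra.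
have ubS : has_ubound S.
  exists M => a Sa; have [n /= an] := filter_ex Sa.
  by apply: le_trans an _; apply: le_trans (ler_norm _) (fM n).
have hS : has_sup S by split => //; exists (- M).
exists (sup S) => e e0; have [a Sa ae] := sup_adherent e0 hS.
have [Fl|Fu] := in_ultra_setVsetC [set n | sup S + e <= f n] UF.
  have : sup S + e <= sup S by apply: ub_le_sup.
  by rewrite gerDl leNgt e0.
apply: filterS (filterI Sa Fu) => n /= [an /negP]; rewrite -ltNge => fn.
rewrite ltr_norml; apply/andP; split; lra.
Qed.

Lemma ultra_bounded_row_limit {N : nat} (F : set_system nat) (X : nat -> 'rV[R]_N) (M : R) :
  UltraFilter F -> (forall n, enorm (X n) <= M) ->
  exists l, forall e : R, 0 < e -> F [set n | enorm (X n - l) < e].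
Proof.
move=> UF XM; have /choice[l Hl] : forall i, exists l : R, forall e : R, 0 < e ->
    F [set n | `|X n 0 i - l| < e].
  move=> i; apply: (ultra_bounded_limit (M := M) UF) => n.
  exact: le_trans (coord_le_enorm _ i) (XM n).
exists (\row_i l i) => e e0; have N1 : 0 < (N%:R + 1 : R) by rewrite ltr_wpDl.
have : \forall n \near F, forall i, `|X n 0 i - l i| < e / (N%:R + 1).
  by apply: filter_forall => i; apply: Hl; rewrite divr_gt0.
apply: filterS => n Hn /=; apply: le_lt_trans (enorm_le_sum _) _.
apply: (@le_lt_trans _ _ (\sum_(i < N) e / (N%:R + 1))).
  by apply: ler_sum => i _; rewrite !mxE ltW.
rewrite sumr_const card_ord -[ltLHS]mulr_natl mulrA ltr_pdivrMr// mulrC mulrDr mulr1.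
by rewrite ltrDl.
Qed.

End ultrafilter_limits.

Section envelope.
Context {R : realType} {N : nat}.
Local Notation E := 'rV[R]_N.
Variables (V : E -> R -> \bar R) (T : R).
Local Notation U z s := (limf_einf (fun q : E * R => V q.1 q.2)
  (within [set q | q.2 \in `[0, T[] (nbhs (z, s)))).

Lemma envelope_le (z : E) (s : R) v :
  (forall e : R, 0 < e -> exists z' s', [/\ enorm (z' - z) < e, `|s' - s| < e, 0 <= s' < T &
     (V z' s' <= v)%E]) -> (U z s <= v)%E.
Proof.
move=> H; rewrite limf_einfE; apply: ge_ereal_sup => _ [B /nbhs_ballP[e /= e0 HB] <-].
have [z' [s' [ze se sT Vv]]] := H e e0; apply: le_trans Vv.
apply: ereal_inf_lbound; exists (z', s') => //; apply: HB; last by rewrite /= in_itv.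
rewrite prod_norm_ball /= prod_normE/= gt_max [`|s - s'|]distrC se andbT distrC.
exact: le_lt_trans (norm_le_enorm _) ze.
Qed.

Lemma envelope_approx (z : E) (s : R) v : (U z s < v)%E -> forall e : R, 0 < e ->
  exists z' s', [/\ enorm (z' - z) < e, `|s' - s| < e, 0 <= s' < T & (V z' s' < v)%E].
Proof.
move=> Uv e e0; pose B : set (E * R) := [set q | [/\ enorm (q.1 - z) < e, `|q.2 - s| < e & 0 <= q.2 < T]].
have : (ereal_inf [set V q.1 q.2 | q in B] < v)%E.
  apply: le_lt_trans Uv; rewrite limf_einfE; apply: ereal_sup_ubound.
  exists B => //; have [d d0 Hd] := near_enorm z e0.
  apply/nbhs_ballP; exists (Num.min d e) => /=; first by rewrite lt_min d0.
  move=> [z' s']; rewrite prod_norm_ball /= prod_normE/= gt_max !lt_min => /andP[/andP[z1 _] /andP[_ s1]].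
  rewrite in_itv/= => sT; split => //=; last by rewrite distrC.
  by rewrite enorm_distC; exact: Hd.
by move=> /ereal_inf_lt[_ [[z' s'] [/= h1 h2 h3] <-] h4]; exists z', s'.
Qed.

End envelope.

Section near_optimal.
Context {R : realType} {N : nat} {A1 A2 : metricType R}.
Local Notation E := 'rV[R]_N.
Local Notation mu := (@lebesgue_measure R).
Variables (Om1 Om2 H : set E) (n1 n2 : E -> E) (T : R).
Variables (b1 : E -> R -> A1 -> E) (b2 : E -> R -> A2 -> E).
Variables (l1 : E -> R -> A1 -> R) (l2 : E -> R -> A2 -> R).
Variables (Mb Lb Ml Mg : R) (ml : R -> R) (g : E -> R).
Local Notation A12 := (A1 * A2 * R)%type.
Hypothesis hO : hyp_Omega Om1 Om2 H.
Hypotheses (HC11 : hyp_C1 T Om1 b1 Mb Lb) (HC12 : hyp_C1 T Om2 b2 Mb Lb).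
Hypotheses (HC21 : hyp_C2 T Om1 l1 Ml ml) (HC22 : hyp_C2 T Om2 l2 Ml ml).
Hypotheses (Mb0 : 0 <= Mb) (Ml0 : 0 <= Ml) (gM : forall z, `|g z| <= Mg).
Local Notation dyn := (dynamics Om1 Om2 H b1 b2).
Local Notation cost := (running_cost Om1 Om2 H l1 l2).
Local Notation V := (Uplus Om1 Om2 H n1 n2 b1 b2 l1 l2 g).
Local Notation U := (Uplus_lsc Om1 Om2 H n1 n2 b1 b2 l1 l2 T g).
Variables (x : E) (t : R).
Hypothesis tT : 0 < t < T.

Lemma uplus_lsc_gtNy : (-oo < U x t)%E.
Proof.
case/andP: tT => t0 tT'; rewrite ltNge; apply/negP => UNy.
have Ul : (U x t < (- (Ml * T + Mg))%:E)%E by apply: le_lt_trans UNy _; exact: ltNyr.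
have [y [tau [_ tt /andP[_ tauT] /ereal_inf_lt[_ [[X c] XcT <-]]]]] := envelope_approx Ul t0.
rewrite lte_fin; move: tt; rewrite ltr_norml => /andP[tt _].
have tau0 : 0 < tau <= T by apply/andP; split; lra.
have := total_cost_ge hO HC11 HC12 HC21 HC22 Mb0 tau0 XcT gM.
have : Ml * tau <= Ml * T by rewrite ler_wpM2l// ltW.
lra.
Qed.

Variable u : R.
Hypothesis Uu : U x t = u%:E.

(** A single ultrafilter provides limits at all times at once, with no extraction of subsequences.
    The interval [[0, t / 2]] is common to all trajectories since [|tn n - t| < t / 2]. *)
Lemma near_optimal_limit : exists (F : set_system nat) (Xn : nat -> R -> E)
    (Ln : nat -> R -> R) (tn : nat -> R) (X : R -> E) (L : R -> R),
  [/\ ProperFilter F,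
    [/\ forall n, enorm_lipon Mb 0 (t / 2) (Xn n), forall n, lipon Ml 0 (t / 2) (Ln n) &
        forall n, t / 2 <= tn n <= T],
    [/\ forall e : R, 0 < e -> F [set n | `|tn n - t| < e],
        forall s : R, 0 <= s <= t / 2 -> forall e : R, 0 < e -> F [set n | enorm (Xn n s - X s) < e],
        forall s : R, 0 <= s <= t / 2 -> forall e : R, 0 < e -> F [set n | `|Ln n s - L s| < e],
        X 0 = x & L 0 = 0],
    forall n, {ae mu, forall s, 0 < s < t / 2 -> exists a,
      [/\ ctrl_set a, dder (Xn n) s (dyn (Xn n s) (tn n - s) a),
          dder (Ln n) s (cost (Xn n s) (tn n - s) a) &
          H (Xn n s) -> A0reg n1 n2 b1 b2 (Xn n s) (tn n - s) a]} &
    forall s : R, 0 <= s <= t / 2 -> (U (X s) (t - s) <= (u - L s)%:E)%E].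
Proof.
case/andP: tT => t0 tT'; pose r (n : nat) := n.+1%:R^-1 : R.
have r0 n : 0 < r n by rewrite invr_gt0.
have rsmall e : 0 < e -> \forall n \near \oo, r n < e.
  by move=> e0; exact: (near_infty_natSinv_lt (PosNum e0)).
have /choice[w Hw] : forall n, exists w : E * R * ((R -> E) * (R -> A12)),
    [/\ enorm (w.1.1 - x) < r n, `|w.1.2 - t| < Num.min (r n) (t / 2), 0 <= w.1.2 < T,
        Treg Om1 Om2 H n1 n2 b1 b2 w.1.1 w.1.2 w.2 & total_cost Om1 Om2 H l1 l2 g w.1.2 w.2 < u + r n].
  move=> n; have Ul : (U x t < (u + r n)%:E)%E by rewrite Uu lte_fin ltrDl.
  have m0 : 0 < Num.min (r n) (t / 2) by rewrite lt_min r0 divr_gt0.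
  have [y [tau [yx tt tauT /ereal_inf_lt[_ [[X c] XcT <-]]]]] := envelope_approx Ul m0.
  rewrite lte_fin => tc; exists (y, tau, (X, c)); split => //.
  by move: yx; rewrite lt_min => /andP[].
pose tn n := (w n).1.2; pose Xn n := (w n).2.1; pose c n := (w n).2.2.
pose Ln n := cost_upto Om1 Om2 H l1 l2 (tn n) (Xn n) (c n).
have tnt n : `|tn n - t| < r n /\ t / 2 < tn n < T.
  have [_ + /andP[_ tT2] _ _] := Hw n; rewrite lt_min => /andP[h1 h2]; split => //.
  by move: h2; rewrite ltr_norml => /andP[h2 _]; rewrite /tn; apply/andP; split; lra.
have tn0 n : 0 < tn n <= T by have [_ /andP[? ?]] := tnt n; apply/andP; split; lra.
have XcT n : Treg Om1 Om2 H n1 n2 b1 b2 (w n).1.1 (tn n) (Xn n, c n).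
  by have [_ _ _ + _] := Hw n; rewrite /tn /Xn /c; case: (w n).2.
have tle n : t / 2 <= tn n by have [_ /andP[? _]] := tnt n; exact: ltW.
have XnL n : enorm_lipon Mb 0 (t / 2) (Xn n).
  by apply: enorm_lipon_sub (treg_lipschitz hO HC11 HC12 Mb0 (tn0 n) (XcT n)).
have LnA n := treg_cost_upto hO HC11 HC12 HC21 HC22 Mb0 (tn0 n) (XcT n).
have LnL n : lipon Ml 0 (t / 2) (Ln n).
  by have [_ h _] := LnA n; apply: lipon_sub h.
have Xn0 n : Xn n 0 = (w n).1.1 by have [[_ ->]] := XcT n.
have i0 : (0 : R) <= (0 : R) <= t / 2 by rewrite lexx divr_ge0// ltW.
have r1 n : r n <= 1 by rewrite invf_le1// ler1n.
have [F [UF FF]] := ultraFilterLemma (F := \oo) _.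
have Fr e : 0 < e -> F [set n | r n < e] by move=> /rsmall; exact: FF.
have lim s : exists XL : E * R, 0 <= s <= t / 2 ->
    (forall e : R, 0 < e -> F [set n | enorm (Xn n s - XL.1) < e]) /\
    (forall e : R, 0 < e -> F [set n | `|Ln n s - XL.2| < e]).
  have [si|] := boolP (0 <= s <= t / 2); last by exists (0, 0).
  case/andP: (si) => s0 _.
  have [n|y Hy] := @ultra_bounded_row_limit _ _ F (fun n => Xn n s) (Mb * s + (1 + enorm x)) UF.
    have h1 := XnL n s 0 si i0; rewrite subr0 (ger0_norm s0) in h1.
    have h2 := enormD (Xn n s - Xn n 0) (Xn n 0); rewrite subrK in h2.
    have h3 := enormD (Xn n 0 - x) x; rewrite subrK in h3.
    have [h4 _ _ _ _] := Hw n; rewrite Xn0 in h1 h2 h3; have := r1 n; lra.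
  have [n|k Hk] := @ultra_bounded_limit _ F (fun n => Ln n s) (Ml * s) UF.
    by have [h0 _ _] := LnA n; have := LnL n s 0 si i0; rewrite {2}/Ln h0 !subr0 (ger0_norm s0).
  by exists (y, k).
have {lim}/choice[XL HXL] := lim.
exists F, Xn, Ln, tn, (fun s => (XL s).1), (fun s => (XL s).2); split.
- exact: ultra_proper.
- by split => // n; have [_ /andP[h1 h2]] := tnt n; rewrite !ltW.
- split.
  + move=> e /Fr; apply: filterS => n /= rn; have [h _] := tnt n; exact: lt_trans h rn.
  + by move=> s /HXL[].
  + by move=> s /HXL[].
  + have [HX _] := HXL 0 i0; apply/eqP; rewrite -subr_eq0; apply/eqP/enorm_eq0/eqP.
    rewrite eq_le enorm_ge0 andbT; apply/ler_addgt0Pr => e e0; rewrite add0r.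
    have e20 : 0 < e / 2 by rewrite divr_gt0.
    have [n [/= h1 h2]] := filter_ex (filterI (HX _ e20) (Fr _ e20)).
    have [h4 _ _ _ _] := Hw n; rewrite enorm_distC Xn0 in h1.
    have := enorm_triangle (w n).1.1 (XL 0).1 x; lra.
  + have [_ HL] := HXL 0 i0; apply/normr0_eq0/eqP; rewrite eq_le normr_ge0 andbT.
    apply/ler_addgt0Pr => e e0; rewrite add0r; have [n /=] := filter_ex (HL _ e0).
    by have [h0 _ _] := LnA n; rewrite /Ln h0 sub0r normrN => /ltW.
- move=> n; have tnh := tle n.
  apply: aeS (treg_dynamics hO HC11 HC12 HC21 HC22 Mb0 (tn0 n) (XcT n)) => s Hs /andP[s0 st].
  by apply: Hs; rewrite s0 (lt_le_trans st).
(* By [treg_tail] the value at [(Xn n s, tn n - s)] is at most [u + r n - Ln n s]. These points come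
   arbitrarily close to [(X s, t - s)], and the lower envelope inherits the bound. *)
move=> s si; have [HX HL] := HXL s si; case/andP: (si) => s0 st.
apply/lee_addgt0Pr => e e0; have e20 : 0 < e / 2 by rewrite divr_gt0.
rewrite -EFinD; apply: envelope_le => d d0.
have [n [[/= h1 h2] [/= h3 h4]]] := filter_ex (filterI (filterI (HX _ d0) (HL _ e20)) (filterI (Fr _ d0) (Fr _ e20))).
have [h5 /andP[h6 h7]] := tnt n.
exists (Xn n s), (tn n - s); split => //.
- have -> : tn n - s - (t - s) = tn n - t by ring.
  exact: lt_trans h5 h3.
- by rewrite subr_ge0 (le_trans st (ltW h6))/= (le_lt_trans _ h7)// gerBl.
have sn : 0 <= s < tn n by rewrite s0 (le_lt_trans st).
have h9 := treg_tail g hO HC11 HC12 HC21 HC22 Mb0 (tn0 n) (XcT n) sn.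
apply: (le_trans h9).
rewrite lee_fin -/(Ln n s); have [_ _ _ _ h8] := Hw n.
have -> : (Xn n, c n) = (w n).2 by rewrite /Xn /c; case: (w n).2.
by rewrite -/(tn n) in h8; move: h2 => /ltr_normlP[h2 _]; lra.
Qed.

End near_optimal.

(** * Growth along the interface *)

Section positive_part.
Context {R : realType}.
Implicit Types (F : R -> R) (s d : R).

Lemma max0_lipschitz (a b : R) : `|Num.max a 0 - Num.max b 0| <= `|a - b|.
Proof.
have := ler_norm (a - b); have := ler_norm (- (a - b)); rewrite normrN => h1 h2.
by rewrite ler_norml /Num.max; case: ltP => ?; case: ltP => ?; apply/andP; split; lra.
Qed.

Lemma dder_small F s d : dder F s d -> forall e : R, 0 < e -> exists2 r : R, 0 < r &
  forall h : R, `|h| < r -> `|F (s + h) - F s| < e.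
Proof.
move=> dF e e0; have [r r0 Hr] := dF 1 ltr01.
have d1 : 0 < `|d| + 1 by rewrite ltr_wpDl.
exists (Num.min r (e / (`|d| + 1))); first by rewrite lt_min r0 divr_gt0.
move=> h; rewrite lt_min ltr_pdivlMr// => /andP[/Hr h1 h2].
have -> : F (s + h) - F s = (F (s + h) - F s - h *: d) + h * d by rewrite subrK.
apply: le_lt_trans (ler_normD _ _) _; rewrite normrM; lra.
Qed.

Lemma dder_pospart_gt0 F s d : dder F s d -> 0 < F s -> dder (fun r => Num.max (F r) 0) s d.
Proof.
move=> dF F0; have [r r0 Hr] := dder_small dF F0; apply: (dder_eq r0 _ dF) => h /Hr.
by rewrite ltr_norml => /andP[h1 _]; rewrite max_l//; lra.
Qed.

Lemma dder_pospart_lt0 F s d : dder F s d -> F s < 0 -> dder (fun r => Num.max (F r) 0) s 0.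
Proof.
move=> dF F0; have F0' : 0 < - F s by rewrite oppr_gt0.
have [r r0 Hr] := dder_small dF F0'; apply: (dder_eq r0 _ (dder_cst 0 s)) => h /Hr.
by rewrite ltr_norml => /andP[_ h1]; rewrite max_r//; lra.
Qed.

(** On H a regular velocity is tangential, so the signed distance has derivative 0 along the
    trajectory; this makes the kinked terms differentiable there. *)
Lemma dder_pospart_eq0 F s : dder F s 0 -> F s = 0 -> dder (fun r => Num.max (F r) 0) s 0.
Proof.
move=> dF F0 e /dF[r r0 Hr]; exists r => // h /Hr; rewrite !scaler0 !subr0 F0.
by rewrite subr0; apply: le_trans; have := max0_lipschitz (F (s + h)) 0; rewrite subr0.
Qed.

Lemma dderN F s d : dder F s d -> dder (fun r => - F r) s (- d).
Proof.
move=> dF e /dF[r r0 Hr]; by exists r => // h /Hr; rewrite scalerN -!opprD normrN.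
Qed.

End positive_part.

Section inward_inequality.
Context {R : realType} {N : nat} {A : metricType R}.
Local Notation E := 'rV[R]_N.
Variables (T : R) (Om : set E) (b : E -> R -> A -> E) (l : E -> R -> A -> R).
Variables (Mb Lb Ml : R) (ml : R -> R).
Hypotheses (HC1 : hyp_C1 T Om b Mb Lb) (HC2 : hyp_C2 T Om l Ml ml).
Hypothesis Mb0 : 0 <= Mb.

(** The chain rule produces the gradient of the signed distance at the current point [z], while the
    multipliers are adapted to [G x]; the Lipschitz bound on [G] pays for the difference. *)
Lemma drift_cost_normal_near (G : E -> E) (C q0 : R) x (t : R) q (m c : R) : 0 <= C -> 0 < q0 ->
  (forall z, enorm (z - x) < q0 -> enorm (G z - G x) <= C * enorm (z - x)) ->
  closure Om x -> 0 <= t <= T ->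
  (forall a, c <= dot (q + m *: G x) (b x t a) + l x t a) ->
  forall e : R, 0 < e -> exists2 r : R, 0 < r & forall z (s : R) a, closure Om z -> 0 <= s <= T ->
    enorm (z - x) + `|s - t| < r -> c - e <= dot q (b z s a) + m * dot (G z) (b z s a) + l z s a.
Proof.
move=> C0 q00 GL cx tT Hc e e0; have e20 : 0 < e / 2 by rewrite divr_gt0.
have [d dp Hd] := drift_cost_near HC1 HC2 (q + m *: G x) 1 cx tT e20.
pose K := `|m| * C * Mb + 1; have K0 : 0 < K by rewrite ltr_wpDl// !mulr_ge0.
exists (Num.min d (Num.min q0 (e / 2 / K))); first by rewrite !lt_min dp q00 divr_gt0.
move=> z s a cz sT; rewrite !lt_min => /andP[r1 /andP[r2 r3]].
have zr : enorm (z - x) <= enorm (z - x) + `|s - t| by rewrite lerDl.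
have h1 := Hd z s a cz sT r1; have := Hc a; rewrite !mul1r in h1.
have h2 := GL z (le_lt_trans zr r2).
have [_ _ bM _] := HC1.
have h3 : enorm (b z s a) <= Mb by apply: bM; split => //=; rewrite in_itv.
have h4 : `|m * dot (G z - G x) (b z s a)| <= e / 2.
  rewrite normrM; apply: (@le_trans _ _ (`|m| * (C * enorm (z - x) * Mb))).
    rewrite ler_wpM2l//; apply: le_trans (dot_enorm _ _) _.
    by apply: ler_pM; rewrite ?enorm_ge0.
  apply: (@le_trans _ _ (K * enorm (z - x))).
    have -> : `|m| * (C * enorm (z - x) * Mb) = `|m| * C * Mb * enorm (z - x) by ring.
    by rewrite ler_wpM2r ?enorm_ge0// lerDl.
  by rewrite mulrC -ler_pdivlMr// ltW// (le_lt_trans zr).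
rewrite dotBl mulrBr in h4; rewrite !dotDl !dotZl in h1; move: h4 => /ler_normlP[h4 _].
rewrite !dotDl !dotZl; lra.
Qed.

End inward_inequality.

Section tangential_growth.
Context {R : realType} {N : nat} {A1 A2 : metricType R}.
Local Notation E := 'rV[R]_N.
Local Notation mu := (@lebesgue_measure R).
Variables (Om1 Om2 H : set E) (n1 n2 : E -> E) (T : R).
Variables (b1 : E -> R -> A1 -> E) (b2 : E -> R -> A2 -> E).
Variables (l1 : E -> R -> A1 -> R) (l2 : E -> R -> A2 -> R).
Variables (Mb Lb Ml delta : R) (ml : R -> R).
Local Notation A12 := (A1 * A2 * R)%type.
Hypothesis hO : hyp_Omega Om1 Om2 H.
Hypotheses (hn1 : forall z, H z -> outward_unit_normal Om1 z (n1 z))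
  (hn2 : forall z, H z -> outward_unit_normal Om2 z (n2 z)).
Hypotheses (HC11 : hyp_C1 T Om1 b1 Mb Lb) (HC12 : hyp_C1 T Om2 b2 Mb Lb).
Hypotheses (HC21 : hyp_C2 T Om1 l1 Ml ml) (HC22 : hyp_C2 T Om2 l2 Ml ml).
Hypotheses (HC31 : hyp_C3 T Om1 b1 l1) (HC32 : hyp_C3 T Om2 b2 l2).
Hypotheses (delta0 : (0 : R) < delta) (HC41 : hyp_C4 T H n1 b1 delta) (HC42 : hyp_C4 T H n2 b2 delta).
Hypothesis Mb0 : 0 <= Mb.
Local Notation f := (signed_dist Om1 Om2 H).
Local Notation dyn := (dynamics Om1 Om2 H b1 b2).
Local Notation cost := (running_cost Om1 Om2 H l1 l2).
Variables (x : E) (t : R).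
Hypothesis Hx : H x.
Hypothesis tT : 0 <= t <= T.

(** [S1] and [S2] collect pairs (outward normal velocity, excess over [c]). (C3) makes them convex,
    (C4) provides the abscissas 0 and [delta], and a balanced pair of nonnegative abscissas is
    precisely a regular control. *)
Lemma tangential_multipliers p (c : R) : n2 x = - n1 x ->
  (forall a : A12, A0reg n1 n2 b1 b2 x t a -> c <= dot (bH b1 b2 x t a) p + lH l1 l2 x t a) ->
  exists m1 m2 : R, [/\ 0 <= m1 + m2,
    forall a, c <= dot (p + m1 *: (- n1 x)) (b1 x t a) + l1 x t a &
    forall a, c <= dot (p + m2 *: (- n2 x)) (b2 x t a) + l2 x t a].
Proof.
move=> n21 Hc; have [_ _ /(_ Hx)[c1 c2]] := closure_sides hO x.
have tI : t \in `[0, T] by rewrite in_itv.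
pose S1 : set (R * R) := [set (dot (b1 x t a) (n1 x), dot (b1 x t a) p + l1 x t a - c) | a in [set: A1]].
pose S2 : set (R * R) := [set (dot (b2 x t a) (n2 x), dot (b2 x t a) p + l2 x t a - c) | a in [set: A2]].
have S1y (y : R) : - delta <= y <= delta -> exists L, S1 (y, L).
  move=> yd; have [|a _ ay] := HC41 Hx tI (t := y); first by rewrite /= in_itv.
  by exists (dot (b1 x t a) p + l1 x t a - c); exists a => //; rewrite ay.
have S2y (y : R) : - delta <= y <= delta -> exists L, S2 (y, L).
  move=> yd; have [|a _ ay] := HC42 Hx tI (t := y); first by rewrite /= in_itv.
  by exists (dot (b2 x t a) p + l2 x t a - c); exists a => //; rewrite ay.
have dd : - delta <= delta <= delta by rewrite lexx andbT (le_trans _ (ltW delta0))// oppr_le0 ltW.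
have d0 : - delta <= 0 <= delta by rewrite oppr_le0 (ltW delta0).
have [||y y' mu Sc Sc' mu01 p1 p2 e|m1 [m2 [m12 Hm1 Hm2]]] :=
  one_sided_multipliers delta0 (S1y _ dd) (S2y _ dd) (S1y _ d0) (S2y _ d0).
- move=> _ _ th [a _ <-] [a' _ <-] th01 /=.
  have [a'' [ba la]] := drift_cost_convex HC31 a a' c1 tT th01.
  exists a'' => //; rewrite ba la !dotDl !dotZl; congr (_, _); ring.
- move=> _ _ th [a _ <-] [a' _ <-] th01 /=.
  have [a'' [ba la]] := drift_cost_convex HC32 a a' c2 tT th01.
  exists a'' => //; rewrite ba la !dotDl !dotZl; congr (_, _); ring.
- case: Sc p1 e => a _ <- /= p1; case: Sc' p2 => a' _ <- /= p2 e.
  have := Hc (a, a', mu) _; rewrite /bH /lH /=.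
  rewrite dotDl !dotZl => h; have : A0reg n1 n2 b1 b2 x t (a, a', mu).
    split => //=; rewrite /bH /= dotDl !dotZl e n21 dotNr; ring.
  by move=> /h; lra.
exists m1, m2; split => // a.
  have := Hm1 _ (ex_intro2 _ _ a I erefl); rewrite /= dotDl dotZl dotNl (dotC p) (dotC (n1 x)); lra.
have := Hm2 _ (ex_intro2 _ _ a I erefl); rewrite /= dotDl dotZl dotNl (dotC p) (dotC (n2 x)); lra.
Qed.

(* The candidate p . X + m1 f^+ + m2 f^- + L grows at rate at least c along
   every admissible trajectory near (x, t): in Omega_i by the one-sided
   inequalities, and on the interface because m1 + m2 >= 0. *)
Lemma tangential_growth p (c : R) :
  (forall a : A12, A0reg n1 n2 b1 b2 x t a -> c <= dot (bH b1 b2 x t a) p + lH l1 l2 x t a) ->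
  exists m1 m2 : R, forall e : R, 0 < e -> exists2 r : R, 0 < r &
    forall (X : R -> E) (L : R -> R) (s tau : R) a, 0 <= tau <= T ->
      enorm (X s - x) + `|tau - t| < r -> ctrl_set a ->
      dder X s (dyn (X s) tau a) -> dder L s (cost (X s) tau a) ->
      (H (X s) -> A0reg n1 n2 b1 b2 (X s) tau a) ->
      exists2 k, dder (fun r => dot p (X r) + m1 * Num.max (f (X r)) 0 + m2 * Num.max (- f (X r)) 0 + L r) s k
        & c - e <= k.
Proof.
move=> Hc; have [G [C [rho [rho0 C0 fG GL G1]]]] := interface_chart hO Hx.
have N1 z : ball x rho z -> H z -> n1 z = - G z.
  by move=> xz Hz; exact: (normal_side1 hO Hx C0 fG G1 xz Hz (hn1 Hz)).
have N2 z : ball x rho z -> H z -> n2 z = G z.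
  by move=> xz Hz; exact: (normal_side2 hO Hx C0 fG G1 xz Hz (hn2 Hz)).
have xx : ball x rho x by exact: ballxx.
have n1x := N1 x xx Hx; have n2x := N2 x xx Hx.
have [|m1 [m2 [m12 Hm1 Hm2]]] := tangential_multipliers (p := p) (c := c) _ Hc.
  by rewrite n1x n2x opprK.
rewrite n1x opprK in Hm1; rewrite n2x in Hm2.
exists m1, m2 => e e0; have [q q0 Hq] := ball_enorm xx.
have GLx z : enorm (z - x) < q -> enorm (G z - G x) <= C * enorm (z - x).
  by move=> zq; have := GL _ _ xx (Hq _ zq); rewrite (_ : x + (z - x) = z)// addrC subrK.
have [_ _ /(_ Hx)[c1 c2]] := closure_sides hO x.
(* In Omega_2 the negative part of the signed distance has gradient [- G], hence the opposite
   sign. *)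
have Hm2' a : c <= dot (p + (- m2) *: G x) (b2 x t a) + l2 x t a by rewrite scaleNr -scalerN.
have [r1 r10 H1] := drift_cost_normal_near HC11 HC21 Mb0 C0 q0 GLx c1 tT Hm1 e0.
have [r2 r20 H2] := drift_cost_normal_near HC12 HC22 Mb0 C0 q0 GLx c2 tT Hm2' e0.
exists (Num.min q (Num.min r1 r2)); first by rewrite !lt_min q0 r10.
move=> X L s tau a tauT; rewrite !lt_min => /andP[rq /andP[rr1 rr2]] ca dX dL HA.
have xX : ball x rho (X s).
  rewrite -[X s](subrK x) addrC; apply: Hq; apply: le_lt_trans rq; by rewrite lerDl.
have df := sdist_chain C0 fG xX dX.
have [cl1 cl2 clH] := closure_sides hO (X s).
have build k1 k2 : dder (fun r => Num.max (f (X r)) 0) s k1 ->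
    dder (fun r => Num.max (- f (X r)) 0) s k2 ->
    dder (fun r => dot p (X r) + m1 * Num.max (f (X r)) 0 + m2 * Num.max (- f (X r)) 0 + L r) s
     (dot p (dyn (X s) tau a) + m1 * k1 + m2 * k2 + cost (X s) tau a).
  move=> D1 D2; apply: dderD dL; apply: dderD (dderZ m2 D2).
  by apply: dderD (dderZ m1 D1); exact: dder_dot.
case: (interface_cases hO (X s)) => Os.
- have f0 : 0 < f (X s) by apply/(sdist_side1 hO Hx).
  eexists; first apply: build.
  + exact: dder_pospart_gt0 df f0.
  + by apply: dder_pospart_lt0 (dderN df) _; rewrite oppr_lt0.
  rewrite mulr0 addr0 (dynamics1 _ _ hO) // (cost1 _ _ hO)//.
  exact: H1 (cl1 Os) tauT rr1.
- have f0 : f (X s) < 0 by apply/(sdist_side2 hO Hx).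
  eexists; first apply: build.
  + exact: dder_pospart_lt0 df f0.
  + by apply: dder_pospart_gt0 (dderN df) _; rewrite oppr_gt0.
  rewrite mulr0 addr0 (dynamics2 _ _ hO) // (cost2 _ _ hO)//.
  by have := H2 _ _ a.1.2 (cl2 Os) tauT rr2; rewrite mulNr mulrN.
have [[d1 d2] [_ bn bn1 bn2]] := (clH Os, HA Os).
have f0 : f (X s) = 0 by exact: (sdist0 hO Os).
rewrite (N1 _ xX Os) dotNr in bn bn1; rewrite (N2 _ xX Os) in bn2.
have dG : dot (G (X s)) (dyn (X s) tau a) = 0.
  by rewrite (dynamicsH _ _ hO)// dotC; apply/eqP; rewrite -oppr_eq0 bn.
rewrite dG in df.
eexists; first apply: build.
+ exact: dder_pospart_eq0 df f0.
+ by apply: dder_pospart_eq0; [rewrite -oppr0; exact: dderN|rewrite f0 oppr0].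
have h1 := H1 _ _ a.1.1 d1 tauT rr1; have h2 := H2 _ _ a.1.2 d2 tauT rr2.
rewrite !mulr0 !addr0 (dynamicsH _ _ hO)// (costH _ _ hO)// /lH.
move: bn; rewrite /bH dotDl !dotZl dotDr !dotZr.
case/andP: ca => mu0 mu1.
have {}h1 : a.2 * (c - e) <= a.2 * (dot p (b1 (X s) tau a.1.1) + m1 * dot (G (X s)) (b1 (X s) tau a.1.1) + l1 (X s) tau a.1.1).
  by rewrite ler_wpM2l.
have {}h2 : (1 - a.2) * (c - e) <= (1 - a.2) * (dot p (b2 (X s) tau a.1.2) - m2 * dot (G (X s)) (b2 (X s) tau a.1.2) + l2 (X s) tau a.1.2).
  by rewrite ler_wpM2l ?subr_ge0// -mulNr.
rewrite dotC dotNl oppr_ge0 in bn1; rewrite dotC in bn2.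
rewrite (dotC _ (G (X s))) (dotC _ (G (X s))).
move: h1 h2 bn1 bn2; set B1 := dot (G _) _; set B2 := dot (G _) _ => h1 h2 bn1 bn2 bn.
have w0 : a.2 * B1 <= 0 by rewrite mulr_ge0_le0//; lra.
have : (m1 + m2) * (a.2 * B1) <= 0 by rewrite mulr_ge0_le0.
have e2 : (1 - a.2) * B2 = - (a.2 * B1) by lra.
have e3 : m2 * ((1 - a.2) * B2) = - (m2 * (a.2 * B1)) by rewrite e2 mulrN.
lra.
Qed.

End tangential_growth.

(** * Behaviour of the limit trajectory near its starting point *)

Section dichotomy.
Context {R : realType} {N : nat} {A1 A2 : metricType R}.
Local Notation E := 'rV[R]_N.
Local Notation mu := (@lebesgue_measure R).
Variables (Om1 Om2 H : set E) (n1 n2 : E -> E) (T : R).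
Variables (b1 : E -> R -> A1 -> E) (b2 : E -> R -> A2 -> E).
Variables (l1 : E -> R -> A1 -> R) (l2 : E -> R -> A2 -> R).
Variables (Mb Lb Ml delta : R) (ml : R -> R).
Local Notation A12 := (A1 * A2 * R)%type.
Hypothesis hO : hyp_Omega Om1 Om2 H.
Hypotheses (hn1 : forall z, H z -> outward_unit_normal Om1 z (n1 z))
  (hn2 : forall z, H z -> outward_unit_normal Om2 z (n2 z)).
Hypotheses (HC11 : hyp_C1 T Om1 b1 Mb Lb) (HC12 : hyp_C1 T Om2 b2 Mb Lb).
Hypotheses (HC21 : hyp_C2 T Om1 l1 Ml ml) (HC22 : hyp_C2 T Om2 l2 Ml ml).
Hypotheses (HC31 : hyp_C3 T Om1 b1 l1) (HC32 : hyp_C3 T Om2 b2 l2).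
Hypotheses (delta0 : (0 : R) < delta) (HC41 : hyp_C4 T H n1 b1 delta) (HC42 : hyp_C4 T H n2 b2 delta).
Hypothesis Mb0 : 0 <= Mb.
Local Notation f := (signed_dist Om1 Om2 H).
Local Notation dyn := (dynamics Om1 Om2 H b1 b2).
Local Notation cost := (running_cost Om1 Om2 H l1 l2).
Variables (x : E) (t eta : R).
Hypothesis Hx : H x.
Hypothesis eta0 : 0 < eta.
Hypothesis tT : eta <= t <= T.
Variables (F : set_system nat) (Xn : nat -> R -> E) (Ln : nat -> R -> R) (tn : nat -> R)
  (X : R -> E) (L : R -> R).
Context {FF : ProperFilter F}.
Hypothesis XnL : forall n, enorm_lipon Mb 0 eta (Xn n).
Hypothesis LnL : forall n, lipon Ml 0 eta (Ln n).
Hypothesis tnT : forall n, eta <= tn n <= T.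
Hypothesis tlim : forall e : R, 0 < e -> F [set n | `|tn n - t| < e].
Hypothesis Xlim : forall s : R, 0 <= s <= eta -> forall e : R, 0 < e ->
  F [set n | enorm (Xn n s - X s) < e].
Hypothesis Llim : forall s : R, 0 <= s <= eta -> forall e : R, 0 < e ->
  F [set n | `|Ln n s - L s| < e].
Hypotheses (X0 : X 0 = x) (L0 : L 0 = 0).
Hypothesis Hdyn : forall n, {ae mu, forall s, 0 < s < eta -> exists a,
  [/\ ctrl_set a, dder (Xn n) s (dyn (Xn n s) (tn n - s) a),
      dder (Ln n) s (cost (Xn n s) (tn n - s) a) &
      H (Xn n s) -> A0reg n1 n2 b1 b2 (Xn n s) (tn n - s) a]}.

Lemma limit_stays_on_one_side : (forall s : R, 0 < s <= eta -> ~ H (X s)) ->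
  (forall s : R, 0 < s <= eta -> Om1 (X s)) \/ (forall s : R, 0 < s <= eta -> Om2 (X s)).
Proof.
move=> XH; have XL : enorm_lipon Mb 0 eta X by exact: limit_enorm_lipon XnL Xlim.
pose F' s := f (X (clamp eta s)).
have cF : continuous F'.
  apply: (lip_continuous (K := Mb)) => s s'; apply: le_trans (sdist_lipschitz hO Hx _ _) _.
  apply: (le_trans (XL _ _ (clamp_in s (ltW eta0)) (clamp_in s' (ltW eta0)))).
  by rewrite ler_wpM2l// clamp_dist// ltW.
have FX s : 0 < s <= eta -> F' s = f (X s).
  by move=> /andP[s0 se]; rewrite /F' clampE// (ltW s0).
have nz s : 0 < s -> s <= eta -> Num.min (F' s) (F' eta) <= 0 <= Num.max (F' s) (F' eta) -> False.
  move=> s0 se; move=> /(@IVT R F' s eta 0 se (continuous_subspaceT cF))[r /[!in_itv]/= /andP[sr re] r0].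
  have ri : 0 < r <= eta by rewrite re (lt_le_trans s0).
  by apply: (XH r ri); apply/(sdist_eq0 hO Hx); rewrite -FX.
have ee : 0 < eta <= eta by rewrite eta0 lexx.
case: (interface_cases hO (X eta)) => Oe; last by have := XH _ ee Oe.
- left => s si; case/andP: (si) => s0 se; apply/(sdist_side1 hO Hx); rewrite ltNge; apply/negP => fs.
  have fe : 0 < f (X eta) by apply/(sdist_side1 hO Hx).
  by apply: (nz s s0 se); rewrite ge_min le_max !FX// fs/= (ltW fe) orbT.
- right => s si; case/andP: (si) => s0 se; apply/(sdist_side2 hO Hx); rewrite ltNge; apply/negP => fs.
  have fe : f (X eta) < 0 by apply/(sdist_side2 hO Hx).
  by apply: (nz s s0 se); rewrite ge_min le_max !FX// fs/= (ltW fe) orbT.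
Qed.

(** The approximations need not be on H at time [s]. Growth is integrated along them for the
    Lipschitz function [Psi]; its values converge to those at [X s] and [x], where the kinked terms
    vanish. *)
Lemma limit_tangential_growth p (c : R) :
  (forall a : A12, A0reg n1 n2 b1 b2 x t a -> c <= dot (bH b1 b2 x t a) p + lH l1 l2 x t a) ->
  forall e : R, 0 < e -> exists2 s0 : R, 0 < s0 & forall s : R, 0 < s <= s0 -> s <= eta -> H (X s) ->
    (c - e) * s <= dot p (X s - x) + L s.
Proof.
move=> Hc e e0; case/andP: tT => et tT'.
have tT0 : 0 <= t <= T by rewrite tT' andbT (le_trans (ltW eta0)).
have [m1 [m2 /(_ e e0)[r r0 Hr]]] := tangential_growth hO hn1 hn2 HC11 HC12 HC21 HC22 HC31 HC32
  delta0 HC41 HC42 Mb0 Hx tT0 Hc.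
have Mb1 : 0 < Mb + 1 by rewrite ltr_wpDl.
(* The displacement in space and time up to [s] uses a quarter of [r]; the errors of the starting
   point and of [tn n] use two more. *)
exists (r / (4 * (Mb + 1))); first by rewrite divr_gt0// mulr_gt0.
move=> s /andP[s0 sr] se HXs; rewrite ler_pdivlMr ?mulr_gt0// in sr.
pose K := enorm p + `|m1| + `|m2| + 1.
have K0 : 0 < K by rewrite ltr_wpDl// !addr_ge0 ?enorm_ge0.
pose Psi z := dot p z + m1 * Num.max (f z) 0 + m2 * Num.max (- f z) 0.
have PsiL z y : `|Psi z - Psi y| <= (K - 1) * enorm (z - y).
  have -> : Psi z - Psi y = dot p (z - y) + m1 * (Num.max (f z) 0 - Num.max (f y) 0)
      + m2 * (Num.max (- f z) 0 - Num.max (- f y) 0) by rewrite /Psi dotBr; ring.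
  apply: le_trans (ler_normD _ _) _; apply: le_trans (lerD (ler_normD _ _) (lexx _)) _.
  have h := sdist_lipschitz hO Hx z y.
  have h1 := max0_lipschitz (f z) (f y); have h2 := max0_lipschitz (- f z) (- f y).
  rewrite -opprD normrN in h2; have h3 := dot_enorm p (z - y); rewrite !normrM.
  have h4 : `|m1| * `|Num.max (f z) 0 - Num.max (f y) 0| <= `|m1| * enorm (z - y).
    by rewrite ler_wpM2l//; apply: le_trans h1 h.
  have h5 : `|m2| * `|Num.max (- f z) 0 - Num.max (- f y) 0| <= `|m2| * enorm (z - y).
    by rewrite ler_wpM2l//; apply: le_trans h2 h.
  rewrite /K; lra.
have PsiH z : H z -> Psi z = dot p z.
  by move=> Hz; rewrite /Psi (sdist0 hO Hz) oppr0 /Num.max ltxx !mulr0 !addr0.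
have i0 : (0 : R) <= (0 : R) <= eta by rewrite lexx ltW.
have is_ : 0 <= s <= eta by rewrite se ltW.
apply/ler_addgt0Pr => d d0.
(* [Psi] has Lipschitz constant [K - 1] and [L] enters with factor 1, so the errors at both ends add
   up to at most [2 * K * (d / (4 * K)) = d / 2]. *)
have d1 : 0 < Num.min (d / (4 * K)) (r / 4) by rewrite lt_min !divr_gt0// mulr_gt0.
have d2 : 0 < d / (4 * K) by rewrite divr_gt0// mulr_gt0.
have r4 : 0 < r / 4 by rewrite divr_gt0.
have [n [[[/= x0] xs] [[/= k0 ks] tnr]]] := filter_ex (filterI (filterI (Xlim i0 d1) (Xlim is_ d2))
  (filterI (filterI (Llim i0 d2) (Llim is_ d2)) (tlim r4))).
move: x0; rewrite lt_min => /andP[x0 x0r].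
have FL : lipon ((K - 1) * Mb + Ml) 0 s (fun r => Psi (Xn n r) + Ln n r).
  apply: liponD.
    move=> r1 r2 /andP[u1 u2] /andP[u3 u4]; apply: le_trans (PsiL _ _) _; rewrite -mulrA.
    apply: ler_wpM2l; first by rewrite /K addrK !addr_ge0 ?enorm_ge0.
    by apply: XnL; rewrite ?u1 ?u3/=; apply: le_trans se.
  exact: lipon_sub (lexx _) se (LnL n).
have := ae_growth (c := c - e) FL (ltW s0) _; rewrite subr0 => G.
have {}G : (c - e) * s <= Psi (Xn n s) + Ln n s - (Psi (Xn n 0) + Ln n 0).
  apply: G; apply: aeS (Hdyn n) => q Hq /andP[q0 qs].
  have [|a [ca dX dL HA]] := Hq; first by rewrite q0 (lt_le_trans qs).
  have /andP[tn1 tn2] := tnT n.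
  have [||k dk ck] := Hr (Xn n) (Ln n) q (tn n - q) a _ _ ca dX dL HA; last by exists k.
  - rewrite subr_ge0 (le_trans (ltW qs) (le_trans se tn1))/=.
    by apply: le_trans tn2; rewrite gerBl ltW.
  have iq : 0 <= q <= eta by rewrite (ltW q0) (le_trans (ltW qs)).
  have h1 := XnL n iq i0; rewrite subr0 (gtr0_norm q0) in h1.
  have h2 := enorm_triangle (Xn n 0) (Xn n q) x; rewrite X0 in x0r.
  have h3 : Mb * q <= Mb * s by rewrite ler_wpM2l// ltW.
  have h4 := ler_normB (tn n - t) q; rewrite (gtr0_norm q0) in h4.
  have -> : tn n - q - t = tn n - t - q by ring.
  lra.
have h0 := PsiL (Xn n 0) x; have hs := PsiL (Xn n s) (X s).
rewrite X0 in x0; rewrite L0 subr0 in k0.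
have K1 : 0 <= K - 1 by rewrite /K addrK !addr_ge0 ?enorm_ge0.
have g0 : (K - 1) * enorm (Xn n 0 - x) <= (K - 1) * (d / (4 * K)) by rewrite ler_wpM2l// ltW.
have gs : (K - 1) * enorm (Xn n s - X s) <= (K - 1) * (d / (4 * K)) by rewrite ler_wpM2l// ltW.
have Kd : K * (d / (4 * K)) = d / 4 by field; rewrite gt_eqF.
rewrite (PsiH _ Hx) in h0; rewrite (PsiH _ HXs) in hs; rewrite dotBr.
move: h0 hs k0 ks => /ler_normlP[h0 h0'] /ler_normlP[hs hs'] /ltr_normlP[k0 k0'] /ltr_normlP[ks ks'].
set D := d / (4 * K) in g0 gs Kd k0 k0' ks ks' *.
lra.
Qed.

End dichotomy.

Theorem theorem3p5 (R : realType) (N : nat)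
    (Om1 Om2 H : set 'rV[R]_N) (n1 n2 : 'rV[R]_N -> 'rV[R]_N)
    (T : R) (A1 A2 : metricType R)
    (b1 : 'rV[R]_N -> R -> A1 -> 'rV[R]_N) (b2 : 'rV[R]_N -> R -> A2 -> 'rV[R]_N)
    (l1 : 'rV[R]_N -> R -> A1 -> R) (l2 : 'rV[R]_N -> R -> A2 -> R)
    (Mb Lb Ml delta : R) (ml : R -> R)
    (g : 'rV[R]_N -> R) (phi : 'rV[R]_N -> R -> R) (x : 'rV[R]_N) (t : R) :
  (exists M, forall z, `|g z| <= M) -> continuous g ->
  hyp_Omega Om1 Om2 H ->
  (forall z, H z -> outward_unit_normal Om1 z (n1 z)) ->
  (forall z, H z -> outward_unit_normal Om2 z (n2 z)) ->
  0 < T ->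
  hyp_C1 T Om1 b1 Mb Lb -> hyp_C1 T Om2 b2 Mb Lb ->
  hyp_C2 T Om1 l1 Ml ml -> hyp_C2 T Om2 l2 Ml ml ->
  hyp_C3 T Om1 b1 l1 -> hyp_C3 T Om2 b2 l2 ->
  0 < delta -> hyp_C4 T H n1 b1 delta -> hyp_C4 T H n2 b2 delta ->
  C1_on_interface H T phi ->
  H x -> t \in `]0, T[ ->
  let U := Uplus_lsc Om1 Om2 H n1 n2 b1 b2 l1 l2 T g in
  (forall z s, H z -> s \in `[0, T] ->
     (U x t - (phi x t)%:E <= U z s - (phi z s)%:E)%E) ->
  (superoptimal_into Om1 b1 l1 U x t \/ superoptimal_into Om2 b2 l2 U x t) \/
  (0 <= (derive1 (phi x) t)%:E
        + HTreg n1 n2 b1 b2 l1 l2 x t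
            (tangential_gradient H (fun z => phi z t) x))%E.
Proof.
move=> [Mg gM] _ hO hn1 hn2 T0 HC11 HC12 HC21 HC22 HC31 HC32 delta0 HC41 HC42 phiC Hx.
move=> tT_itv U Hmin; have tT : 0 < t < T by move: tT_itv; rewrite in_itv.
case/andP: (tT) => t0 tT'.
have tI : t \in `[0, T] by rewrite in_itv/= !ltW.
have d0 : [set` `[- delta, delta]] 0 by rewrite /= in_itv/= oppr_le0 ltW.
have [a1 _ _] := HC41 x t Hx tI 0 d0; have [a2 _ _] := HC42 x t Hx tI 0 d0.
have [_ _ /(_ Hx)[cl1 cl2]] := closure_sides hO x.
have Mb0 : 0 <= Mb.
  by have [_ _ h _] := HC11; apply: le_trans (enorm_ge0 _) (h x t a1 _); split.
have Ml0 : 0 <= Ml.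
  by have [_ h _ _] := HC21; apply: le_trans (normr_ge0 _) (h x t a1 _); split.
(* Finiteness of [U x t] from above comes from the minimum property compared with the point
   [(x, 0)]; no trajectory near [(x, t)] is constructed. *)
have Ux0 : (U x 0%R <= (g x)%:E)%E.
  apply: envelope_le => e e0; exists x, 0; split => //.
  - by rewrite subrr enorm0.
  - by rewrite subrr normr0.
  - by rewrite lexx.
  - by apply: uplus_initial; exact: (a1, a2, 0).
have UNy := uplus_lsc_gtNy n1 n2 hO HC11 HC12 HC21 HC22 Mb0 Ml0 gM x tT.
have [u Uu] : exists u, U x t = u%:E.
  have zI : (0 : R) \in `[0, T] by rewrite in_itv/= lexx ltW.
  have := Hmin x 0 Hx zI; move: Ux0 UNy; rewrite -/(U x t).
  case: (U x t) => [u _ _ _|+ _|//]; first by exists u.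
  by case: (U x 0) => [v _| |].
have [F [Xn [Ln [tn [X [L [FF [XnL LnL tnT] [tlim Xlim Llim X0 L0] Hdyn DPP]]]]]]] :=
  near_optimal_limit hO HC11 HC12 HC21 HC22 Mb0 tT Uu.
rewrite -/(Uplus_lsc Om1 Om2 H n1 n2 b1 b2 l1 l2 T g) -/U in DPP.
have [[eta [/andP[eta0 eta2] XH]]|Hhit] := pselect (exists eta : R, 0 < eta <= t / 2 /\ forall s : R, 0 < s <= eta -> ~ H (X s)).
  left.
  have sub s : 0 <= s <= eta -> 0 <= s <= t / 2 by move=> /andP[-> /le_trans]; apply.
  have sub' s : 0 < s < eta -> 0 < s < t / 2 by move=> /andP[-> /lt_le_trans]; apply.
  have XnL' n : enorm_lipon Mb 0 eta (Xn n) by exact: enorm_lipon_sub (lexx _) eta2 (XnL n).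
  have LnL' n : lipon Ml 0 eta (Ln n) by exact: lipon_sub (lexx _) eta2 (LnL n).
  have tT1 : eta <= t <= T by clear -t0 tT' eta2; apply/andP; split; lra.
  have tnT' n : eta <= tn n <= T by have /andP[h ->] := tnT n; rewrite (le_trans eta2).
  have Xlim' s : 0 <= s <= eta -> forall e : R, 0 < e -> F [set n | enorm (Xn n s - X s) < e].
    by move=> /sub; exact: Xlim.
  have Llim' s : 0 <= s <= eta -> forall e : R, 0 < e -> F [set n | `|Ln n s - L s| < e].
    by move=> /sub; exact: Llim.
  have ineq : ((L eta - L 0)%R%:E + U (X eta) (t - eta)%R <= U x t)%E.
    have := DPP eta; rewrite (ltW eta0) eta2 => /(_ isT) h.
    move: h; rewrite L0 subr0 Uu; case: (U (X eta) _) => [v| |]; last by move=> _; rewrite addeNy leNye.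
      by rewrite -EFinD !lee_fin; lra.
    by rewrite leye_eq.
  have [_ [oO1 oO2 _] _ _ _] := hO.
  have ei : eta \in `]0, t] by rewrite in_itv/= eta0; clear -t0 eta2; lra.
  have [S1|S2] := limit_stays_on_one_side hO Mb0 Hx eta0 XnL' Xlim' XH.
  + left; have [n|alpha [Z [ca [ZL Z0 Zd] ZO [Ze Zi]]]] := one_sided_trajectory HC11 HC21 HC31 Mb0 a1 oO1 eta0
      XnL' LnL' tT1 tnT' tlim Xlim' Llim' _ S1.
      apply: aeS (Hdyn n) => s Hs /sub'/Hs[a [_ dX dL _]] Os; exists a.1.1.
      by move: dX dL; rewrite (dynamics1 _ _ hO)// (cost1 _ _ hO).
    exists eta, alpha, Z; split; [by split|by split; [exact: ZL|rewrite Z0|exact: Zd]|exact: ZO|].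
    by rewrite Zi Ze; exact: ineq.
  + right; have [n|alpha [Z [ca [ZL Z0 Zd] ZO [Ze Zi]]]] := one_sided_trajectory HC12 HC22 HC32 Mb0 a2 oO2 eta0
      XnL' LnL' tT1 tnT' tlim Xlim' Llim' _ S2.
      apply: aeS (Hdyn n) => s Hs /sub'/Hs[a [_ dX dL _]] Os; exists a.1.2.
      by move: dX dL; rewrite (dynamics2 _ _ hO)// (cost2 _ _ hO).
    exists eta, alpha, Z; split; [by split|by split; [exact: ZL|rewrite Z0|exact: Zd]|exact: ZO|].
    by rewrite Zi Ze; exact: ineq.
right; set p := tangential_gradient _ _ _; set HT := HTreg _ _ _ _ _ _ _ _ _.
rewrite leNgt; apply/negP => neg.
(* For finite [HT] the rate is its opposite. If [HT] is [-oo], no control satisfies the premise and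
   any larger rate will do. *)
have [c phic Hc] : exists2 c, derive1 (phi x) t < c &
    forall a, A0reg n1 n2 b1 b2 x t a -> c <= dot (bH b1 b2 x t a) p + lH l1 l2 x t a.
  have HTa a : A0reg n1 n2 b1 b2 x t a -> ((- dot (bH b1 b2 x t a) p - lH l1 l2 x t a)%:E <= HT)%E.
    by move=> Aa; apply: ereal_sup_ubound; exists a.
  move: neg HTa; case: HT => [h| |].
  - rewrite -EFinD lte_fin => h1 Ha; exists (- h); first lra.
    by move=> a /Ha; rewrite lee_fin; lra.
  - by rewrite addey.
  - by move=> _ Ha; exists (derive1 (phi x) t + 1); [rewrite ltrDl|move=> a /Ha; rewrite leeNy_eq].
(* One error [e] comes from the growth bound and one from the expansion of [phi]; together they use
   half of the gap. *)
pose e := (c - derive1 (phi x) t) / 4; have e0 : 0 < e by rewrite divr_gt0// subr_gt0.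
have Mb1 : 0 < Mb + 1 by rewrite ltr_wpDl.
have tT1 : t / 2 <= t <= T by clear -t0 tT'; apply/andP; split; lra.
have t20 : 0 < t / 2 by rewrite divr_gt0.
have [s0 s00 Hs0] := limit_tangential_growth hO hn1 hn2 HC11 HC12 HC21 HC22 HC31 HC32
  delta0 HC41 HC42 Mb0 Hx t20 tT1 XnL LnL tnT tlim Xlim Llim X0 L0 Hdyn Hc e0.
have [r r0 Hr] := tangential_expansion hO Hx phiC tT (divr_gt0 e0 Mb1).
(* The last bound keeps both the displacement of [X], at most [Mb * s], and the time [s] below [r].
   Their sum is at most [(Mb + 1) * s], which is why the expansion is taken with precision
   [e / (Mb + 1)]. *)
pose eta := Num.min (Num.min s0 (t / 2)) (r / (2 * (Mb + 1))).
have eta0 : 0 < eta by rewrite !lt_min s00 t20 divr_gt0// mulr_gt0.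
have [s [/andP[sp se] HXs]] : exists s, 0 < s <= eta /\ H (X s).
  apply: contrapT => nH; apply: Hhit; exists eta; rewrite eta0 !ge_min lexx orbT /=; split => //.
  by move=> s si Hs; apply: nH; exists s.
move: se; rewrite !le_min => /andP[/andP[ss0 st] sr].
rewrite ler_pdivlMr ?mulr_gt0// in sr.
have si : 0 <= s <= t / 2 by rewrite ltW.
have g1 := Hs0 s; rewrite sp ss0 in g1; have {}g1 := g1 isT st HXs.
have XL : enorm_lipon Mb 0 (t / 2) X by exact: limit_enorm_lipon XnL Xlim.
have i0 : (0 : R) <= (0 : R) <= t / 2 by rewrite lexx ltW.
have Xs : enorm (X s - x) <= Mb * s by have := XL s 0 si i0; rewrite X0 subr0 (gtr0_norm sp).
have ts : `|t - s - t| = s by rewrite addrAC subrr add0r normrN gtr0_norm.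
have Ms : 0 <= Mb * s by rewrite mulr_ge0 ?(ltW sp).
have k1 : enorm (X s - x) < r by clear -Xs sr sp Ms; lra.
have k2 : `|t - s - t| < r by rewrite ts; clear -Xs sr sp Ms; lra.
have ex := Hr (X s) (t - s) HXs k1 k2; rewrite ts in ex.
have {}ex : `|phi (X s) (t - s) - phi x t - dot p (X s - x) - derive1 (phi x) t * (t - s - t)| <= e * s.
  apply: (le_trans ex); rewrite mulrAC ler_pdivrMr// -[leRHS]mulrA; apply: ler_wpM2l; first exact: ltW.
  by clear -Xs; lra.
have tsI : t - s \in `[0, T] by rewrite in_itv/=; clear -st sp t0 tT'; apply/andP; split; lra.
have := Hmin (X s) (t - s) HXs tsI; have := DPP s si; rewrite Uu.
case: (U (X s) (t - s)) => [v|//|//]; rewrite lee_fin => h1; rewrite -!EFinB lee_fin => h2.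
move: ex; rewrite (_ : t - s - t = - s); last ring.
move=> /ler_normlP[ex _].
have : (c - derive1 (phi x) t - 2 * e) * s <= 0 by clear -h1 h2 g1 ex; lra.
by rewrite pmulr_lle0// /e; clear -phic; lra.
Qed.
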